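(* Let $m\ge 1$ be an integer and let $G$ be a $(2m+8)$-connected graph. For two distinct edges $e_1,e_2\in E(G)$ and any distinct vertices $a_1,\ldots,a_m$ of $G-V(\{e_1,e_2\})$, there exists a cycle $C$ in $G-\{a_1,\ldots,a_m\}$ such that $\{e_1,e_2\}\subseteq E(C)$ and $G-V(C)$ is connected.
   Context: All graphs are finite and simple. $V(\{e_1,e_2\})$ is the set of end vertices of $e_1$ and $e_2$; for $S\subseteq V(G)$, $G-S$ is the subgraph induced on $V(G)\setminus S$. *)

(* Defs.v *)
(* A finite simple graph is a symmetric irreflexive relation
   e : rel T on a finType T (vertex set = T). *)
From mathcomp Require Import all_boot.
Set Implicit Arguments. Unset Strict Implicit. Unset Printing Implicit Defensive.

Definition induced_rel (T : finType) (e : rel T) (S : {set T}) : rel T :=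
  fun x y => [&& e x y, x \in S & y \in S].

Definition induced_connected (T : finType) (e : rel T) (S : {set T}) : Prop :=
  forall x y, x \in S -> y \in S -> connect (induced_rel e S) x y.

Definition k_connected (T : finType) (e : rel T) (k : nat) : Prop :=
  k < #|T| /\ forall X : {set T}, #|X| < k -> induced_connected e (~: X).

Definition is_cycle (T : finType) (e : rel T) (c : seq T) : Prop :=
  2 < size c /\ ucycle e c.

Definition cycle_edge (T : finType) (c : seq T) (x y : T) : bool :=
  (x \in c) && (y \in c) && ((next c x == y) || (next c y == x)).

(* Main.v *)
Require Import Defs.
From mathcomp Require Import all_boot zify.
From Stdlib Require Import Classical.
Set Implicit Arguments. Unset Strict Implicit. Unset Printing Implicit Defensive.

(** The vertices [X] = A + V(e1, e2) number at most c = m + 4, and the graph is 2c-connected. First,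
    [X] is linked: for disjoint S, U1, U2 in [X] with |U1| = |U2| <= 2 there are disjoint connected
    sets, one containing S and |U1| others joining U1 to U2. This is an edge-count argument in the
    style of Thomas and Wollan. In a minimal counterexample that is dense outside [X] and sparse
    behind smaller boundaries, no region behind a boundary of size at most |X| is linked to it.
    Contracting an edge loses one edge per common neighbour, so density forces every edge between
    a minimal region and its boundary into many triangles. To link the boundary of such a region,
    take in it a largest connected set K whose deletion keeps U1 and U2 linked. The rest of the
    region then consists of two paths without shortcuts or crossings. A vertex of S with no
    neighbour in K has all its neighbours on these paths, one of them shares few neighbours with it,
    and the triangle count makes that one adjacent to all of S: it can play the role of K.

    Applied to S = A, U1 = V(e1), U2 = V(e2), this yields a connected set containing A whose
    complement links the two edges. A largest such set leaves only two disjoint paths, and these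
    form with e1 and e2 the required cycle. *)

(** * Sets *)

(** Contraction shapes the invariant. After contracting an edge [x y], a region away from it may
    look too dense behind a boundary of |X| - 1 vertices, although in the uncontracted graph its
    boundary has |X| vertices, with [x] and [y] distinct, and each common neighbour of [x] and [y]
    in the region has one edge more. Such a region is again a dense instance once these extra edges
    are discounted; hence the twin, one adjacent pair in [X] whose common neighbours are counted
    apart. One twin suffices: an older twin inside the new boundary is kept, and one not inside it
    has no common neighbour in the region. In a pattern, the edge of the twin serves as a link or as
    an attachment.

    The triangle count does not exclude a region of two adjacent vertices complete to [c] boundary
    vertices. It offers two hubs where three disjoint connected sets may be required, so it need not
    be linked to its boundary; a third hub is then sought outside the region, and [X] is linked
    directly. *)

Section Sets.
Variable T : finType.
Implicit Types (A B : {set T}) (x : T).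

Lemma subset_at x A B : A \subset B -> (x \in A) ==> (x \in B).
Proof. by move=> /subsetP AB; apply/implyP/AB. Qed.

Lemma disjoint_at x A B : [disjoint A & B] -> ~~ ((x \in A) && (x \in B)).
Proof. by move=> dAB; apply/andP=> -[xA]; rewrite (disjointFr dAB xA). Qed.

Lemma eqset_at x A B : A = B -> ((x \in A) ==> (x \in B)) && ((x \in B) ==> (x \in A)).
Proof. by move=> ->; rewrite implybb. Qed.

Lemma mem_eq_at x y A : y \in A -> (x == y) ==> (x \in A).
Proof. by move=> yA; apply/implyP=> /eqP->. Qed.

Lemma notin_eq_at x y A : y \notin A -> (x == y) ==> (x \notin A).
Proof. by move=> yA; apply/implyP=> /eqP->. Qed.

Lemma disjointI A B : (forall x, x \in A -> x \in B -> False) -> [disjoint A & B].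
Proof. by move=> h; rewrite disjoint_subset; apply/subsetP=> x xA; apply/negP/h. Qed.

Lemma choose_in A (P : T -> T -> Prop) :
  (forall x, x \in A -> exists u, P x u) -> exists f, forall x, x \in A -> P x (f x).
Proof.
move=> h; apply: (@fin_all_exists _ _ (fun x u => x \in A -> P x u)) => x.
by have [/h [u Pu]|xA] := boolP (x \in A); [exists u | exists x].
Qed.

Lemma choose_mem A (F : T -> {set T}) B :
  (forall a, a \in A -> exists2 b, b \in F a & b \in B) ->
  exists f, forall a, a \in A -> f a \in F a /\ f a \in B.
Proof.
move=> h; apply: (choose_in (P := fun a z => z \in F a /\ z \in B)) => a /h[b bF bB].
by exists b.
Qed.

Lemma ex_set (P : T -> Prop) : exists A : {set T}, forall x, x \in A <-> P x.
Proof.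
have [f fP] : exists f : T -> bool, forall x, f x <-> P x.
  apply: (@fin_all_exists _ (fun=> bool) (fun x (b : bool) => b <-> P x)) => x.
  by case: (classic (P x)) => h; [exists true | exists false].
by exists [set x | f x] => x; rewrite inE.
Qed.

Lemma ex_min_nat (I : Type) (P : I -> Prop) (f : I -> nat) i0 : P i0 ->
  exists i, P i /\ forall j, P j -> f i <= f j.
Proof.
elim: {i0}_.+1 {-2}i0 (ltnSn (f i0)) => // n IH i fi Pi.
case: (classic (exists j, P j /\ f j < f i)) => [[j [Pj ji]]|no].
  by apply: (IH j) => //; apply: leq_trans ji _.
by exists i; split=> // j Pj; rewrite leqNgt; apply/negP=> lt; apply: no; exists j.
Qed.

Lemma ex_min_card (P : {set T} -> Prop) A0 : P A0 ->
  exists A, P A /\ forall B, P B -> #|A| <= #|B|.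
Proof. exact: ex_min_nat. Qed.

Lemma ex_max_card (P : {set T} -> Prop) A0 : P A0 ->
  exists A, P A /\ forall B, P B -> #|B| <= #|A|.
Proof.
move=> PA0; have [A [PA mA]] := ex_min_nat (fun A => #|~: A|) PA0.
exists A; split=> // B PB.
have := mA B PB; have := cardsC A; have := cardsC B; lia.
Qed.

Lemma card1_neq A x y : x \in A -> y \in A -> x != y -> 1 < #|A|.
Proof. by move=> xA yA xy; apply/card_gt1P; exists x, y. Qed.



End Sets.

Definition setE := (in_setU, in_setI, in_setD, in_setC, in_set1, in_set0, in_setT).

Lemma imply_bool (a b : bool) : a -> a ==> b -> b.
Proof. by case: a. Qed.

Lemma imply2_bool (a b c : bool) : (a -> b -> c) -> a ==> (b ==> c).
Proof. by case: a b c => -[] [] // /(_ isT isT). Qed.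

Definition allb (P : bool -> bool) := P true && P false.

Lemma allbP (P : bool -> bool) : allb P -> forall b, P b.
Proof. by move=> /andP[? ?] []. Qed.

Lemma falso_bool : is_true false -> False.
Proof. by []. Qed.

Lemma eq_bool (a b : bool) : (a ==> b) && (b ==> a) -> a = b.
Proof. by case: a b => -[]. Qed.

(* [setat x] decides a goal about membership of [x] from the inclusions, disjointness and equalities
   of sets in the context: it gathers their instances at [x] into one boolean formula, generalizes
   the atoms and evaluates it. *)
Ltac bprep :=
  lazymatch goal with
  | |- is_true (_ \subset _) -> _ => let H := fresh in move=> H; bprep
  | |- is_true [disjoint _ & _] -> _ => let H := fresh in move=> H; bprep
  | |- is_true _ -> _ => let H := fresh in move=> H; bprep; apply: (imply_bool H); clear H
  | |- (is_true _ -> is_true _) -> _ =>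
      let H := fresh in move=> H; bprep; apply: (imply_bool (introT implyP H)); clear H
  | |- (is_true _ -> is_true _ -> is_true _) -> _ =>
      let H := fresh in move=> H; bprep; apply: (imply_bool (imply2_bool H)); clear H
  | |- ~ is_true _ => let H := fresh in move=> H; bprep; apply: (imply_bool H); clear H
  | |- False => apply: falso_bool
  | |- @eq bool _ _ => apply: eq_bool
  | |- _ => idtac
  end.
Ltac atoms x :=
  bprep;
  repeat match goal with
  | H : is_true (_ \subset _) |- _ => apply: (imply_bool (subset_at x H)); clear H
  | H : is_true [disjoint _ & _] |- _ => apply: (imply_bool (disjoint_at x H)); clear H
  | H : @eq _ _ _ |- _ => apply: (imply_bool (eqset_at x H)); clear H
  | H : is_true (x \in _) |- _ => apply: (imply_bool H); clear H
  | H : is_true (x \notin _) |- _ => apply: (imply_bool H); clear H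
  | H : is_true (x \in _) -> is_true _ |- _ => apply: (imply_bool (introT implyP H)); clear H
  | H : is_true (x \in _) -> is_true _ -> is_true _ |- _ => apply: (imply_bool (imply2_bool H)); clear H
  | H : is_true (x \in _) \/ is_true _ |- _ => apply: (imply_bool (introT orP H)); clear H
  | H : is_true (_ || _) |- _ => apply: (imply_bool H); clear H
  | H : is_true (~~ (x == _)) |- _ => apply: (imply_bool H); clear H
  | H : is_true (~~ (_ == x)) |- _ => rewrite eq_sym in H; apply: (imply_bool H); clear H
  end;
  rewrite ?setE;
  repeat match goal with
  | H : is_true (?y \in ?A) |- context [@eq_op _ x ?y] => apply: (imply_bool (mem_eq_at x H)); clear H
  | H : is_true (?y \notin ?A) |- context [@eq_op _ x ?y] => apply: (imply_bool (notin_eq_at x H)); clear H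
  end;
  rewrite ?setE.
Ltac bcase :=
  bprep; repeat (match goal with
  | |- context [@in_mem ?T ?x ?A] => generalize (@in_mem T x A)
  | |- context [@eq_op ?T ?x ?y] => generalize (@eq_op T x y)
  end; apply: allbP);
  vm_compute; reflexivity.
Ltac setat x := atoms x; bcase.
Ltac subs := let x := fresh "x" in apply/subsetP=> x; setat x.
Ltac disj := let x := fresh "x" in apply: disjointI=> x; setat x.
Ltac seteq := let x := fresh "x" in apply/setP=> x; setat x.


(* zify is slow on set-theoretic hypotheses, which [lia] cannot use. *)
Ltac nlia :=
  repeat match goal with
  | H : is_true (_ \in _) |- _ => clear H
  | H : is_true (_ \notin _) |- _ => clear H
  | H : is_true (_ \subset _) |- _ => clear H
  | H : is_true (_ \proper _) |- _ => clear H
  | H : is_true [disjoint _ & _] |- _ => clear H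
  | H : is_true (_ != _) |- _ => clear H
  | H : @eq (set_of _) _ _ |- _ => clear H
  | H : forall _, _ |- _ => clear H
  | H : _ \/ _ |- _ => clear H
  end; lia.

(** * Connected vertex sets *)

Section Conn.
Variable T : finType.
Implicit Types (e : rel T) (A B C D V W R Z : {set T}) (x y : T).

Definition closed_in e W Z : Prop := forall x y, x \in Z -> y \in W -> e x y -> y \in Z.

(* Stated with closed sets rather than paths, so that unions are easy. *)
Variant conn e D : Prop :=
  Conn of forall Z, Z != set0 -> Z \subset D -> closed_in e D Z -> D \subset Z.

(* Locked so that [inE] does not unfold it. *)
Fact nb_key : unit. Proof. exact: tt. Qed.
Definition nb e V R := locked_with nb_key [set y in V :\: R | [exists z in R, e z y]].

Lemma nbP e V R y : reflect (y \in V /\ y \notin R /\ exists2 z, z \in R & e z y) (y \in nb e V R).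
Proof.
rewrite [nb _ _ _]locked_withE !inE; apply: (iffP andP) => [[/andP[yR yV] /existsP[z /andP[zR zy]]]|[yV [yR [z zR zy]]]].
  by split=> //; split=> //; exists z.
by split; [rewrite yR|apply/existsP; exists z; rewrite zR].
Qed.

Lemma nb_sub e V R : nb e V R \subset V :\: R.
Proof. by apply/subsetP=> y /nbP[yV [yR _]]; rewrite inE yR. Qed.

Lemma nb_subV e V R : nb e V R \subset V.
Proof. by have := nb_sub e V R => h; subs. Qed.

Lemma nb_disj e V R : [disjoint nb e V R & R].
Proof. by have := nb_sub e V R => h; disj. Qed.

Lemma nb_in e V R x y : x \in R -> e x y -> y \in V -> y \notin R -> y \in nb e V R.
Proof. by move=> xR xy yV yR; apply/nbP; split=> //; split=> //; exists x. Qed.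

Lemma conn0 e : conn e set0.
Proof. by split=> Z _ _ _; exact: sub0set. Qed.

Lemma conn1 e x : conn e [set x].
Proof.
split=> Z /set0Pn[z zZ] Zx _; have := subsetP Zx z zZ; rewrite inE => /eqP zx.
by rewrite sub1set -zx.
Qed.

Lemma conn_mono e e' D : (forall x y, x \in D -> y \in D -> e x y -> e' x y) ->
  conn e D -> conn e' D.
Proof.
move=> ee' [cD]; split=> Z Z0 ZD clZ; apply: cD => // x y xZ yD xy.
by apply: (clZ x) => //; apply: ee' => //; apply: (subsetP ZD).
Qed.

Lemma conn_meet e A D Z : conn e A -> A \subset D -> closed_in e D Z ->
  (exists2 x, x \in A & x \in Z) -> A \subset Z.
Proof.
move=> [cA] AD clZ [x xA xZ].
have : A \subset A :&: Z.
  apply: cA; [by apply/set0Pn; exists x; rewrite inE xA | by subs | ].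
  move=> y z; rewrite !inE => /andP[_ yZ] zA yz; rewrite zA /=.
  by apply: (clZ y) => //; apply: (subsetP AD).
by move=> h; subs.
Qed.

Lemma conn_cover e A D : conn e A -> A \subset D -> A != set0 ->
  (forall b, b \in D -> b \notin A ->
     exists C, [/\ conn e C, C \subset D, b \in C & exists2 x, x \in C & x \in A]) ->
  conn e D.
Proof.
move=> cA AD A0 h; split=> Z /set0Pn[z zZ] ZD clZ.
suff AZ : A \subset Z.
  apply/subsetP=> b bD; have [bA|bA] := boolP (b \in A); first exact: (subsetP AZ).
  have [C [cC CD bC [x xC xA]]] := h b bD bA.
  by apply: (subsetP (conn_meet cC CD clZ _)) => //; exists x => //; apply: (subsetP AZ).
have zD := subsetP ZD z zZ.
apply: (conn_meet cA AD clZ).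
have [zA|zA] := boolP (z \in A); first by exists z.
have [C [cC CD zC [x xC xA]]] := h z zD zA.
exists x => //; apply: (subsetP (conn_meet cC CD clZ _)) => //; by exists z.
Qed.

Lemma connU_meet e A B : conn e A -> conn e B -> (exists2 x, x \in A & x \in B) ->
  conn e (A :|: B).
Proof.
move=> cA cB [x xA xB]; apply: (conn_cover cA); first exact: subsetUl.
  by apply/set0Pn; exists x.
move=> b; rewrite inE => /orP[->//|bB] _; exists B; split=> //; first exact: subsetUr.
by exists x.
Qed.

Lemma conn2 e x y : symmetric e -> e x y -> conn e [set x; y].
Proof.
move=> es xy; split=> Z /set0Pn[z zZ] Zs cl.
have := subsetP Zs z zZ; rewrite !inE => zxy.
have xZ : x \in Z.
  case/orP: zxy => /eqP zE; first by rewrite -zE.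
  by apply: (cl z) => //; [rewrite !inE eqxx | rewrite zE es].
have yZ : y \in Z by apply: (cl x) => //; rewrite !inE eqxx orbT.
by apply/subsetP=> w; rewrite !inE => /orP[]/eqP->.
Qed.

Lemma connU_edge e A B x y : symmetric e -> conn e A -> conn e B ->
  x \in A -> y \in B -> e x y -> conn e (A :|: B).
Proof.
move=> es cA cB xA yB xy.
have c1 : conn e (A :|: [set x; y]).
  by apply: connU_meet => //; [apply: conn2|exists x => //; rewrite !inE eqxx].
suff -> : A :|: B = (A :|: [set x; y]) :|: B.
  by apply: connU_meet => //; exists y => //; rewrite !inE eqxx !orbT.
apply/setP=> z; rewrite !inE; case: (z =P x) => [->|_]; first by rewrite xA.
by case: (z =P y) => [->|_]; rewrite ?yB ?orbT ?orbF.
Qed.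

Lemma conn_add1 e A x y : symmetric e -> conn e A -> x \in A -> e x y -> conn e (y |: A).
Proof.
move=> es cA xA xy; rewrite setUC; have := connU_edge es cA (conn1 e y) xA (set11 y) xy; exact: id.

Qed.

Lemma conn_connect e D x y : conn e D -> x \in D -> y \in D -> connect (induced_rel e D) x y.
Proof.
move=> [cD] xD yD.
suff : D \subset [set z in D | connect (induced_rel e D) x z].
  by move/subsetP/(_ y yD); rewrite inE yD.
apply: cD; first by apply/set0Pn; exists x; rewrite inE xD connect0.
  by apply/subsetP=> z; rewrite inE => /andP[].
move=> u v; rewrite !inE => /andP[uD xu] vD uv; rewrite vD /=.
by apply: connect_trans xu _; apply: connect1; rewrite /induced_rel uv uD.
Qed.

Lemma connect_closed e W Z x y : closed_in e W Z -> x \in Z ->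
  connect (induced_rel e W) x y -> y \in Z.
Proof.
move=> cl xZ /connectP[p]; elim: p x xZ => [|z p IH] x xZ /=; first by move=> _ ->.
by move=> /andP[/and3P[xz xW zW] zp]; apply: IH => //; apply: cl xz.
Qed.

Lemma induced_conn e D : (forall x y, x \in D -> y \in D -> connect (induced_rel e D) x y) ->
  conn e D.
Proof.
move=> h; split=> Z /set0Pn[z zZ] ZD cl; apply/subsetP=> y yD.
by apply: (connect_closed cl zZ); apply: h => //; apply: (subsetP ZD).
Qed.

Fact reach_key : unit. Proof. exact: tt. Qed.
Definition reach e W A :=
  locked_with reach_key [set y in W | [exists a in A :&: W, connect (induced_rel e W) a y]].

Lemma reachP e W A y : reflect (y \in W /\ exists a, [/\ a \in A, a \in W & connect (induced_rel e W) a y])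
  (y \in reach e W A).
Proof.
rewrite [reach _ _ _]locked_withE inE; apply: (iffP andP) => -[yW].
  by case/existsP=> a; rewrite inE => /andP[/andP[? ?] ?]; split=> //; exists a.
by case=> a [aA aW ay]; split=> //; apply/existsP; exists a; rewrite inE aA aW.
Qed.

Lemma reach_sub e W A : reach e W A \subset W.
Proof. by apply/subsetP=> y /reachP[]. Qed.

Lemma reach_self e W A x : x \in A -> x \in W -> x \in reach e W A.
Proof. by move=> xA xW; apply/reachP; split=> //; exists x; split=> //; exact: connect0. Qed.

Lemma reach_closed e W A : closed_in e W (reach e W A).
Proof.
move=> x y /reachP[xW [a [aA aW ax]]] yW xy; apply/reachP; split=> //; exists a; split=> //.
by apply: connect_trans ax _; apply: connect1; rewrite /induced_rel xy xW.
Qed.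

Lemma reach_min e W A Z : (forall a, a \in A -> a \in W -> a \in Z) -> closed_in e W Z ->
  reach e W A \subset Z.
Proof.
move=> h cl; apply/subsetP=> y /reachP[yW [a [aA aW ay]]].
by apply: (connect_closed cl _ ay); apply: h.
Qed.

Lemma conn_reach1 e W x : symmetric e -> conn e (reach e W [set x]).
Proof.
move=> es; split=> Z /set0Pn[z zZ] Zs cl.
have clW : closed_in e W Z.
  move=> u v uZ vW uv; apply: (cl u) => //; apply: (reach_closed _ vW uv); exact: (subsetP Zs).
have /reachP[_ [a [aE aW]]] := subsetP Zs z zZ; have := aE; rewrite inE => /eqP ax az.
apply: reach_min => // x'; rewrite inE => /eqP-> _; rewrite -ax.
apply: (connect_closed clW zZ).
rewrite -(sym_connect_sym (e := induced_rel e W)) // => u v.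
by rewrite /induced_rel es [(u \in W) && _]andbC.
Qed.

Lemma conn_path e D x y : conn e D -> x \in D -> y \in D ->
  exists p, [/\ path e x p, last x p = y, uniq (x :: p) & {subset x :: p <= D}].
Proof.
move=> cD xD yD; have /connectP[p0 pp0 ->] := conn_connect cD xD yD.
case/shortenP: pp0 => p pp up _; exists p; split=> //.
  by apply: sub_path pp => u v /andP[].
move=> z; rewrite inE => /orP[/eqP->//|]; elim: p x pp {xD up} => //= w p IH u.
by move=> /andP[/and3P[_ _ wD] wp]; rewrite inE => /orP[/eqP->//|]; apply: IH wp.
Qed.

Lemma conn_exit e D Z : conn e D -> (exists2 x, x \in D & x \in Z) -> ~~ (D \subset Z) ->
  exists x y, [/\ x \in D, x \in Z, y \in D, y \notin Z & e x y].
Proof.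
move=> cD meet nDZ; apply: NNPP => no; case/negP: nDZ.
suff h : D \subset Z :&: D by subs.
apply: (conn_meet cD (subxx _)); last by case: meet => x xD xZ; exists x; rewrite // inE xZ.
move=> x y; rewrite !inE => /andP[xZ xD] yD xy; rewrite yD andbT.
by apply: contraT => yZ; case: no; exists x, y.
Qed.
End Conn.

(** * Linkages and Menger's theorem *)

Section Link.
Variable T : finType.
Implicit Types (e : rel T) (A B C W R S U Z : {set T}) (x y : T) (D : T -> {set T}).

(** Links are connected sets rather than paths, so that composing links or undoing a contraction is
    taking unions. Paths are extracted only where their order matters, in [linkable_path_pair]. *)
Definition linkage e W A B D : Prop :=
  [/\ forall a, a \in A -> [/\ a \in D a, D a \subset W & conn e (D a)],
      forall a, a \in A -> exists2 b, b \in D a & b \in B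
    & forall a a' x, a \in A -> a' \in A -> x \in D a -> x \in D a' -> a = a'].

Definition linkable e W A B : Prop := exists D, linkage e W A B D.

Lemma linkage_mono e W W' A B D : W \subset W' -> linkage e W A B D -> linkage e W' A B D.
Proof.
move=> WW [h1 h2 h3]; split=> // a /h1[aD DW cD]; split=> //; exact: subset_trans DW WW.
Qed.

Lemma linkable_mono e W W' A B : W \subset W' -> linkable e W A B -> linkable e W' A B.
Proof. by move=> WW [D /(linkage_mono WW)]; exists D. Qed.

Lemma linkage_fam e W B U D (f : T -> T) :
  (forall u, u \in U -> [/\ f u \in D u, D u \subset W & conn e (D u)]) ->
  (forall u, u \in U -> exists2 b, b \in D u & b \in B) ->
  (forall u u' x, u \in U -> u' \in U -> x \in D u -> x \in D u' -> u = u') ->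
  linkable e W (f @: U) B.
Proof.
move=> h1 h2 h3.
have [g gP] := choose_in (P := fun b u => u \in U /\ f u = b)
  (fun b bU => let: ex_intro2 u uU bE := imsetP bU in ex_intro _ u (conj uU (esym bE))).
exists (fun b => D (g b)); split.
- move=> b /gP[gU gE]; have [] := h1 _ gU; rewrite gE; by split.
- by move=> b /gP[gU _]; exact: h2.
- by move=> b b' x /gP[gU gE] /gP[gU' gE'] xD xD'; rewrite -gE -gE' (h3 _ _ _ gU gU' xD xD').
Qed.

Lemma linkage_comp e W1 W2 A S B D1 D2 : linkage e W1 A S D1 -> linkage e W2 S B D2 ->
  (forall x, x \in W1 -> x \in W2 -> x \in S) -> #|S| <= #|A| -> linkable e (W1 :|: W2) A B.
Proof.
move=> [a1 a2 a3] [b1 b2 b3] WW SA.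
have [s sP] := choose_mem a2.
exists (fun a => D1 a :|: D2 (s a)); split.
- move=> a aA; have [aD DW cD] := a1 a aA; have [sD sS] := sP a aA; have [sD2 D2W cD2] := b1 _ sS.
  split; first by rewrite inE aD.
    by apply: setUSS.
  by apply: connU_meet => //; exists (s a).
- by move=> a aA; have [_ /b2[b bD bB]] := sP a aA; exists b; rewrite // inE bD orbT.
(* A point shared by a first half and a second half lies in [S]; it is then the source of its second
   half, so both halves belong to the same link. *)
have cross a a' x : a \in A -> a' \in A -> x \in D1 a -> x \in D2 (s a') -> a = a'.
  move=> aA aA' xD xD'; have [sD' sS'] := sP _ aA'.
  have xS : x \in S.
    apply: WW; first by have [_ /subsetP DW _] := a1 a aA; apply: DW.
    by have [_ /subsetP DW _] := b1 _ sS'; apply: DW.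
  have [xx _ _] := b1 _ xS; have xE := b3 _ _ _ xS sS' xx xD'; subst x.
  exact: (a3 _ _ _ aA aA' xD sD').
move=> a a' x aA aA'; have [sD sS] := sP a aA; have [sD' sS'] := sP _ aA'.
rewrite !inE => /orP[xD|xD] /orP[xD'|xD']; first exact: (a3 _ _ x).
- exact: (cross _ _ x).
- by symmetry; apply: (cross _ _ x).
have sE := b3 _ _ _ sS sS' xD xD'; rewrite sE in sD; exact: (a3 _ _ (s a')).
Qed.

Lemma linkageU e W W' A A' B B' : [disjoint W & W'] -> linkable e W A B -> linkable e W' A' B' ->
  linkable e (W :|: W') (A :|: A') (B :|: B').
Proof.
move=> dW [D [a1 a2 a3]] [D' [b1 b2 b3]].
have AW a : a \in A -> a \in W by move=> aA; have [aD /subsetP DW _] := a1 a aA; apply: DW.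
have AW' a : a \in A' -> a \in A = false.
  move=> aA; have [aD /subsetP DW _] := b1 a aA; have aW' := DW _ aD.
  by apply/negP=> /AW aW; rewrite (disjointFr dW aW) in aW'.
exists (fun a => if a \in A then D a else D' a); split.
- move=> a; rewrite inE; have [aA _|_ /= aA] := boolP (a \in A).
    have [? DW ?] := a1 a aA; split=> //; exact: subset_trans (subsetUl _ _).
  have [? DW ?] := b1 a aA; split=> //; exact: subset_trans (subsetUr _ _).
- move=> a; rewrite inE; have [aA _|_ /= aA] := boolP (a \in A).
    by have [b ? bB] := a2 a aA; exists b; rewrite // inE bB.
  by have [b ? bB] := b2 a aA; exists b; rewrite // inE bB orbT.
have cross a a' x : a \in A -> a' \in A' -> x \in D a -> x \in D' a' -> a = a'.
  move=> /a1[_ /subsetP DW _] /b1[_ /subsetP DW' _] /DW xW /DW'.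
  by rewrite (disjointFr dW xW).
move=> a a' x; rewrite !inE.
have [aA _|_ /= aA] := boolP (a \in A); have [aA' _|_ /= aA'] := boolP (a' \in A).
- exact: (a3 _ _ x).
- exact: (cross _ _ x).
- by move=> ? ?; symmetry; apply: (cross _ _ x).
- exact: (b3 _ _ x).
Qed.

Lemma linkage_id e W A B : A \subset W -> A \subset B -> linkable e W A B.
Proof.
move=> AW AB; exists (fun a => [set a]); split.
- by move=> a aA; split; rewrite ?inE // ?sub1set ?(subsetP AW) //; exact: conn1.
- by move=> a aA; exists a; rewrite ?inE ?(subsetP AB).
- by move=> a a' x _ _; rewrite !inE => /eqP-> /eqP->.
Qed.

(* [Z] certifies that [C] separates [A] from [B] in [W]. *)
Definition separates e W A B C Z : Prop :=
  [/\ Z \subset W :\: C, A :\: C \subset Z, closed_in e (W :\: C) Z & [disjoint Z & B]].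

(** Induction on |W|. A separator of size |A| other than [A] and [B] cuts the problem into two
    smaller ones. Without such a separator there is enough slack to delete a vertex, or both ends of
    an edge that is itself a link. *)
Theorem menger e W A B : symmetric e -> A \subset W -> B \subset W ->
  (forall C Z, C \subset W -> separates e W A B C Z -> #|A| <= #|C|) -> linkable e W A B.
Proof.
move=> es; elim: {W}_.+1 {-2}W A B (ltnSn #|W|) => // n IH W A B Wn AW BW sepW.
set k := #|A|.
(* [B] is itself a separator, certified by everything outside it. *)
have BA : k <= #|B|.
  apply: (sepW _ (W :\: B)) => //; split=> //; first by subs.
  by disj.
case: (classic (exists S Z, [/\ S \subset W, separates e W A B S Z, #|S| = k, S != A & S != B]))
  => [[S [L [SW [LW AL clL LB] Sk SA SB]]]|noS].
  pose R := W :\: S :\: L.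
  have L0 : L != set0.
    apply: contraNneq SA => L0; rewrite L0 in AL.
    by rewrite eq_sym eqEcard Sk leqnn andbT; subs.
  have R0 : R != set0.
    apply: contraNneq SB => R0.
    rewrite eq_sym eqEcard Sk BA andbT; apply/subsetP=> x xB.
    have := disjoint_at x LB; have := eqset_at x R0; have := subset_at x BW.
    by rewrite !inE xB; bcase.
  have LSR : L :|: S \proper W.
    apply/properP; split; first by subs.
    have /set0Pn[x] := R0; rewrite !inE => /andP[xL /andP[xS xW]].
    by exists x; rewrite // inE negb_or xL.
  have RSL : R :|: S \proper W.
    apply/properP; split; first by rewrite /R; subs.
    have /set0Pn[x xL] := L0; exists x; first by setat x.
    by rewrite !inE xL /=; setat x.
  have [D1 D1P] : linkable e (L :|: S) A S.
    apply: IH; [have := proper_card LSR; nlia | by subs | by subs | ].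
    move=> C Z CW [ZW AZ clZ ZS]; apply: (sepW C Z); first by subs.
    split=> //; [by subs | | by apply: disjointI => x xZ xB;
       have := disjoint_at x LB; have := disjoint_at x ZS; have := subset_at x ZW;
       rewrite !inE xZ xB; bcase].
    move=> x y xZ yW xy; apply: (clZ x y xZ _ xy).
    have xL : x \in L by setat x.
    have [yS|yS] := boolP (y \in S); first by move: yW; rewrite !inE yS orbT => /andP[->].
    have yL : y \in L by apply: (clL x y xL _ xy); setat y.
    by setat y.
  have [D2 D2P] : linkable e (R :|: S) S B.
    apply: IH; [have := proper_card RSL; nlia | by subs | | ].
      by rewrite /R; apply/subsetP=> x xB; setat x.
    move=> C Z CW [ZW AZ clZ ZS]; rewrite Sk; apply: (sepW C (Z :|: (L :\: C))).
      by rewrite /R in CW; subs.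
    rewrite /R in ZW; split; [by subs | by subs | | by disj].
    move=> x y; rewrite inE => xZL yW xy.
    have [yL|yL] := boolP (y \in L); first by setat y.
    have yRS : y \in (R :|: S) :\: C by rewrite /R; setat y.
    have yZ : y \in S -> y \in Z by move=> yS; setat y.
    case/orP: xZL => [xZ|xL]; first by rewrite inE (clZ x y).
    have [/yZ yS|yS] := boolP (y \in S); first by rewrite inE yS.
    case/negP: yL; apply: (clL x y _ _ xy); [by setat x | by setat y].
  apply: (@linkable_mono _ (L :|: S :|: (R :|: S))); first by rewrite /R; subs.
  apply: linkage_comp D1P D2P _ _; last by rewrite Sk.
  by move=> x; rewrite /R; setat x.
have big S Z : S \subset W -> separates e W A B S Z -> S != A -> S != B -> k < #|S|.
  move=> SW sS SA SB; rewrite ltn_neqAle (sepW S Z) // andbT; apply: contra_notN noS => /eqP kS.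
  by exists S, Z; split.
have del1 v : v \in W -> v \notin A -> (v \in B -> k < #|B|) -> linkable e W A B.
  move=> vW vA vB.
  have [D DP] : linkable e (W :\ v) A (B :\ v); last first.
    have [a1 a2 a3] := linkage_mono (subsetDl W [set v]) DP; exists D; split=> // a /a2[b bD].
    by rewrite inE => /andP[_ bB]; exists b.
  apply: IH.
  - by have := cardsD1 v W; rewrite vW; nlia.
  - apply/subsetP=> x xA; rewrite !inE (subsetP AW) // andbT.
    by apply: contraNneq vA => <-.
  - by apply: setSD.
  move=> C Z CW [ZW AZ clZ ZB].
  have vC : v \notin C by apply/negP=> /(subsetP CW); rewrite !inE eqxx.
  have vZ : v \notin Z by apply/negP=> /(subsetP ZW); rewrite !inE eqxx andbF.
  have WE : W :\: (v |: C) = W :\ v :\: C by apply/setP=> x; rewrite !inE negb_or; bcase.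
  suff : k < #|v |: C| by rewrite cardsU1 vC.
  have sW : separates e W A B (v |: C) Z.
    rewrite /separates WE; split=> //; first by subs.
    apply: disjointI => x xZ xB; have := disjoint_at x ZB; rewrite !inE xZ xB /= andbT.
    by move/negbNE/eqP=> xv; rewrite xv (negPf vZ) in xZ.
  have [E|ne] := eqVneq (v |: C) B.
    by rewrite E; apply: vB; rewrite -E !inE eqxx.
  apply: (big _ Z) => //; first by rewrite subUset sub1set vW; subs.
  by apply: contraNneq vA => <-; rewrite !inE eqxx.
have [W0|/set0Pn[v]] := eqVneq (W :\: (A :|: B)) set0; last first.
  rewrite !inE negb_or => /andP[/andP[vA vB] vW].
  by apply: (del1 v) => //; rewrite (negPf vB).
have [BA'|/set0Pn[b]] := eqVneq (B :\: A) set0.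
  apply: linkage_id => //.
  suff <- : B = A by [].
  by apply/eqP; rewrite eqEcard BA andbT; apply/subsetP=> x xB; have := eqset_at x BA'; setat x.
rewrite inE => /andP[bA bB].
have [ltB|geB] := ltnP k #|B|.
  by apply: (del1 b) => //; apply: (subsetP BW).
have Bk : #|B| = k by nlia.
(* Now W = A :|: B and |A| = |B|. Without an edge [a c], A :&: B separates and must be all of [A].
   With one, a separator of the rest together with [a] and [c] differs from [A], as it contains [c],
   and from [B], as it contains [a]; so it has more than [k] vertices. *)
case: (classic (exists a c, [/\ a \in A :\: B, c \in B :\: A & e a c])) => [[a [c [aAB cBA ac]]]|noe]; last first.
  apply: linkage_id => //.
  have : k <= #|A :&: B|.
    apply: (sepW _ (A :\: B)); first by subs.
    split; [by subs | by subs | | by disj].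
    move=> x y xAB yW xy; have [yA|yA] := boolP (y \in A); first by setat y.
    case: noe; exists x, y; split=> //; have := eqset_at y W0; setat y.
  by move=> le; apply/setIidPl/eqP; rewrite eqEcard subsetIl.
have aA : a \in A by setat a.
have cB : c \in B by setat c.
have aB : a \notin B by setat a.
have cA : c \notin A by setat c.
have ane : a != c by apply: contraNneq cA => <-.
have k0 : 0 < k by rewrite /k (cardsD1 a) aA.
have Ak : k = #|A :\ a|.+1 by rewrite /k (cardsD1 a) aA.
have : linkable e (W :\ a :\ c) (A :\ a) (B :\ c).
  apply: IH.
  - have := cardsD1 a W; rewrite (subsetP AW) //; have := cardsD1 c (W :\ a); nlia.
  - by apply/subsetP=> x xA; move: (xA); rewrite !inE => /andP[-> xA']; rewrite (subsetP AW) // andbT andbT; apply: contraNneq cA => <-.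
  - by apply/subsetP=> x xA; move: (xA); rewrite !inE => /andP[-> xA']; rewrite (subsetP BW) // andbT /=; apply: contraNneq aB => <-.
  move=> C Z CW [ZW AZ clZ ZB].
  have cC : c \notin C by apply/negP=> /(subsetP CW); rewrite !inE eqxx.
  have cZ : c \notin Z by apply/negP=> /(subsetP ZW); rewrite !inE eqxx andbF.
  have aC : a \notin C by apply/negP=> /(subsetP CW); rewrite !inE eqxx andbF.
  have WE : W :\: (a |: (c |: C)) = W :\ a :\ c :\: C.
    by apply/setP=> x; rewrite !inE !negb_or; bcase.
  suff : k < #|a |: (c |: C)|.
    by rewrite !cardsU1 cC !inE negb_or aC ane /=; nlia.
  apply: (big _ Z).
  - by rewrite !subUset !sub1set (subsetP AW) // (subsetP BW) //=; subs.
  - rewrite /separates WE; split=> //; first by subs.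
    apply: disjointI => x xZ xB; have := disjoint_at x ZB; rewrite !inE xZ xB /= andbT.
    by move/negbNE/eqP=> xv; rewrite xv (negPf cZ) in xZ.
  - by apply: contraNneq cA => <-; rewrite !inE eqxx orbT.
  - by apply: contraNneq aB => <-; rewrite !inE eqxx.
have : linkable e [set a; c] [set a] [set c].
  exists (fun _ => [set a; c]); split.
  - by move=> x; rewrite inE => /eqP->; split=> //; [rewrite !inE eqxx|exact: conn2].
  - by move=> x _; exists c; rewrite !inE ?eqxx ?orbT.
  - by move=> x y z; rewrite !inE => /eqP-> /eqP->.
move=> l1 l2.
have := linkageU _ l1 l2.
rewrite !setD1K //; move=> H; apply: (linkable_mono _ (H _)).
  by rewrite !subUset !sub1set (subsetP AW) // (subsetP BW) //=; subs.
by apply: disjointI => x; rewrite !inE => /orP[]/eqP->; rewrite eqxx /= ?andbF.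
Qed.
End Link.

(** * Linked sets *)

Section Solv.
Variable T : finType.
Implicit Types (e : rel T) (A B V W R S U X Z : {set T}) (x y : T) (D : T -> {set T}).

Definition solvable e V X S U1 U2 : Prop := exists T0 D,
  [/\ conn e T0, S \subset T0, T0 \subset V :\: (X :\: S)
    & linkage e (V :\: T0 :\: (X :\: (U1 :|: U2))) U1 U2 D].

(** Fewer than two pairs must be allowed: this happens when the two edges of the theorem share an
    end, when the edge of a twin is used as a link, and when only some links enter a region. *)
Definition pattern X S U1 U2 : Prop :=
  [/\ S \subset X, U1 \subset X, U2 \subset X &
      [/\ [disjoint S & U1], [disjoint S & U2], [disjoint U1 & U2], #|U1| = #|U2| & #|U1| <= 2]].

Definition linked e V X : Prop := forall S U1 U2, pattern X S U1 U2 -> solvable e V X S U1 U2.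

Lemma linkable_tgt e W A B B' : B \subset B' -> linkable e W A B -> linkable e W A B'.
Proof.
move=> /subsetP BB [D [h1 h2 h3]]; exists D; split=> // a /h2[b bD bB]; exists b => //; exact: BB.
Qed.

(** A step of [A] along an edge inside [B] is bypassed through [A'], which contains every vertex of
    [A] in [B]. *)
Lemma conn_clique e e1 B A A' : conn e1 A -> conn e A' -> A :&: B \subset A' ->
  (forall x y, e1 x y -> e x y \/ x \in B /\ y \in B) ->
  (exists2 x, x \in A & x \in B) -> conn e (A :|: A').
Proof.
move=> cA cA' sub e1P [x0 x0A x0B]; split=> Z /set0Pn[z zZ] ZA cl.
have BA x : x \in A -> x \in B -> x \in A' by move=> xA xB; setat x.
have full : (exists2 z, z \in A' & z \in Z) -> A :|: A' \subset Z.
  move=> meet; have AZ := conn_meet cA' (subsetUr A A') cl meet.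
  rewrite subUset AZ andbT; apply: (conn_meet cA (subxx _)).
    move=> x y xZ yA /e1P[xy|[_ yB]]; last by apply: (subsetP AZ); exact: BA.
    by apply: (cl x) => //; rewrite inE yA.
  by exists x0 => //; apply: (subsetP AZ); exact: BA.
case: (classic (exists2 z, z \in A' & z \in Z)) => [//|no].
have noA' x : x \in Z -> x \in A.
  move=> xZ; have := subsetP ZA x xZ; rewrite inE => /orP[//|xA'].
  by case: no; exists x.
suff AZ : A \subset Z by apply: full; exists x0; [exact: BA | exact: (subsetP AZ)].
apply: (conn_meet cA (subxx _)); last by exists z => //; exact: noA'.
move=> x y xZ yA /e1P[xy|[xB _]]; first by apply: (cl x) => //; rewrite inE yA.
by case: no; exists x => //; apply: BA => //; exact: noA'.
Qed.

Definition add_clique e B : rel T := fun x y => e x y || [&& x != y, x \in B & y \in B].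

(* A linking set that uses clique edges breaks into components; those of its two ends reach the
   boundary, and the region supplies the missing link between them. *)
Lemma linked_replace e V X R : symmetric e -> R \subset V :\: X -> X \subset V ->
  linked e (R :|: nb e V R) (nb e V R) ->
  linked (add_clique e (nb e V R)) (V :\: R) X ->
  linked e V X.
Proof.
move=> es RV XV; have BV : nb e V R \subset V :\: R by apply: nb_sub.
set B := nb e V R in BV * => lR lV S U1 U2 [SX U1X U2X [dS1 dS2 d12 cU c2]].
have [//|T0 [D [cT ST TV [d1 d2 d3]]]] := lV S U1 U2.
have [w wP] := choose_mem d2.
have e1P x y : add_clique e B x y -> e x y \/ x \in B /\ y \in B.
  by move=> /orP[->|/and3P[_ -> ->]]; [left|right].
pose A u := reach e (D u) [set u].
pose Q u := reach e (D u) [set w u].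
have AD u : A u \subset D u by apply: reach_sub.
have QD u : Q u \subset D u by apply: reach_sub.
have AxD u x : x \in A u -> x \in D u by apply: (subsetP (AD u)).
have QxD u x : x \in Q u -> x \in D u by apply: (subsetP (QD u)).
have cA u : conn e (A u) by apply: conn_reach1.
have cQ u : conn e (Q u) by apply: conn_reach1.
have uA u : u \in U1 -> u \in A u by move=> /d1[uD _ _]; apply: reach_self; rewrite ?inE.
have wQ u : u \in U1 -> w u \in Q u by move=> /wP[wD _]; apply: reach_self; rewrite ?inE.
(* [N] collects the links that cannot do without clique edges. For such a link the component [A u]
   of its source and the component [Q u] of its end are disjoint, and each reaches the boundary. *)
pose N := [set u in U1 | w u \notin A u].
have NU : N \subset U1 by apply/subsetP=> u; rewrite inE => /andP[].
have AQ u x : u \in N -> x \in A u -> x \in Q u -> False.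
  rewrite inE => /andP[uU /negP wA] xA xQ; apply: wA.
  apply: (subsetP (conn_meet (cQ u) (QD u) (@reach_closed _ e (D u) [set u]) _)); last exact: wQ.
  by exists x.
have sel (F : T -> {set T}) u : u \in N -> F u \subset D u -> closed_in e (D u) (F u) -> (exists2 z, z \in D u & z \in F u) ->
    ~~ (D u \subset F u) -> exists z, z \in F u /\ z \in B.
  move=> uN FD cl meet nDF; have uU := subsetP NU u uN; have [_ _ cD] := d1 u uU.
  have [x [y [xD xF yD yF /e1P[xy|[xB _]]]]] := conn_exit cD meet nDF; last by exists x.
  by rewrite (cl x y) in yF.
have [s sP] : exists s : T -> T, forall u, u \in N -> s u \in A u /\ s u \in B.
  apply: (choose_in (P := fun u z => z \in A u /\ z \in B)) => u uN.
  have uU := subsetP NU u uN; have [uD _ _] := d1 u uU; apply: (sel A) => //; [exact: reach_closed | by exists u => //; exact: uA |].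
  apply/negP=> h; have [wD _] := wP u uU; move: uN; rewrite inE => /andP[_ /negP]; apply.
  exact: (subsetP h).
have [t tP] : exists t : T -> T, forall u, u \in N -> t u \in Q u /\ t u \in B.
  apply: (choose_in (P := fun u z => z \in Q u /\ z \in B)) => u uN.
  have uU := subsetP NU u uN; have [uD _ _] := d1 u uU.
  have [wD _] := wP u uU.
  apply: (sel Q) => //; [exact: reach_closed | by exists (w u) => //; exact: wQ |].
  apply/negP=> h; apply: (AQ u u uN); [exact: uA | exact: (subsetP h)].
have inj (f : T -> T) : (forall u, u \in N -> f u \in D u) -> {in N &, injective f}.
  move=> h u v uN vN E; apply: (d3 u v (f u)); rewrite ?(subsetP NU) ?h //.
  by rewrite E h.
have sD u : u \in N -> s u \in D u by move=> /sP[h _]; apply: (subsetP (AD u)).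
have tD u : u \in N -> t u \in D u by move=> /tP[h _]; apply: (subsetP (QD u)).
have sinj := inj _ sD; have tinj := inj _ tD.
pose W0 := V :\: R :\: T0 :\: (X :\: (U1 :|: U2)).
have DW u x : u \in U1 -> x \in D u -> x \in W0 by move=> /d1[_ /subsetP h _]; apply: h.
have sW : s @: N \subset W0.
  by apply/subsetP=> _ /imsetP[u uN ->]; apply: (DW u); [exact: (subsetP NU)|exact: sD].
have tW : t @: N \subset W0.
  by apply/subsetP=> _ /imsetP[u uN ->]; apply: (DW u); [exact: (subsetP NU)|exact: tD].
have sB : s @: N \subset B by apply/subsetP=> _ /imsetP[u uN ->]; have [] := sP u uN.
have tB : t @: N \subset B by apply/subsetP=> _ /imsetP[u uN ->]; have [] := tP u uN.
have dd u v x : u \in U1 -> v \in U1 -> x \in D u -> x \in D v -> u = v by move=> *; apply: (d3 _ _ x).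
have dst : [disjoint s @: N & t @: N].
  apply: disjointI => x /imsetP[u uN ->] /imsetP[v vN E].
  have uv : u = v by apply: (dd _ _ (s u)); rewrite ?(subsetP NU) ?sD // E tD.
  rewrite -uv in E; have [sA _] := sP u uN; have [tQ _] := tP u uN.
  by apply: (AQ u (s u)) => //; rewrite E.
(* A single pattern on the boundary repairs everything at once: the traces of the broken links
   become its pairs, and the trace of the linking set becomes its connected part. *)
have : solvable e (R :|: B) B (T0 :&: B) (s @: N) (t @: N).
  apply: lR; split; [exact: subsetIr | exact: sB | exact: tB | split=> //].
  - by clear -sW; rewrite /W0 in sW; disj.
  - by clear -tW; rewrite /W0 in tW; disj.
  - by rewrite !card_in_imset.
  - by rewrite card_in_imset //; apply: leq_trans (subset_leq_card NU) c2.
case=> T1 [D1 [cT1 TT1 T1V L2]].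
set W2 := _ :\: (B :\: _) in L2.
pose PA (M : {set T}) := \bigcup_(u in M) A u; pose PQ := \bigcup_(u in N) Q u.
have PAW (M : {set T}) : M \subset U1 -> PA M \subset W0.
  move=> MU; apply/subsetP=> x /bigcupP[u uM xA].
  by apply: (DW u); [exact: (subsetP MU) | exact: (subsetP (AD u))].
have PQW : PQ \subset W0.
  apply/subsetP=> x /bigcupP[u uM xA].
  by apply: (DW u); [exact: (subsetP NU) | exact: (subsetP (QD u))].
have LA (M : {set T}) f : M \subset U1 -> (forall u, u \in M -> f u \in A u) -> linkage e (PA M) M (f @: M) A.
  move=> MU fA; split.
  - move=> u uM; split=> //; first by apply: uA; exact: (subsetP MU).
    by apply/subsetP=> x xA; apply/bigcupP; exists u.
  - by move=> u uM; exists (f u); [exact: fA | exact: imset_f].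
  - move=> u v x uM vM xu xv; apply: (dd _ _ x); rewrite ?(subsetP MU) //; exact: (subsetP (AD _)).
have L1 := LA N s NU (fun u uN => proj1 (sP u uN)).
have [D3 L3] : linkable e PQ (t @: N) (w @: N).
  apply: (@linkage_fam _ _ _ _ _ Q).
  - move=> u uN; split=> //; first by have [] := tP u uN.
    by apply/subsetP=> x xA; apply/bigcupP; exists u.
  - by move=> u uM; exists (w u); [apply: wQ; exact: (subsetP NU) | exact: imset_f].
  - move=> u v x uM vM xu xv; apply: (dd _ _ x); rewrite ?(subsetP NU) //; exact: (subsetP (QD _)).
have sPA : s @: N \subset PA N.
  by apply/subsetP=> _ /imsetP[u uN ->]; apply/bigcupP; exists u => //; have [] := sP u uN.
have tPQ : t @: N \subset PQ.
  by apply/subsetP=> _ /imsetP[u uN ->]; apply/bigcupP; exists u => //; have [] := tP u uN.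
have dAQ : [disjoint PA N & PQ].
  apply: disjointI => x /bigcupP[u uN xA] /bigcupP[v vN xQ].
  have uv : u = v by apply: (dd _ _ x _ _ (AxD _ _ xA) (QxD _ _ xQ)); apply: (subsetP NU).
  by rewrite -uv in xQ; apply: (AQ u x).
have dND (M : {set T}) : M \subset U1 -> [disjoint N & M] -> [disjoint PA N :|: PQ & PA M].
  move=> MU dNM; apply: disjointI => x xx /bigcupP[v vN xQ].
  have xv := subsetP (AD v) x xQ.
  move: xx; rewrite inE => /orP[]/bigcupP[u uN xu].
    have uv : u = v by apply: (dd _ _ x _ _ (AxD _ _ xu) xv); [apply: (subsetP NU)|apply: (subsetP MU)].
    by rewrite -uv (disjointFr dNM uN) in vN.
  have uv : u = v by apply: (dd _ _ x _ _ (QxD _ _ xu) xv); [apply: (subsetP NU)|apply: (subsetP MU)].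
  by rewrite -uv (disjointFr dNM uN) in vN.
have NW := PAW N NU.
have [D4 L4] : linkable e (PA N :|: W2) N (t @: N).
  apply: linkage_comp L1 L2 _ _; last exact: leq_imset_card.
  move=> x xP xW; rewrite /W2 in xW; rewrite /W0 in NW; clear -xP xW RV NW tPQ dAQ; setat x.
have L5 : linkable e (PA N :|: W2 :|: PQ) N (w @: N).
  apply: linkage_comp L4 L3 _ _; last exact: leq_imset_card.
  move=> x xP xW; rewrite /W2 in xP; rewrite /W0 in PQW; clear -xP xW RV PQW sPA dAQ; setat x.
have MU : U1 :\: N \subset U1 by apply: subsetDl.
have L6 : linkable e (PA (U1 :\: N)) (U1 :\: N) (w @: (U1 :\: N)).
  exists A; apply: LA => // u; rewrite !inE negb_and negbK => /andP[/orP[h1 h2|//]].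
  by rewrite h2 in h1.
have dM := dND _ MU _; have MW := PAW _ MU.
have : linkable e (PA N :|: W2 :|: PQ :|: PA (U1 :\: N)) (N :|: (U1 :\: N)) (w @: N :|: w @: (U1 :\: N)).
  apply: linkageU L5 L6.
  have := dM _; move=> /(_ _) h; have {h} d : [disjoint PA N :|: PQ & PA (U1 :\: N)] by apply: h; disj.
  by rewrite /W2; rewrite /W0 in MW sW tW; clear -d MW sW tW sPA tPQ RV; disj.
rewrite -imsetU.
have -> : N :|: (U1 :\: N) = U1 by seteq.
move=> L7; have {L7} : linkable e (PA N :|: W2 :|: PQ :|: PA (U1 :\: N)) U1 U2.
  by apply: linkable_tgt L7; apply/subsetP=> _ /imsetP[u uU ->]; have [] := wP u uU.
(* A linking set that misses [B] uses no clique edge and stays as it is; otherwise [T1] reconnects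
   it. *)
pose T2 := if T0 :&: B == set0 then T0 else T0 :|: T1.
have T2s : T2 \subset T0 :|: T1 by rewrite /T2; case: ifP => _; rewrite ?subsetUl.
have TT2 : T0 \subset T2 by rewrite /T2; case: ifP => _; rewrite ?subsetUl.
move=> L; have {L} [D' L'] : linkable e (V :\: T2 :\: (X :\: (U1 :|: U2))) U1 U2.
  apply: linkable_mono L; rewrite /W2; rewrite /W0 in MW NW PQW sW tW.
  by clear -MW NW PQW sW tW TV T1V T2s RV BV; subs.
exists T2, D'; split=> //.
- rewrite /T2; case: ifPn => [/eqP TB|/set0Pn[x]].
    apply: conn_mono cT => x y xT yT /e1P[//|[xB _]].
    by move/setP/(_ x): TB; rewrite !inE xT xB.
  rewrite inE => /andP[xT xB]; apply: (conn_clique cT cT1 TT1 e1P); by exists x.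
- exact: subset_trans ST TT2.
- by clear -T2s TV T1V RV BV XV; subs.
Qed.

(** The links of [P] carry a pattern on [X] to a pattern on the boundary of [R]. Its solution is
    pulled back by adjoining the links, which stay outside [R]. *)
Lemma linked_compose e V X R P : symmetric e -> R \subset V :\: X -> X \subset V ->
  linked e (R :|: nb e V R) (nb e V R) ->
  linkage e (V :\: R) X (nb e V R) P -> linked e V X.
Proof.
move=> es RV XV lR [p1 p2 p3] S U1 U2 [SX U1X U2X [dS1 dS2 d12 cU c2]].
have BV : nb e V R \subset V :\: R by apply: nb_sub.
set B := nb e V R in lR p2 BV *.
have [b bP] := choose_mem p2.
have binj A : A \subset X -> {in A &, injective b}.
  move=> AX x y xA yA E; have xX := subsetP AX x xA; have yX := subsetP AX y yA.
  by have [h _] := bP x xX; have [h' _] := bP y yX; rewrite E in h; apply: (p3 _ _ (b y)).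
have bB A : A \subset X -> b @: A \subset B.
  by move=> AX; apply/subsetP=> _ /imsetP[x xA ->]; have [] := bP x (subsetP AX x xA).
have bdis A A' : A \subset X -> A' \subset X -> [disjoint A & A'] -> [disjoint b @: A & b @: A'].
  move=> AX AX' dA; apply: disjointI => z /imsetP[x xA ->] /imsetP[y yA E].
  have xX := subsetP AX x xA; have yX := subsetP AX' y yA.
  have xy : x = y by apply: (binj X).
  by move: yA; rewrite -xy (disjointFr dA xA).
have : solvable e (R :|: B) B (b @: S) (b @: U1) (b @: U2).
  apply: lR; split; try exact: bB.
  split; try exact: bdis.
    by rewrite !card_in_imset //; apply: binj.
  by rewrite card_in_imset //; apply: binj.
case=> T0 [D [cT ST TV DP]].
pose P' A := \bigcup_(a in A) P a.
have P'W A : A \subset X -> P' A \subset V :\: R.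
  move=> AX; apply/bigcupsP=> a aA; by have [] := p1 a (subsetP AX a aA).
have P'm A a x : a \in A -> x \in P a -> x \in P' A by move=> aA xP; apply/bigcupP; exists a.
have P'X A x : A \subset X -> x \in P' A -> x \in X -> x \in A.
  move=> AX /bigcupP[a aA xP] xX; have [xPx _ _] := p1 x xX.
  by rewrite (p3 _ _ _ xX (subsetP AX a aA) xPx xP).
have P'd A A' : A \subset X -> A' \subset X -> [disjoint A & A'] -> [disjoint P' A & P' A'].
  move=> AX AX' dA; apply: disjointI => x /bigcupP[a aA xP] /bigcupP[a' aA' xP'].
  have E := p3 _ _ _ (subsetP AX _ aA) (subsetP AX' _ aA') xP xP'.
  by rewrite E (disjointFl dA aA') in aA.
have P'b A x : A \subset X -> x \in P' A -> x \in b @: X -> x \in b @: A.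
  move=> AX /bigcupP[a aA xP] /imsetP[a' aX' xE]; rewrite xE in xP *.
  have [h _] := bP a' aX'; have E := p3 _ _ _ (subsetP AX _ aA) aX' xP h.
  by rewrite -E imset_f.
have bP' A : A \subset X -> b @: A \subset P' A.
  move=> AX; apply/subsetP=> _ /imsetP[a aA ->]; apply: (P'm _ a) => //.
  by have [] := bP a (subsetP AX a aA).
have AP' A : A \subset X -> A \subset P' A.
  move=> AX; apply/subsetP=> a aA; apply: (P'm _ a) => //.
  by have [] := p1 a (subsetP AX a aA).
have bsub A : A \subset X -> b @: A \subset b @: X by move=> AX; apply: imsetS.
have L1 : linkage e (P' U1) U1 (b @: U1) P.
  split.
  - move=> a aU; have [aP _ cP] := p1 a (subsetP U1X a aU); split=> //.
    by apply/subsetP=> x; apply: P'm.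
  - by move=> a aU; exists (b a); rewrite ?imset_f //; have [] := bP a (subsetP U1X a aU).
  - by move=> a a' x aU aU'; apply: p3; apply: (subsetP U1X).
have [D3 L3] : linkable e (P' U2) (b @: U2) U2.
  apply: (@linkage_fam _ _ _ _ _ P).
  - move=> a aU; have [aP _ cP] := p1 a (subsetP U2X a aU); split=> //.
      by have [] := bP a (subsetP U2X a aU).
    by apply/subsetP=> x; apply: P'm.
  - by move=> a aU; exists a => //; have [] := p1 a (subsetP U2X a aU).
  - by move=> a a' x aU aU'; apply: p3; apply: (subsetP U2X).
pose W2 := (R :|: B) :\: T0 :\: (B :\: (b @: U1 :|: b @: U2)).
have bU1 := bB _ U1X; have bU2 := bB _ U2X; have bS := bB _ SX.
have P1 := P'W _ U1X; have P2 := P'W _ U2X; have PS := P'W _ SX.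
have d12' := P'd _ _ U1X U2X d12.
have dS1' := P'd _ _ SX U1X dS1; have dS2' := P'd _ _ SX U2X dS2.
have bP1 := bP' _ U1X; have bP2 := bP' _ U2X; have bPS := bP' _ SX.
have [D2 L2] : linkable e (P' U1 :|: W2) U1 (b @: U2).
  apply: linkage_comp L1 DP _ _; last by apply: leq_imset_card.
  move=> x xP xW; have := P'b _ x U1X xP; have := bsub _ U1X; have := bsub _ U2X => s2 s1.
  clear -xW bU1 bU2 P1 s1 s2 bP2 d12' xP RV.
  by setat x.
have [D' L'] : linkable e (P' U1 :|: W2 :|: P' U2) U1 U2.
  apply: linkage_comp L2 L3 _ _; last by rewrite card_in_imset ?cU //; apply: binj.
  move=> x xP xW; have := P'b _ x U2X xW; have := bsub _ U1X; have := bsub _ U2X => s2 s1.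
  clear -xW bU1 bU2 P2 s1 s2 bP1 d12' xP RV.
  by rewrite /W2 in xP; setat x.
exists (P' S :|: T0), D'; split.
- rewrite setUC.
  have [S0|S0] := eqVneq S set0.
    by rewrite /P' S0 big_set0 setU0.
  have TE : T0 != set0.
    have /set0Pn[s sS] := S0; apply/set0Pn; exists (b s); apply: (subsetP ST); exact: imset_f.
  apply: (conn_cover cT) => //; first exact: subsetUl.
  move=> x; rewrite inE => /orP[-> //|/bigcupP[s sS xP]] _; exists (P s).
  have sX := subsetP SX s sS; have [sP _ cP] := p1 s sX; split=> //.
    by apply/subsetP=> z zP; rewrite inE (P'm _ s) ?orbT.
  by exists (b s); [have [] := bP s sX | apply: (subsetP ST); exact: imset_f].
- by have := AP' S SX; clear; move=> h; subs.
- apply/subsetP=> x; have := P'X S x SX.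
  by clear -PS TV RV BV SX bS bPS ST; setat x.
- apply: linkage_mono L'; apply/subsetP=> x; have := P'X U1 x U1X; have := P'X U2 x U2X.
  move=> h2 h1; rewrite /W2; clear -h1 h2 dS1' dS2' P1 P2 PS TV bPS bP1 bP2 RV BV bS XV.
  by setat x.
Qed.

Lemma linkable_sym e W A B : #|A| = #|B| -> linkable e W A B -> linkable e W B A.
Proof.
move=> cAB [D [d1 d2 d3]]; have [f fP] := choose_mem d2.
have finj : {in A &, injective f}.
  by move=> x y xA yA E; have [h _] := fP x xA; have [h' _] := fP y yA; rewrite E in h; apply: (d3 _ _ (f y)).
have fE : f @: A = B.
  apply/eqP; rewrite eqEcard card_in_imset // cAB leqnn andbT.
  by apply/subsetP=> _ /imsetP[x xA ->]; have [] := fP x xA.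
rewrite -fE; apply: (@linkage_fam _ _ _ _ _ D) => //.
- by move=> u uA; have [_ DW cD] := d1 u uA; split=> //; have [] := fP u uA.
- by move=> u uA; exists u => //; have [] := d1 u uA.
Qed.

Lemma linkable_edge e x y : symmetric e -> e x y -> linkable e [set x; y] [set x] [set y].
Proof.
move=> es xy; exists (fun=> [set x; y]); split.
- by move=> a; rewrite inE => /eqP->; split=> //; [rewrite !inE eqxx | exact: conn2].
- by move=> a _; exists y; rewrite !inE eqxx ?orbT.
- by move=> a a' z; rewrite !inE => /eqP-> /eqP->.
Qed.

Lemma solvable_swap e V X S U1 U2 : #|U1| = #|U2| -> solvable e V X S U2 U1 -> solvable e V X S U1 U2.
Proof.
move=> cU [T0 [D [cT ST TV LD]]].
have [D' LD'] : linkable e (V :\: T0 :\: (X :\: (U2 :|: U1))) U1 U2.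
  by apply: linkable_sym; [rewrite cU | exists D].
by exists T0, D'; split=> //; rewrite setUC.
Qed.

(** The pair is linked by its own edge. The rest of the solution avoids both ends, because they lie
    in [X] and no longer belong to the pattern. *)
Lemma solvable_add_edge e V X S U1 U2 x y : symmetric e -> pattern X S U1 U2 -> X \subset V ->
  x \in U1 -> y \in U2 -> e x y -> solvable e V X S (U1 :\ x) (U2 :\ y) -> solvable e V X S U1 U2.
Proof.
move=> es [SX U1X U2X [d1 d2 d12 cU c2]] XV xU yU xy [T0 [D [cT ST TV LD]]].
have [D' LD'] : linkable e (V :\: T0 :\: (X :\: (U1 :|: U2))) U1 U2; last by exists T0, D'.
have xyd : [disjoint V :\: T0 :\: (X :\: ((U1 :\ x) :|: (U2 :\ y))) & [set x; y]].
  have xX := subsetP U1X x xU; have yX := subsetP U2X y yU.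
  have xU2 : x \notin U2 by clear -xU d12; setat x.
  have yU1 : y \notin U1 by clear -yU d12; setat y.
  apply: disjointI => z zW /set2P[] E; move: zW; rewrite E !inE eqxx.
    by rewrite xX (negPf xU2) /= !andbF.
  by rewrite yX (negPf yU1) /= !andbF.
have := linkageU xyd (ex_intro _ D LD) (linkable_edge es xy).
have E1 : U1 :\ x :|: [set x] = U1 by rewrite setUC setD1K.
have E2 : U2 :\ y :|: [set y] = U2 by rewrite setUC setD1K.
rewrite E1 E2; apply: linkable_mono.
rewrite subUset; apply/andP; split.
  by apply/subsetP=> z; rewrite !inE; bcase.
have xT : x \notin T0 by clear -TV xU d1 U1X; setat x.
have yT : y \notin T0 by clear -TV yU d2 U2X; setat y.
rewrite subUset !sub1set; apply/andP; split.
  by clear -xT xU U1X XV; setat x.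
by clear -yT yU U2X XV; setat y.
Qed.
End Solv.

(** * Contraction and edge counts *)

Section Cls.
Variable T : finType.
Implicit Types (e : rel T) (A V R S U X Z Q tw : {set T}) (x y : T) (D : T -> {set T}).

(** [x] inherits the neighbours of [y]. The vertex [y] remains in the type and is dropped by passing
    to [V :\ y], so that all contractions live on the same [T]. *)
Definition contract e x y : rel T := fun a b =>
  (a != b) && [|| e a b, (a == x) && e y b | (b == x) && e a y].

Lemma contract_sym e x y : symmetric e -> symmetric (contract e x y).
Proof.
by move=> es a b; rewrite /contract eq_sym es (es a y) (es y b) [X in _ || X]orbC.
Qed.

Definition blow x y A := if x \in A then y |: A else A.

Lemma blow_sub x y A : A \subset blow x y A.
Proof. by rewrite /blow; case: ifP => // _; subs. Qed.

Lemma mem_blow x y A z : z \in blow x y A = (z \in A) || (z == y) && (x \in A).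
Proof. by rewrite /blow; case: ifP; rewrite ?inE ?andbT ?andbF ?orbF // orbC. Qed.

Lemma conn_blow e x y A : symmetric e -> e x y -> y \notin A ->
  conn (contract e x y) A -> conn e (blow x y A).
Proof.
move=> es xy yA cA; rewrite /blow; case: ifPn => xA; last first.
  apply: conn_mono cA => a b aA bA /andP[_ /or3P[//|/andP[/eqP ax _]|/andP[/eqP bx _]]].
    by rewrite -ax aA in xA.
  by rewrite -bx bA in xA.
have yx : e y x by rewrite es.
split=> Z /set0Pn[z zZ] ZA cl.
have xyZ : x \in Z -> y |: A \subset Z.
  move=> xZ; have yZ : y \in Z by apply: (cl x) => //; rewrite !inE eqxx.
  rewrite subUset sub1set yZ /=; apply: (conn_meet cA (subxx _)); last by exists x.
  move=> a b aZ bA /andP[_ /or3P[ab|/andP[/eqP ax yb]|/andP[/eqP bx _]]]; last by rewrite bx.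
    by apply: (cl a) => //; rewrite inE bA orbT.
  by apply: (cl y) => //; rewrite inE bA orbT.
have [/xyZ//|xZ] := boolP (x \in Z).
have yZ : y \notin Z.
  by apply: contra xZ => yZ; apply: (cl y) => //; rewrite inE xA orbT.
have zA : z \in A.
  have := subsetP ZA z zZ; rewrite !inE => /orP[/eqP zy|//]; by rewrite zy (negPf yZ) in zZ.
suff AZ : A \subset Z by rewrite (subsetP AZ) in xZ.
apply: (conn_meet cA (subxx _)); last by exists z.
move=> a b aZ bA /andP[_ /or3P[ab|/andP[/eqP ax yb]|/andP[/eqP bx ay]]].
- by apply: (cl a) => //; rewrite inE bA orbT.
- by rewrite -ax aZ in xZ.
- by case/negP: yZ; apply: (cl a) => //; rewrite !inE eqxx.
Qed.

(** The vertex [y] is added to the member of the solution that contains [x]; by disjointness there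
    is at most one. As [y] is outside [X], this respects the pattern. *)
Lemma linked_lift e V X x y : symmetric e -> e x y -> y \in V -> y \notin X ->
  linked (contract e x y) (V :\ y) X -> linked e V X.
Proof.
move=> es xy yV yX lV S U1 U2 pat; have [T0 [D [cT ST TV [d1 d2 d3]]]] := lV S U1 U2 pat.
have [SX U1X U2X [dS1 dS2 d12 _ _]] := pat.
have yT : y \notin T0 by apply/negP=> /(subsetP TV); rewrite !inE eqxx andbF.
have yD u : u \in U1 -> y \notin D u.
  by move=> /d1[_ /subsetP DW _]; apply/negP=> /DW; rewrite !inE eqxx !andbF.
exists (blow x y T0), (fun u => blow x y (D u)); split.
- exact: conn_blow.
- exact: subset_trans ST (blow_sub _ _ _).
- apply/subsetP=> z; rewrite mem_blow => /orP[zT|/andP[/eqP-> _]]; first by setat z.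
  by rewrite !inE yV andbT negb_and yX orbT.
split.
- move=> u uU; have [uD DW cD] := d1 u uU; split; first exact: (subsetP (blow_sub _ _ _)).
    apply/subsetP=> z; rewrite mem_blow => /orP[zD|/andP[/eqP-> xD]].
      have : z \notin blow x y T0.
        rewrite mem_blow negb_or; have := subsetP DW z zD; rewrite !inE.
        by case: (z == y); rewrite /= ?andbF // => /andP[_ /andP[->]].
      by move=> h; clear -DW zD h; setat z.
    have xT : x \notin T0 by clear -DW xD; setat x.
    have yB : y \notin blow x y T0 by rewrite mem_blow (negPf yT) (negPf xT) andbF.
    by clear -yV yX yB; setat y.
  by apply: conn_blow => //; exact: yD.
- by move=> u /d2[b bD bU]; exists b => //; exact: (subsetP (blow_sub _ _ _)).
move=> u v z uU vU; rewrite !mem_blow => /orP[zu|/andP[/eqP zy xu]] /orP[zv|/andP[/eqP zy' xv]].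
- exact: (d3 _ _ z).
- by rewrite zy' (negPf (yD u uU)) in zu.
- by rewrite zy (negPf (yD v vU)) in zv.
- exact: (d3 _ _ x).
Qed.

Definition Nb e x := [set y | e x y].

(* Ordered pairs, so [E2] is twice the number of edges of [V] that meet [R]. *)
Definition epairs e V R := [set p : T * T |
  [&& p.1 \in V, p.2 \in V, e p.1 p.2 & (p.1 \in R) || (p.2 \in R)]].
Definition E2 e V R := #|epairs e V R|.

(* A twin is an edge of [X] obtained by splitting a vertex; the edges doubled by the split are
   discounted in [dense] and [sparse_at]. *)
Definition twin_set e tw R := [set y in R | (tw != set0) && (tw \subset Nb e y)].
Definition twin_count e tw R := #|twin_set e tw R|.

Definition twin e tw : Prop :=
  tw = set0 \/ exists x0 y0, [/\ tw = [set x0; y0], x0 != y0 & e x0 y0].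

(* The last summand leaves room for splitting a vertex into a twin once [X] has full size. *)
Definition dense c e V X tw : Prop :=
  2 * c * #|V :\: X| + 2 * twin_count e tw (V :\: X) + 2 * ((tw == set0) && (#|X| == c))
    < E2 e V (V :\: X).

Definition sparse_at c e V X tw R : Prop :=
  #|nb e V R| < #|X| -> E2 e V R <= 2 * c * #|R| + 2 * twin_count e tw R.

(** Density alone could sit behind a boundary too small to be reached from all of [X] by disjoint
    links; the last condition excludes this. *)
Definition admissible c e V X tw : Prop :=
  [/\ X \subset V, #|X| <= c, twin e tw /\ tw \subset X, dense c e V X tw
    & forall R, R != set0 -> R \subset V :\: X -> sparse_at c e V X tw R].

Lemma nb_within e V V' R : R :|: nb e V R \subset V' -> V' \subset V -> nb e V' R = nb e V R.
Proof.
move=> s1 s2; apply/setP=> y; apply/idP/idP => /nbP[yV [yR [z zR zy]]].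
  by apply: (nb_in zR zy) => //; exact: (subsetP s2).
by apply: (nb_in zR zy) => //; apply: (subsetP s1); rewrite inE (nb_in zR zy) ?orbT.
Qed.

Lemma nb_sub_within e V V' R R1 : R1 \subset R -> R :|: nb e V R \subset V' -> V' \subset V ->
  nb e V' R1 = nb e V R1.
Proof.
move=> s0 s1 s2; apply/setP=> y; apply/idP/idP => /nbP[yV [yR [z zR zy]]].
  by apply: (nb_in zR zy) => //; exact: (subsetP s2).
apply: (nb_in zR zy) => //; apply: (subsetP s1); rewrite inE.
by have [//|yR'] := boolP (y \in R); rewrite (nb_in (subsetP s0 z zR) zy).
Qed.

Lemma E2_within e V V' R R1 : symmetric e -> R \subset V -> R1 \subset R ->
  R :|: nb e V R \subset V' -> V' \subset V -> E2 e V' R1 = E2 e V R1.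
Proof.
move=> es RV s0 s1 s2; congr #|pred_of_set _|; apply/setP=> -[a b]; rewrite !inE /=.
have sV a' : a' \in V' -> a' \in V by apply: (subsetP s2).
have h u v : u \in R1 -> v \in V -> e u v -> v \in V'.
  move=> uR vV uv; apply: (subsetP s1); rewrite inE.
  by have [//|vR] := boolP (v \in R); rewrite (nb_in (subsetP s0 u uR) uv).
have h' u : u \in R1 -> u \in V'.
  by move=> uR; apply: (subsetP s1); rewrite inE (subsetP s0 _ uR).
apply/idP/idP => /and4P[aV bV ab /orP[aR|aR]].
- by rewrite !sV // ab aR.
- by rewrite !sV // ab aR orbT.
- by rewrite h' // (h a) // ab aR.
- by rewrite [b \in _]h' // (h b) // ?ab ?aR ?orbT // es.
Qed.

Lemma E2_split e V R Q : R \subset Q -> Q \subset V ->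
  E2 e V Q = E2 e V R + E2 e (V :\: R) (Q :\: R).
Proof.
move=> RQ QV; rewrite /E2 -[X in X = _](cardsID (epairs e V R)).
congr (_ + _); congr #|pred_of_set _|; apply/setP=> -[a b]; rewrite !inE /=.
  by have := subset_at a RQ; have := subset_at b RQ; case: (e a b); clear; bcase.
by case: (e a b); clear; bcase.
Qed.

Lemma twin_count_split e tw R Q : R \subset Q -> twin_count e tw Q = twin_count e tw R + twin_count e tw (Q :\: R).
Proof.
move=> RQ; rewrite /twin_count -[X in X = _](cardsID R).
congr (_ + _); congr #|pred_of_set _|; apply/setP=> a; rewrite !inE.
  by have := subset_at a RQ; move: (tw != set0) (tw \subset Nb e a) => [] []; clear; bcase.
by move: (tw != set0) (tw \subset Nb e a) => [] []; clear; bcase.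
Qed.

(* Every vertex that becomes adjacent to both twins gains an edge to one of them. *)
Lemma E2_twin_count_rel e e' V tw Q : symmetric e -> symmetric e' -> (forall x y, e x y -> e' x y) ->
  Q \subset V -> tw \subset V -> [disjoint tw & Q] ->
  E2 e V Q + 2 * twin_count e' tw Q <= E2 e' V Q + 2 * twin_count e tw Q.
Proof.
move=> es es' ee QV tV tQ.
pose Y := twin_set e' tw Q :\: twin_set e tw Q.
have YE : twin_count e' tw Q = twin_count e tw Q + #|Y|.
  rewrite /twin_count -(cardsID (twin_set e tw Q) (twin_set e' tw Q)); congr (#|pred_of_set _| + _).
  apply/setP=> a; rewrite !inE; case: (a \in Q) => //=; case: (tw != set0) => //=.
  rewrite andbC; case: (boolP (tw \subset Nb e a)) => //= /subsetP h.
  by apply/subsetP=> t /h; rewrite !inE; apply: ee.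
have [f fP] : exists f : T -> T, forall a, a \in Y -> f a \in tw /\ ~~ e a (f a) /\ e' a (f a).
  apply: (choose_in (P := fun a t => t \in tw /\ ~~ e a t /\ e' a t)) => a.
  rewrite !inE => /andP[h /and3P[aQ t0 /subsetP h']]; move: h; rewrite aQ t0 /= => /subsetPn[t tt].
  by rewrite inE => nt; exists t; split=> //; split=> //; have := h' t tt; rewrite inE.
have YQ a : a \in Y -> a \in Q by rewrite !inE => /andP[_ /andP[]].
pose F1 := [set (a, f a) | a in Y]; pose F2 := [set (f a, a) | a in Y].
have c1 : #|F1| = #|Y| by rewrite card_imset // => a b [].
have c2 : #|F2| = #|Y| by rewrite card_imset // => a b [].
have d12 : [disjoint F1 & F2].
  apply: disjointI => -[a b] /imsetP[a1 a1Y [-> _]] /imsetP[a2 a2Y [E _]].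
  have [h _] := fP _ a2Y; by rewrite -E (disjointFl tQ (YQ _ a1Y)) in h.
have d3 : [disjoint epairs e V Q & F1 :|: F2].
  apply: disjointI => -[a b]; rewrite !inE /= => /and4P[aV bV ab _].
  case/orP=> /imsetP[a1 a1Y [Ea Eb]]; have [_ [/negP h _]] := fP _ a1Y; apply: h; first by rewrite -Eb -Ea.
  by rewrite es -Ea -Eb.
have sub : epairs e V Q :|: (F1 :|: F2) \subset epairs e' V Q.
  apply/subsetP=> -[a b]; rewrite 2!in_setU => /or3P[|/imsetP[a1 a1Y [-> ->]]|/imsetP[a1 a1Y [-> ->]]].
  - by rewrite !inE /= => /and4P[-> -> /ee-> ->].
  - have [h1 [_ h2]] := fP _ a1Y; have aQ := YQ _ a1Y.
    by rewrite inE /= h2 aQ (subsetP QV _ aQ) (subsetP tV _ h1).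
  - have [h1 [_ h2]] := fP _ a1Y; have aQ := YQ _ a1Y.
    by rewrite inE /= es' h2 aQ (subsetP QV _ aQ) (subsetP tV _ h1) orbT.
have := subset_leq_card sub; rewrite cardsU (disjoint_setI0 d3) cards0 subn0.
rewrite cardsU (disjoint_setI0 d12) cards0 subn0 c1 c2 YE /E2; clear; lia.
Qed.

Definition star x (M : {set T}) := [set p : T * T | (p.1 == x) && (p.2 \in M) || (p.2 == x) && (p.1 \in M)].

Lemma card_star x (M : {set T}) : x \notin M -> #|star x M| = 2 * #|M|.
Proof.
move=> xM.
have -> : star x M = [set (x, b) | b in M] :|: [set (b, x) | b in M].
  apply/setP=> -[a b]; rewrite !inE /=; apply/idP/idP.
    case/orP=> /andP[/eqP-> m]; apply/orP; [left|right]; apply/imsetP; first by exists b.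
    by exists a.
  by case/orP=> /imsetP[c cM [-> ->]]; rewrite eqxx cM ?orbT.
rewrite cardsU !card_imset; [|by move=> a b []|by move=> a b []].
rewrite (_ : _ :&: _ = set0) ?cards0 ?subn0; first by clear; lia.
apply/setP=> -[a b]; rewrite in_setI in_set0; apply/andP=> -[/imsetP[a1 a1N [Ea _]] /imsetP[a2 a2N [Ea' _]]].
by move: xM; rewrite -Ea Ea' a2N.
Qed.

(* The edges at [y] that disappear when [y] is contracted onto [x]. *)
Definition loss e V X x y :=
  [set b in V | [&& b != x, e y b & e x b || (x \in X) && (b \in X)]].

(** Every edge at [y] reappears at [x], except the edge [x y] itself, which is the [.+1], and the
    edges to vertices of [loss]: those to common neighbours, and those that end up inside [X] and
    are no longer counted. *)
Lemma E2_contract e V X x y : symmetric e -> irreflexive e -> X \subset V -> x \in V -> y \in V ->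
  y \notin X -> e x y ->
  E2 e V (V :\: X) <= E2 (contract e x y) (V :\ y) (V :\: X :\ y) + 2 * #|loss e V X x y|.+1.
Proof.
move=> es ei XV xV yV yX xy; set Q := V :\: X.
have yQ : y \in Q by rewrite inE yV yX.
have xney : x != y by apply: contraTneq xy => ->; rewrite ei.
rewrite (@E2_split e V [set y] Q) ?sub1set ?yQ ?subsetDl //.
pose N := V :&: Nb e y.
have yN : y \notin N by rewrite !inE ei andbF.
have E1 : E2 e V [set y] = 2 * #|N|.
  rewrite -(card_star yN); congr #|pred_of_set _|; apply/setP=> -[a b]; rewrite !inE /=.
  case: (eqVneq a y) => [->|ay]; case: (eqVneq b y) => [->|bY]; rewrite ?ei ?yV /= ?andbF ?andbT ?orbF //.
  by rewrite (es a y).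
pose M := N :\ x :\: loss e V X x y.
have NM : #|N| <= #|M| + #|loss e V X x y|.+1.
  have := cardsID (loss e V X x y) (N :\ x); have := cardsD1 x N.
  have : #|(N :\ x) :&: loss e V X x y| <= #|loss e V X x y| by apply: subset_leq_card; exact: subsetIr.
  by rewrite -/M; case: (x \in N); clear; lia.
have MP b : b \in M -> [/\ b \in V, b != x, b != y, e y b & ~~ e x b /\ ~~ ((x \in X) && (b \in X))].
  rewrite !inE => /andP[h /and3P[bx bV yb]]; move: h; rewrite bV bx yb /= negb_or => /andP[-> ->].
  by split=> //; apply: contraTneq yb => ->; rewrite ei.
have xM : x \notin M by apply/negP=> /MP[_]; rewrite eqxx.
have d3 : epairs e (V :\: [set y]) (Q :\ y) :&: star x M = set0.
  apply/setP=> -[a b]; rewrite in_setI in_set0; apply/andP=> -[]; rewrite !inE /= => /and4P[_ _ ab _].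
  move=> aM; have cM : (a == x) && (b \in M) || (b == x) && (a \in M) by rewrite !in_setD in_set1 !inE.
  case/orP: cM => /andP[/eqP E /MP[_ _ _ _ [/negP h _]]]; apply: h; first by rewrite -E.
  by rewrite -E es.
have sub : epairs e (V :\: [set y]) (Q :\ y) :|: star x M \subset epairs (contract e x y) (V :\ y) (Q :\ y).
  apply/subsetP=> -[a b]; rewrite in_setU => /orP[|].
    rewrite !inE /= => /and4P[-> -> ab ->]; rewrite /contract ab /= !andbT.
    by apply: contraTneq ab => ->; rewrite ei.
  rewrite inE /= => /orP[]/andP[/eqP-> /MP[h1 h2 h3 h4 [_ h5]]]; rewrite !inE /= /contract eqxx ?[e _ y]es h4.
    by rewrite !orbT andbT xney h3 xV h1 eq_sym h2 /= ?andbT; move: h5; rewrite negb_and.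
  by rewrite !orbT andbT xney h3 xV h1 h2 /= ?andbT; move: h5; rewrite negb_and orbC.
have := subset_leq_card sub; rewrite cardsU d3 cards0 subn0.
rewrite card_star // E1 /E2; move: NM; clear; lia.
Qed.

(* An edge from [R] to [x] or [y] survives in the contraction, unless it merges with another one. *)
Lemma E2_contract_away e V x y R : symmetric e -> irreflexive e -> x \in V -> y \in V -> e x y ->
  R \subset V -> x \notin R -> y \notin R ->
  E2 e V R = E2 (contract e x y) (V :\ y) R + 2 * twin_count e [set x; y] R.
Proof.
move=> es ei xV yV xy RV xR yR.
have xney : x != y by apply: contraTneq xy => ->; rewrite ei.
have RP a : a \in R -> [/\ a \in V, a != x & a != y].
  by move=> aR; split; [exact: (subsetP RV)|apply: contraNneq xR => <-|apply: contraNneq yR => <-].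
have E1 : E2 e V R = E2 e (V :\ y) R + 2 * #|R :&: Nb e y|.
  rewrite -(@card_star y); last by rewrite !inE (negPf yR).
  rewrite /E2 -(cardsID (epairs e (V :\ y) R) (epairs e V R)).
  congr (_ + _); congr #|pred_of_set _|; apply/setP=> -[a b]; rewrite !inE /=.
    by case: (e a b); rewrite ?andbF //; move: (a == y) (b == y) => [] []; clear; bcase.
  have := RP a; have := RP b; have := es a b.
  case: (eqVneq a y) => [->|ay]; case: (eqVneq b y) => [->|bY]; rewrite ?ei ?(negPf yR) ?yV /= ?andbF ?andbT ?orbF ?orbT //.
  - by move=> _ h _; case: (boolP (b \in R)) => [/h[-> _ _]|]; rewrite ?andbF ?andbT //= es.
  - by move=> -> _ h; case: (boolP (a \in R)) => [/h[-> _ _]|]; rewrite ?andbF ?andbT //=.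
  - by move=> _ _ _; clear; case: (e a b); bcase.
have E2' : E2 (contract e x y) (V :\ y) R = E2 e (V :\ y) R + 2 * #|R :&: Nb e y :\: Nb e x|.
  rewrite -(@card_star x) /E2; last by rewrite !inE (negPf xR) andbF.
  rewrite -(cardsID (epairs e (V :\ y) R) (epairs (contract e x y) (V :\ y) R)).
  congr (_ + _); congr #|pred_of_set _|; apply/setP=> -[a b]; rewrite !inE /=.
    rewrite /contract; case ab : (e a b); rewrite ?andbF //=.
    have -> /= : a != b by apply: contraTneq ab => ->; rewrite ei.
    by clear; bcase.
  rewrite /contract; have [E|ax] := eqVneq a x; have [F|bx] := eqVneq b x.
  - by rewrite E F ei (negPf xR) /= !andbF.
  - rewrite E (negPf xR) xV xney [x == b]eq_sym (negPf bx) /= ?orbF ?andbT.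
    case: (boolP (b \in R)) => [/RP[-> _ ->]|]; rewrite ?andbF //=.
    by case: (e x b); case: (e y b).
  - rewrite F (negPf xR) xV xney (negPf ax) /= ?andbT ?orbF (es a x) (es a y).
    case: (boolP (a \in R)) => [/RP[-> _ ->]|]; rewrite ?andbF //=.
    by case: (e x a); case: (e y a).
  - by case: (e a b); rewrite /= ?andbF //; clear; bcase.
rewrite E1 E2' -addnA; congr (_ + _).
rewrite -mulnDr; congr (2 * _).
rewrite -(cardsID (Nb e x) (R :&: Nb e y)) addnC; congr (_ + _).
congr #|pred_of_set _|; apply/setP=> a; rewrite !inE subUset !sub1set !inE.
have -> /= : [set x; y] != set0 by apply/set0Pn; exists x; rewrite !inE eqxx.
by rewrite (es a x) (es a y) [e x a && _]andbC andbA.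
Qed.
End Cls.

(** * Regions behind a small boundary *)

Section TW.
Variable T : finType.
Implicit Types (e : rel T) (B C V R X Z Q tw : {set T}) (x y : T).

(** A set [C] separating [X] from the boundary of [R] yields the region [R3], made of [R] and all
    that lies beyond [C]. Its boundary is contained in [C], so [C] cannot be smaller than [X]. *)
Lemma menger_region e V X R : symmetric e -> X \subset V -> R \subset V :\: X ->
  (forall R3, R \subset R3 -> R3 \subset V :\: X -> #|X| <= #|nb e V R3|) ->
  linkable e (V :\: R) X (nb e V R).
Proof.
move=> es XV RV minR; have BV := nb_sub e V R.
apply: menger => //; first by subs.
move=> C Z CW [ZW XZ clZ ZB].
pose R3 := R :|: (V :\: R :\: C :\: Z).
apply: leq_trans (minR R3 _ _) (subset_leq_card _); [by rewrite /R3; subs | by rewrite /R3; subs |].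
apply/subsetP=> y /nbP[yV [yR3 [z zR3 zy]]]; apply: contraT => yC.
have yR : y \notin R by rewrite /R3 in yR3; setat y.
have yZ : y \in Z by rewrite /R3 in yR3; clear -yR3 yC yV yR; setat y.
have [zR|zR] := boolP (z \in R).
  by have := nb_in zR zy yV yR; clear -yZ ZB; setat y.
have [zV zZ zC] : [/\ z \in V, z \notin Z & z \notin C].
  by rewrite /R3 in zR3; clear -zR3 zR; split; setat z.
case/negP: zZ; apply: (clZ y) => //; last by rewrite es.
by clear -zV zC zR; setat z.
Qed.

Lemma menger_linked e V X R : symmetric e -> X \subset V -> R \subset V :\: X ->
  linked e (R :|: nb e V R) (nb e V R) ->
  (forall R3, R \subset R3 -> R3 \subset V :\: X -> #|X| <= #|nb e V R3|) -> linked e V X.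
Proof.
move=> es XV RV lR minR; have [P LP] := menger_region es XV RV minR.
by apply: linked_compose LP.
Qed.

Lemma twin_set0 e R : twin_count e set0 R = 0.
Proof. by rewrite /twin_count (_ : twin_set _ _ _ = set0) ?cards0 //; apply/setP=> a; rewrite !inE eqxx andbF. Qed.

Lemma twin_count_nb0 e V X tw R R1 : symmetric e -> tw \subset X -> X \subset V -> R1 \subset R ->
  R \subset V :\: X -> ~~ (tw \subset nb e V R) -> twin_count e tw R1 = 0.
Proof.
move=> es tX XV R1R RV nt; apply/eqP; rewrite cards_eq0; apply: contraNT nt => /set0Pn[r].
rewrite inE => /and3P[rR1 _ /subsetP trr]; apply/subsetP=> t tt.
have := trr t tt; rewrite inE => rt; have rR := subsetP R1R r rR1.
by apply: (nb_in rR rt); clear -tt tX XV RV; setat t.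
Qed.

Lemma setU_nbD e V R : (R :|: nb e V R) :\: nb e V R = R.
Proof. have := nb_disj e V R => h; seteq. Qed.

(** The violation is density for the new instance, and minimality is its sparsity. The twin is kept
    if it lies in the boundary; otherwise no vertex of [R] sees all of it and its count in [R] is
    zero. The boundary has fewer than [c] vertices, so the last summand of [dense] vanishes. *)
Lemma min_violation_admissible c e V X tw R : symmetric e -> X \subset V -> #|X| <= c ->
  twin e tw -> tw \subset X -> R \subset V :\: X -> #|nb e V R| < #|X| ->
  2 * c * #|R| + 2 * twin_count e tw R < E2 e V R ->
  (forall R1, R1 != set0 -> R1 \subset R -> #|R1| < #|R| -> sparse_at c e V X tw R1) ->
  exists tw', admissible c e (R :|: nb e V R) (nb e V R) tw'.
Proof.
move=> es XV Xc tt tX RV nbX viol minR.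
exists (if tw \subset nb e V R then tw else set0); set tw' := (X in admissible _ _ _ _ X).
have sV : R :|: nb e V R \subset V by have := nb_sub e V R => h; subs.
have RV' : R \subset V by subs.
have dlE R1 : R1 \subset R -> twin_count e tw' R1 = twin_count e tw R1.
  move=> R1R; rewrite /tw'; case: ifPn => // nt.
  by rewrite twin_set0 (twin_count_nb0 es tX XV R1R RV nt).
split.
- exact: subsetUr.
- by clear -nbX Xc; lia.
- by rewrite /tw'; split; case: ifPn => // _; [left | rewrite sub0set].
- rewrite /dense setU_nbD dlE // (E2_within es RV' (subxx _) (subxx _) sV).
  have -> : #|nb e V R| == c = false by clear -nbX Xc; lia.
  by rewrite andbF muln0 addn0.
move=> R1 R10; rewrite setU_nbD /sparse_at => R1R.
rewrite (nb_sub_within R1R (subxx _) sV) (E2_within es RV' R1R (subxx _) sV) dlE // => lt.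
apply: minR => //; last exact: leq_trans lt (ltnW nbX).
rewrite ltn_neqAle subset_leq_card // andbT; apply: contraTneq lt => E.
have -> : R1 = R by apply/eqP; rewrite eqEcard R1R E leqnn.
by rewrite ltnn.
Qed.

(* In a minimal counterexample there is no such [R]: it could be replaced by its boundary. *)
Definition rigid e V X R : Prop :=
  [/\ R != set0, R \subset V :\: X, #|nb e V R| <= #|X| & linked e (R :|: nb e V R) (nb e V R)].

Definition linked_below c n : Prop := forall e V X tw, symmetric e -> irreflexive e ->
  admissible c e V X tw -> #|V :\: X| < n -> linked e V X.

Lemma add_clique_sym e B : symmetric e -> symmetric (add_clique e B).
Proof. by move=> es x y; rewrite /add_clique es eq_sym [(x \in B) && _]andbC. Qed.

Lemma add_clique_irr e B : irreflexive e -> irreflexive (add_clique e B).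
Proof. by move=> ei x; rewrite /add_clique ei eqxx. Qed.

Lemma twin_rel e e' tw : (forall x y, x \in tw -> y \in tw -> e x y -> e' x y) ->
  twin e tw -> twin e' tw.
Proof.
move=> ee [->|[x [y [E xy exy]]]]; [by left|right; exists x, y; split=> //].
by apply: ee => //; rewrite E; apply/set2P; [left|right].
Qed.

(** A largest such [R] is replaced by a clique on its boundary. Density survives, so sparsity must
    fail, at a minimal region [R1]. If [R1] misses the clique, it already violates sparsity before
    the replacement; if it meets the clique, [R1 :|: R] is a larger rigid region. *)
Lemma no_rigid_small c e V X tw R : symmetric e -> irreflexive e -> admissible c e V X tw ->
  linked_below c #|V :\: X| -> ~ linked e V X -> rigid e V X R -> #|nb e V R| < #|X| -> False.
Proof.
move=> es ei [XV Xc [tt tX] dens spar] IH nl rR nbR.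
have [{rR nbR}R [[[R0 RV nbX lR] nbR] maxR]] :=
  ex_max_card (P := fun R => rigid e V X R /\ #|nb e V R| < #|X|) (conj rR nbR).
set B := nb e V R in nbX lR nbR; pose e1 := add_clique e B.
have e1s : symmetric e1 by apply: add_clique_sym.
have e1i : irreflexive e1 by apply: add_clique_irr.
have ee1 x y : e x y -> e1 x y by rewrite /e1 /add_clique => ->.
have BV : B \subset V :\: R by apply: nb_sub.
pose Q := V :\: X.
have Q1E : V :\: R :\: X = Q :\: R by rewrite /Q; clear; seteq.
have Q1lt : #|V :\: R :\: X| < #|V :\: X|.
  rewrite Q1E; apply: proper_card; apply/properP; split; first exact: subsetDl.
  by have /set0Pn[r rR] := R0; exists r; [exact: (subsetP RV) | rewrite inE rR].
have tt1 : twin e1 tw by apply: twin_rel tt => x y _ _; apply: ee1.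
(* Deleting [R] costs no more than its sparsity bound. The clique edges may create new common
   neighbours of the twin, but each of these brings a new counted edge. *)
have dens1 : dense c e1 (V :\: R) X tw.
  rewrite /dense; have RQ : R \subset Q by [].
  have d1 := E2_split e RQ (subsetDl V X); have d2 := twin_count_split e tw RQ.
  have d3 := spar R R0 RV nbR.
  have d4 : #|Q| = #|R| + #|Q :\: R| by rewrite -(cardsID R Q) (setIidPr RQ).
  have := @E2_twin_count_rel _ e e1 (V :\: R) tw (Q :\: R) es e1s ee1 _ _ _.
  have -> : Q :\: R \subset V :\: R by rewrite /Q; clear; subs.
  have -> : tw \subset V :\: R by clear -tX RV XV; subs.
  have -> : [disjoint tw & Q :\: R] by rewrite /Q; clear -tX; disj.
  move=> /(_ isT isT isT) d5.
  rewrite Q1E; move: dens; rewrite /dense -/Q.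
  move: d1 d2 d3 d4 d5; clear; move: (_ && _ : nat) => k.
  by move=> -> -> h -> ; lia.
case: (classic (forall R1, R1 != set0 -> R1 \subset V :\: R :\: X -> sparse_at c e1 (V :\: R) X tw R1)) => [sp1|nsp].
  apply: nl; apply: (linked_replace es RV XV lR); apply: (IH _ _ _ tw) => //.
  by split=> //; clear -XV RV; subs.
pose bad R1 := [/\ R1 != set0, R1 \subset V :\: R :\: X &
      #|nb e1 (V :\: R) R1| < #|X| /\ 2 * c * #|R1| + 2 * twin_count e1 tw R1 < E2 e1 (V :\: R) R1].
have [R1 [[R10 R1Q [nb1 viol]] minR1]] : exists R1, bad R1 /\ forall R2, bad R2 -> #|R1| <= #|R2|.
  apply: NNPP => no; apply: nsp => R1 R10 R1Q lt; rewrite leqNgt; apply/negP=> viol.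
  by apply: no; apply: (@ex_min_card _ bad R1).
set N1 := nb e1 (V :\: R) R1 in nb1.
have VR : X \subset V :\: R by clear -XV RV; subs.
have [disj|/set0Pn[b]] := eqVneq (R1 :&: B) set0.
  have e1E x y : x \in R1 -> e1 x y = e x y.
    move=> xR1; rewrite /e1 /add_clique.
    have -> : x \in B = false by have := eqset_at x disj; rewrite !inE xR1 /= andbT => /negPf.
    by rewrite /= andbF orbF.
  have R1B y : y \in R -> forall x, x \in R1 -> e x y -> False.
    move=> yR x xR1 xy; have : x \in B.
      by apply: (nb_in yR); [rewrite es | clear -R1Q xR1; setat x | clear -R1Q xR1; setat x].
    by clear -xR1 disj; setat x.
  have nE : nb e V R1 = N1.
    apply/setP=> y; apply/idP/idP=> /nbP[yV [yR [z zR1 zy]]]; apply: (nb_in zR1) => //.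
    - by rewrite e1E.
    - by rewrite inE yV andbT; apply/negP=> yR'; apply: (R1B y yR' z).
    - by rewrite -(e1E z).
    - by clear -yV; setat y.
  have EE : E2 e1 (V :\: R) R1 = E2 e V R1.
    congr #|pred_of_set _|; apply/setP=> -[u v]; rewrite !inE /=.
    have [uR1|uR1] := boolP (u \in R1).
      rewrite e1E //=; case uv: (e u v); rewrite ?andbF //=.
      have -> : v \notin R by apply/negP=> vR; apply: (R1B v vR u).
      by have := subsetP R1Q u uR1; rewrite !inE => /andP[_ /andP[-> ->]].
    have [vR1|vR1] := boolP (v \in R1); last by rewrite /= !andbF.
    rewrite e1s es e1E //=; case uv: (e v u); rewrite ?andbF //=.
    have -> : u \notin R by apply/negP=> vR; apply: (R1B u vR v).
    by have := subsetP R1Q v vR1; rewrite !inE => /andP[_ /andP[-> ->]].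
  have dE : twin_count e1 tw R1 = twin_count e tw R1.
    congr #|pred_of_set _|; apply/setP=> u; rewrite !inE; case uR: (u \in R1) => //=.
    by have -> : Nb e1 u = Nb e u by apply/setP=> v; rewrite !inE e1E.
  have := spar R1 R10; rewrite /sparse_at nE -EE -dE; move: viol nb1; clear -R1Q.
  have -> : R1 \subset V :\: X by subs.
  by move=> v n /(_ isT n); rewrite leqNgt v.
rewrite inE => /andP[bR1 bB].
(* [R1] contains a vertex of the clique, so the whole clique lies in [R1] or next to it; absorbing
   [R] leaves the boundary [N1] unchanged. *)
have BN : B \subset R1 :|: N1.
  apply/subsetP=> y yB; rewrite inE; have [//|yR1 /=] := boolP (y \in R1).
  apply: (nb_in bR1) => //; last exact: (subsetP BV).
  rewrite /e1 /add_clique bB yB !andbT; apply/orP; right.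
  by apply: contraNneq yR1 => <-.
have R1V : R1 \subset V :\: R by clear -R1Q; subs.
have [tw' cls1] : exists tw', admissible c e1 (R1 :|: N1) N1 tw'.
  apply: (min_violation_admissible e1s VR Xc tt1 tX R1Q nb1 viol) => R2 R20 R2R1 lt nb2.
  rewrite leqNgt; apply/negP=> viol2.
  suff : #|R1| <= #|R2| by rewrite leqNgt lt.
  apply: minR1.
  by split=> //; exact: subset_trans R2R1 R1Q.
have l1 : linked e1 (R1 :|: N1) N1.
  apply: (IH _ _ _ tw') => //; rewrite setU_nbD; apply: leq_ltn_trans Q1lt; exact: subset_leq_card.
have N1V : N1 \subset V :\: R :\: R1 by apply: nb_sub.
have nbU : nb e V (R1 :|: R) = N1.
  apply/setP=> y; apply/idP/idP.
    move=> /nbP[yV [yR [z zR1 zy]]].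
    have yR1 : y \notin R1 by clear -yR; setat y.
    have yR' : y \notin R by clear -yR; setat y.
    case: (boolP (z \in R)) => [zR|zR].
      by have := nb_in zR zy yV yR'; rewrite -/B => yB; clear -yB yR1 BN; setat y.
    have zR1' : z \in R1 by clear -zR zR1; setat z.
    by apply: (nb_in zR1'); [exact: ee1 | rewrite inE yR' | ].
  move=> yN; have /nbP[yV [yR1 [z zR1 /orP[zy|/and3P[_ zB yB]]]]] := yN.
    by apply: (nb_in _ zy); [rewrite inE zR1 | clear -yV; setat y | clear -yV yR1; setat y].
  have /nbP[_ [_ [w wR wy]]] := yB.
  by apply: (nb_in _ wy); [rewrite inE wR orbT | clear -yV; setat y | clear -yV yR1; setat y].
have rU : rigid e V X (R1 :|: R).
  split.
  - by apply/set0Pn; exists b; rewrite inE bR1.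
  - by clear -R1Q RV; subs.
  - by rewrite nbU; apply: ltnW.
  rewrite nbU.
  have V2 : R :|: nb e V R \subset R1 :|: R :|: N1 by rewrite -/B; clear -BN; subs.
  have V2' : R1 :|: R :|: N1 \subset V by clear -N1V R1V RV; subs.
  have RN : R \subset (R1 :|: R :|: N1) :\: N1 by clear -N1V; subs.
  apply: (linked_replace es RN); first exact: subsetUr.
    by rewrite (nb_within V2 V2').
  rewrite (nb_within V2 V2') -/B -/e1.
  have -> : (R1 :|: R :|: N1) :\: R = R1 :|: N1 by clear -N1V R1V; seteq.
  by [].
have := maxR (R1 :|: R); rewrite nbU => /(_ (conj rU nb1)).
rewrite leqNgt => /negP; apply; apply: proper_card; apply/properP; split; first exact: subsetUr.
by exists b; [rewrite inE bR1 | clear -bB BV; setat b].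
Qed.

(** Among the regions containing [R], one with smallest boundary either leaves no obstruction to
    linking [X] to the boundary of [R], or has a boundary smaller than [X] and is rigid itself, by
    the same Menger argument inside it. *)
Lemma no_rigid c e V X tw R : symmetric e -> irreflexive e -> admissible c e V X tw ->
  linked_below c #|V :\: X| -> ~ linked e V X -> ~ rigid e V X R.
Proof.
move=> es ei cl IH nl rR; have [XV _ _ _ _] := cl; have [R0 RV nbX lR] := rR.
have [R2 [[RR2 R2V] minR2]] :=
  ex_min_nat (fun R2 => #|nb e V R2|) (conj (subxx R) RV : (fun R2 => R \subset R2 /\ R2 \subset V :\: X) R).
have [lt|ge] := ltnP #|nb e V R2| #|X|; last first.
  apply: nl; apply: (menger_linked es XV RV lR) => R3 h1 h2.
  by apply: leq_trans ge _; apply: minR2.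
apply: (no_rigid_small es ei cl IH nl _ lt); split=> //; [|exact: ltnW|].
  by have /set0Pn[z zR] := R0; apply/set0Pn; exists z; apply: (subsetP RR2).
have sV : R2 :|: nb e V R2 \subset V by have := nb_sub e V R2 => h; subs.
have E := nb_sub_within RR2 (subxx _) sV.
apply: (@menger_linked _ _ _ R) => //; first exact: subsetUr.
- by rewrite setU_nbD.
- by rewrite E.
- move=> R3 RR3; rewrite setU_nbD => R32; rewrite (nb_sub_within R32 (subxx _) sV).
  by apply: minR2; split=> //; exact: subset_trans R32 R2V.
Qed.

Lemma contract_irr e x y : irreflexive (contract e x y).
Proof. by move=> a; rewrite /contract eqxx. Qed.

Lemma contract_sub e x y a b : irreflexive e -> e a b -> contract e x y a b.
Proof.
by move=> ei ab; rewrite /contract ab andbT; apply: contraTneq ab => ->; rewrite ei.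
Qed.

Lemma contract_other e x y a b : irreflexive e -> a != x -> b != x -> contract e x y a b = e a b.
Proof.
move=> ei ax bx; apply/idP/idP; last exact: contract_sub.
by rewrite /contract (negPf ax) (negPf bx) /= orbF => /andP[].
Qed.

Lemma contract_to e x y a t : irreflexive e -> t != x -> t != y -> a != y ->
  contract e x y a t = if a == x then e x t || e y t else e a t.
Proof.
move=> ei tx ty ay; case: eqVneq => [->|ax]; last exact: contract_other.
by rewrite /contract eq_sym tx eqxx (negPf tx) /= orbF.
Qed.

Lemma admissible_twin_sub c e V X tw R : symmetric e -> irreflexive e -> admissible c e V X tw ->
  R != set0 -> R \subset V :\: X -> #|nb e V R| = #|X| ->
  forall tw', twin e tw' -> tw' \subset nb e V R ->
  (tw \subset nb e V R -> tw != set0 -> tw' = tw) ->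
  2 * c * #|R| + 2 * twin_count e tw' R + 2 * ((tw' == set0) && (#|X| == c)) < E2 e V R ->
  linked_below c #|V :\: X| -> #|R| < #|V :\: X| -> rigid e V X R.
Proof.
move=> es ei [XV Xc [tt tX] dens spar] R0 RV nbX tw' tt' tw'N tw'E viol IH Rlt.
have sV : R :|: nb e V R \subset V by have := nb_sub e V R => h; subs.
have RV' : R \subset V by subs.
split=> //; first by rewrite nbX.
apply: (IH _ _ _ tw') => //; last by rewrite setU_nbD.
split=> //; first exact: subsetUr.
- by rewrite nbX.
- by rewrite /dense setU_nbD (E2_within es RV' (subxx _) (subxx _) sV) nbX.
move=> R1 R10; rewrite setU_nbD /sparse_at => R1R.
rewrite (nb_sub_within R1R (subxx _) sV) (E2_within es RV' R1R (subxx _) sV) nbX => lt.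
apply: leq_trans (spar R1 R10 (subset_trans R1R RV) lt) _; rewrite leq_add2l leq_mul2l /=.
have [tN|tN] := boolP (tw \subset nb e V R); last by rewrite (twin_count_nb0 es tX XV R1R RV tN).
have [->|t0] := eqVneq tw set0; first by rewrite twin_set0.
by rewrite tw'E.
Qed.

(** If the inequality failed, contracting [x y] would preserve density. A solution of the
    contraction lifts, so sparsity must fail there, at a minimal region [R]; in either position of
    [x] this yields a rigid region of the original graph. *)
Lemma contraction_ineq c e V X tw x y : symmetric e -> irreflexive e -> admissible c e V X tw ->
  linked_below c #|V :\: X| -> ~ linked e V X ->
  x \in V -> x \notin tw -> y \in V -> y \notin X -> e x y ->
  c + twin_count e tw (V :\: X) <= twin_count (contract e x y) tw (V :\: X :\ y) + #|loss e V X x y|.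
Proof.
move=> es ei cl IH nl xV xt yV yX xy; have [XV Xc [tt tX] dens spar] := cl.
rewrite leqNgt; apply/negP=> lt.
set e' := contract e x y in lt; pose V' := V :\ y; pose Q := V :\: X.
have es' : symmetric e' by apply: contract_sym.
have ei' : irreflexive e' by apply: contract_irr.
have xney : x != y by apply: contraTneq xy => ->; rewrite ei.
have QE : V' :\: X = Q :\ y by rewrite /V' /Q; clear; seteq.
have yQ : y \in Q by rewrite inE yV yX.
have Qc : #|Q| = #|Q :\ y|.+1 by rewrite (cardsD1 y) yQ.
have Qlt : #|V' :\: X| < #|V :\: X| by rewrite QE -/Q Qc.
have XV' : X \subset V'.
  by apply/subsetP=> z zX; rewrite !inE (subsetP XV) // andbT; apply: contraNneq yX => <-.
have tt' : twin e' tw by apply: twin_rel tt => a b _ _; exact: contract_sub.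
have dens' : dense c e' V' X tw.
  have h := E2_contract es ei XV xV yV yX xy; move: dens h lt; rewrite /dense QE -/Q -/V' -/e' Qc.
  by move: (_ && _ : nat) => k; clear; lia.
have nl' : ~ linked e' V' X by move=> h; apply: nl; apply: (linked_lift es xy yV yX).
pose bad R := [/\ R != set0, R \subset V' :\: X &
      #|nb e' V' R| < #|X| /\ 2 * c * #|R| + 2 * twin_count e' tw R < E2 e' V' R].
have [R [[R0 RQ [nbX viol]] minR]] : exists R, bad R /\ forall R1, bad R1 -> #|R| <= #|R1|.
  apply: NNPP => no; apply: nl'; apply: (IH _ _ _ tw) => //; split=> // R R0 RQ lt1.
  rewrite leqNgt; apply/negP=> viol; apply: no; apply: (@ex_min_card _ bad R).
  by split.
set B := nb e' V' R in nbX.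
have RV : R \subset V :\: X by apply: subset_trans RQ _; rewrite QE; exact: subsetDl.
have yR : y \notin R by apply/negP=> /(subsetP RQ); rewrite !inE eqxx andbF.
have Rlt : #|R| < #|V :\: X|.
  by apply: leq_ltn_trans Qlt; exact: subset_leq_card.
have BV : B \subset V' :\: R by apply: nb_sub.
have e'y a b : e' a b -> b != x -> e a b \/ a = x /\ e y b.
  by move=> /andP[_ /or3P[|/andP[/eqP-> ?]|/andP[->]//]]; [left|right].
(* When [x] lies in [R], putting [y] back gives a region with the same boundary [B]. Otherwise [x]
   will turn out to lie on the boundary. *)
have [xR|xR] := boolP (x \in R).
  have nE : nb e V (y |: R) = B.
    apply/setP=> b; apply/idP/idP.
      move=> /nbP[bV [bR [z zR zb]]]; move: bR; rewrite !inE negb_or => /andP[b_y bR].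
      have bV' : b \in V' by rewrite !inE b_y.
      move: zR; rewrite !inE => /orP[/eqP zy|zR].
        apply: (nb_in xR) => //; rewrite /e' /contract -zy zb eqxx orbT andbT.
        by apply: contraNneq bR => <-.
      by apply: (nb_in zR) => //; exact: contract_sub.
    move=> /nbP[bV [bR [z zR zb]]].
    have bV' : b \in V by move: bV; rewrite !inE => /andP[].
    have bR' : b \notin y |: R by move: bV; rewrite !inE negb_or bR andbT => /andP[].
    have bx : b != x by apply: contraNneq bR => ->.
    case: (e'y _ _ zb bx) => [zb'|[_ yb]].
      by apply: (nb_in _ zb') => //; rewrite inE zR orbT.
    by apply: (nb_in _ yb) => //; rewrite !inE eqxx.
  have [tw' cl'] : exists tw', admissible c e' (R :|: B) B tw'.
    apply: (min_violation_admissible es' XV' Xc tt' tX RQ nbX viol) => R1 R10 R1R lt1 nb1.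
    rewrite leqNgt; apply/negP=> viol1.
    suff : #|R| <= #|R1| by rewrite leqNgt lt1.
    by apply: minR; split=> //; exact: subset_trans R1R RQ.
  have l' : linked e' (R :|: B) B by apply: (IH _ _ _ tw') => //; rewrite setU_nbD.
  have yB : y \notin B by apply/negP=> /(subsetP BV); rewrite !inE eqxx andbF.
  apply: (no_rigid_small es ei cl IH nl (R := y |: R)); last by rewrite nE.
  split; [by apply/set0Pn; exists x; rewrite inE xR orbT | by rewrite subUset sub1set yQ | |].
    by rewrite nE ltnW.
  rewrite nE; apply: (linked_lift es xy) => //; first by rewrite !inE eqxx.
  have -> // : (y |: R :|: B) :\ y = R :|: B.
  by apply/setP=> z; rewrite !inE; case: eqVneq => [->|] //=; rewrite (negPf yR) (negPf yB).
have eR r b : r \in R -> b != x -> e' r b = e r b.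
  by move=> rR bx; apply: contract_other => //; apply: contraNneq xR => <-.
have RV' : R \subset V by apply: subset_trans RV (subsetDl _ _).
have dE R1 : R1 \subset R -> twin_count e' tw R1 = twin_count e tw R1.
  move=> R1R; congr #|pred_of_set _|; apply/setP=> r; rewrite !inE; case rR: (r \in R1) => //=.
  congr (_ && _); apply/subsetP/subsetP=> h t tt1; have := h t tt1; rewrite !inE eR //.
  - exact: (subsetP R1R).
  - by apply: contraNneq xt => <-.
  - exact: (subsetP R1R).
  - by apply: contraNneq xt => <-.
have EE := E2_contract_away es ei xV yV xy RV' xR yR.
have violR : 2 * c * #|R| + 2 * twin_count e tw R < E2 e V R.
  by move: viol; rewrite EE dE // -/e' -/V'; clear; lia.
(* Sparsity before the contraction excludes a boundary smaller than [X], while undoing the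
   contraction adds at most [y] to [B]. So the boundary is [B] with [y], of exactly |X| vertices. *)
have nbR : #|X| <= #|nb e V R|.
  by rewrite leqNgt; apply/negP=> h; have := spar R R0 RV h; rewrite leqNgt violR.
have nbs : nb e V R \subset y |: B.
  apply/subsetP=> b /nbP[bV [bR [z zR zb]]]; rewrite !inE.
  have [//|b_y /=] := eqVneq b y; apply: (nb_in zR) => //; first exact: contract_sub.
  by rewrite !inE b_y.
have c1 : #|y |: B| <= #|B|.+1 by rewrite cardsU1; case: (_ \notin _).
have nE : nb e V R = y |: B.
  by apply/eqP; rewrite eqEcard nbs; move: c1 nbR nbX; clear; lia.
have nbX' : #|nb e V R| = #|X|.
  by move: c1 nbR nbX; rewrite nE; clear; lia.
have xB : x \in B.
  have : y \in nb e V R by rewrite nE !inE eqxx.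
  move=> /nbP[_ [_ [r rR ry]]]; apply: (nb_in rR) => //; last by rewrite !inE xney.
  rewrite /e' /contract eqxx ry !orbT andbT; by apply: contraNneq xR => <-.
have fin tw' : twin e tw' -> tw' \subset nb e V R ->
  (tw \subset nb e V R -> tw != set0 -> tw' = tw) ->
  2 * c * #|R| + 2 * twin_count e tw' R + 2 * ((tw' == set0) && (#|X| == c)) < E2 e V R -> False.
  move=> t1 t2 t3 t4; apply: (no_rigid es ei cl IH nl (R := R)).
  exact: (admissible_twin_sub es ei cl R0 RV nbX' t1 t2 t3 t4 IH Rlt).
have [/andP[tN t0]|tN] := boolP ((tw \subset nb e V R) && (tw != set0)).
  by apply: (fin tw) => //; rewrite (negPf t0) muln0 addn0.
have tN' (tw' : {set T}) : tw \subset nb e V R -> tw != set0 -> tw' = tw by move=> h1 h2; rewrite h1 h2 in tN.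
(* At full size the empty twin would owe the extra summand of [dense]. With the twin [set x; y] this
   summand vanishes, and the discount equals the number of edges that the contraction had merged. *)
have [Xc'|Xc'] := eqVneq #|X| c.
  apply: (fin [set x; y] _ _ (tN' _)).
  - by right; exists x, y.
  - by rewrite nE subUset !sub1set !inE eqxx xB orbT.
  - have -> /= : [set x; y] == set0 = false by apply/negbTE/set0Pn; exists x; rewrite !inE eqxx.
    by move: viol; rewrite EE -/e' -/V'; clear; lia.
apply: (fin set0 _ _ (tN' _)); [by left | by rewrite sub0set |].
by rewrite (negPf Xc') andbF twin_set0; move: violR; clear; lia.
Qed.
End TW.

(** * Common neighbours *)

Section HF.
Variable T : finType.
Implicit Types (e : rel T) (B V R X Q tw I : {set T}) (x y : T).

(** The contraction inequality for an edge from the boundary into [I], expressed inside [I] and [B]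
    alone. The twin helps by at most one, however many of its vertices are adjacent to [y]. *)
Definition rich c e tw I B : Prop := forall x y, x \in B -> x \notin tw -> y \in I -> e x y ->
  c <= #|Nb e x :&: Nb e y :&: I| + #|(Nb e y :&: B) :\ x :\: tw|
       + (Nb e y :&: B :&: tw != set0).

Lemma common_neighbours c e V X tw I : symmetric e -> irreflexive e ->
  X \subset V -> twin e tw -> tw \subset X -> I \subset V :\: X ->
  (forall x y, x \in V -> x \notin tw -> y \in V -> y \notin X -> e x y ->
     c + twin_count e tw (V :\: X) <= twin_count (contract e x y) tw (V :\: X :\ y) + #|loss e V X x y|) ->
  rich c e tw I (nb e V I).
Proof.
move=> es ei XV tt tX IV ineq x y xB xt yI xy; set B := nb e V I in xB *.
have [xV [xI _]] := nbP _ _ _ _ xB.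
have yVX := subsetP IV y yI; move: (yVX); rewrite inE => /andP[yX yV].
have xney : x != y by apply: contraTneq xy => ->; rewrite ei.
have {ineq} h := ineq x y xV xt yV yX xy.
have BP b : b \in V -> b \notin I -> e y b -> b \in B by move=> bV bI yb; apply: (nb_in yI).
have lossE : #|loss e V X x y| <=
   #|Nb e x :&: Nb e y :&: I| + #|(Nb e y :&: B) :\ x :\: tw| + #|loss e V X x y :&: tw|.
  apply: leq_trans (leq_trans (leq_card_setU _ _) (leq_add (leq_card_setU _ _) (leqnn _))).
  apply: subset_leq_card; apply/subsetP=> b bl; rewrite 2!in_setU [X in _ || X]in_setI bl /=.
  have [bt|bt] := boolP (b \in tw); rewrite ?orbT //= orbF.
  move: bl; rewrite inE => /and4P[bV bx yb bb]; rewrite !inE bx yb bt /= andbT.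
  have [bI|bI] := boolP (b \in I); last by rewrite BP ?orbT.
  have bX : b \notin X by clear -bI IV; setat b.
  by move: bb; rewrite (negPf bX) andbF orbF => ->.
(* Contraction alters the twin count only at [y], which disappears, and at [x], which may become a
   common neighbour. Both effects are played off against the lost edges to the twin; the final case
   analysis runs over the adjacencies of [x] and [y] to the twin and over whether [x] is in [X]. *)
suff : #|loss e V X x y :&: tw| + twin_count (contract e x y) tw (V :\: X :\ y) <=
   twin_count e tw (V :\: X) + (Nb e y :&: B :&: tw != set0).
  by move: h lossE; clear; move: (_ != _ : nat) => k; lia.
case: tt => [->|[x0 [y0 [tE x0y0 exy]]]]; first by rewrite setI0 cards0 !twin_set0.
have tn0 : tw != set0 by apply/set0Pn; exists x0; rewrite tE !inE eqxx.
have tP t : t \in tw -> [/\ t \in V, t \notin I, t != x, t != y & t \in X].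
  move=> tt; have tX' := subsetP tX t tt; split=> //; first exact: (subsetP XV).
  - by clear -tX' IV; setat t.
  - by apply: contraNneq xt => <-.
  - by apply: contraNneq yX => <-.
have x0t : x0 \in tw by rewrite tE !inE eqxx.
have y0t : y0 \in tw by rewrite tE !inE eqxx orbT.
have [x0V x0I x0x x0y x0X] := tP x0 x0t; have [y0V y0I y0x y0y y0X] := tP y0 y0t.
have dE e' Q a : a \in twin_set e' tw Q = [&& a \in Q, e' a x0 & e' a y0].
  by rewrite inE tn0 /= tE subUset !sub1set !inE.
have kE : (e y x0 || e y y0 : nat) <= (Nb e y :&: B :&: tw != set0).
  case: (boolP (_ || _)) => // /orP[] yt; rewrite lt0b; apply/set0Pn.
    by exists x0; rewrite !inE yt x0t BP.
  by exists y0; rewrite !inE yt y0t BP.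
have lE : #|loss e V X x y :&: tw| = (e y x0 && (e x x0 || (x \in X))) + (e y y0 && (e x y0 || (x \in X))).
  rewrite (cardsD1 x0) (cardsD1 y0) (_ : _ :\ x0 :\ y0 = set0); last first.
    by apply/setP=> t; rewrite tE !inE; case: (t == x0); case: (t == y0); rewrite /= ?andbF.
  rewrite cards0 addn0 in_setD1 !in_setI x0t y0t !andbT [y0 == x0]eq_sym x0y0 /= !inE.
  by rewrite x0V x0x x0X y0V y0x y0X !andbT.
set e' := contract e x y in h *; pose Q := V :\: X.
have e't a t : t \in tw -> a != y -> e' a t = if a == x then e x t || e y t else e a t.
  by move=> /tP[_ _ tx ty _] ay; apply: contract_to.
have dlE : twin_count e tw Q = (e y x0 && e y y0) + ((x \in Q) && (e x x0 && e x y0)) + #|twin_set e tw Q :\ y :\ x|.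
  by rewrite /twin_count (cardsD1 y) (cardsD1 x (_ :\ y)) in_setD1 !dE yVX xney addnA.
have dlE' : twin_count e' tw (Q :\ y) = ((x \in Q) && ((e x x0 || e y x0) && (e x y0 || e y y0))) + #|twin_set e' tw (Q :\ y) :\ x|.
  by rewrite /twin_count (cardsD1 x) dE in_setD1 xney /= !e't // eqxx.
have sub : #|twin_set e' tw (Q :\ y) :\ x| <= #|twin_set e tw Q :\ y :\ x|.
  apply: subset_leq_card; apply/subsetP=> a; rewrite !in_setD1 !dE in_setD1 => /andP[ax /and3P[/andP[ay aQ]]].
  by rewrite !e't // (negPf ax) => -> ->; rewrite ay aQ.
have xQ : (x \in Q) = ~~ (x \in X) by rewrite inE xV andbT.
rewrite lE dlE dlE' xQ; move: kE sub; clear; move: #|_| #|_| (_ != _ : nat) => a b k.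
by move: (e y x0) (e y y0) (e x x0) (e x y0) (x \in X) => [] [] [] [] [] /=; lia.
Qed.

Lemma min_cut e V X : V :\: X != set0 -> X \subset V -> exists I,
  [/\ I != set0, I \subset V :\: X, #|nb e V I| <= #|X|,
      forall R, R != set0 -> R \subset V :\: X -> #|nb e V I| <= #|nb e V R|
    & forall R, R != set0 -> R \subset I -> R != I -> #|nb e V I| < #|nb e V R|].
Proof.
move=> Q0 XV.
(* The factor |T| + 1 exceeds every |I|, so the weight orders regions lexicographically, by boundary
   and then by size. *)
have [I [[I0 IV] minI]] := ex_min_nat (fun I => #|nb e V I| * #|T|.+1 + #|I|)
  (conj Q0 (subxx _) : (fun I => I != set0 /\ I \subset V :\: X) (V :\: X)).
have le R : R != set0 -> R \subset V :\: X -> #|nb e V I| <= #|nb e V R|.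
  move=> R0 RV; have h1 := minI R (conj R0 RV); have h2 : #|R| <= #|T| := max_card _.
  rewrite leqNgt; apply/negP=> ba; have : (#|nb e V R|.+1) * #|T|.+1 <= #|nb e V I| * #|T|.+1.
    by rewrite leq_mul2r ba orbT.
  rewrite mulSn; move: h1 h2; clear; lia.
exists I; split=> //.
  apply: leq_trans (le _ Q0 (subxx _)) _; apply: subset_leq_card.
  have := nb_sub e V (V :\: X) => h; subs.
move=> R R0 RI RnI; rewrite ltn_neqAle le //; last exact: subset_trans RI IV.
rewrite andbT; apply/negP=> /eqP E; have := minI R (conj R0 (subset_trans RI IV)).
rewrite E leq_add2l leqNgt => /negP; apply; apply: proper_card.
by rewrite properEneq RnI.
Qed.
End HF.

(** * Pairs of disjoint paths *)

Section Paths.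
Variable T : finType.
Implicit Types (e : rel T) (U M : {set T}) (x y : T) (D : T -> {set T}).
Implicit Types (P p q : seq T).

Lemma sorted_mid e p x q : sorted e (p ++ x :: q) = sorted e (rcons p x) && path e x q.
Proof. by case: p => [|y p] //=; rewrite cat_path rcons_path /= andbA. Qed.

Lemma set_cat p q : [set x in p ++ q] = [set x in p] :|: [set x in q].
Proof. by apply/setP=> x; rewrite !inE mem_cat. Qed.

Lemma conn_sorted e P : symmetric e -> sorted e P -> conn e [set x in P].
Proof.
move=> es; elim: P => [|x [|y P] IH] /=.
- by move=> _; rewrite set_nil; exact: conn0.
- by move=> _; rewrite set_cons set_nil setU0; exact: conn1.
- move=> /andP[xy yP]; rewrite set_cons; apply: (@conn_add1 _ _ _ y) => //; [exact: IH | | by rewrite es].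
  by rewrite !inE eqxx.
Qed.

Definition heads P : {set T} := if P is x :: _ then [set x] else set0.
Definition lasts P : {set T} := if P is x :: p then [set last x p] else set0.

Lemma heads_mid p x q q' : heads (p ++ x :: q) = heads (p ++ x :: q').
Proof. by case: p. Qed.

Lemma lasts_mid p p' x q : lasts (p ++ x :: q) = lasts (p' ++ x :: q).
Proof. by case: p p' => [|y p] [|y' p'] //=; rewrite ?last_cat. Qed.

Lemma heads_sub P : heads P \subset [set x in P].
Proof. by case: P => [|x p]; rewrite /= ?sub0set // sub1set !inE eqxx. Qed.

Lemma lasts_sub P : lasts P \subset [set x in P].
Proof. by case: P => [|x p]; rewrite /= ?sub0set // sub1set inE mem_last. Qed.

Lemma card_heads P : #|heads P| = (P != [::]).
Proof. by case: P => [|x p]; rewrite /= ?cards0 ?cards1. Qed.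

(* Either path may be empty. *)
Definition path_pair e M U1 U2 P1 P2 : Prop :=
  [/\ sorted e P1 /\ sorted e P2, uniq (P1 ++ P2), [set x in P1 ++ P2] \subset M,
      U1 = heads P1 :|: heads P2 & U2 = lasts P1 :|: lasts P2].

Lemma path_pair_sym e M U1 U2 P1 P2 : path_pair e M U1 U2 P1 P2 -> path_pair e M U1 U2 P2 P1.
Proof.
move=> [[s1 s2] u sM -> ->]; split; rewrite 1?setUC //; first by rewrite uniq_catC.
by rewrite set_cat setUC -set_cat.
Qed.

Lemma linkable_path e P : symmetric e -> sorted e P -> linkable e [set x in P] (heads P) (lasts P).
Proof.
move=> es sP; exists (fun _ => [set x in P]); split.
- by move=> a aP; split=> //; [exact: (subsetP (heads_sub P)) | exact: conn_sorted].
- move=> a; case: P {sP} => [|x p] /=; first by rewrite inE.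
  by move=> _; exists (last x p); rewrite inE ?mem_last.
- by move=> a a' x; case: P {sP} => [|y p] /=; rewrite !inE // => /eqP-> /eqP->.
Qed.

Lemma uniq_disj P1 P2 : uniq (P1 ++ P2) -> [disjoint [set x in P1] & [set x in P2]].
Proof.
rewrite cat_uniq => /and3P[_ /hasPn h _]; apply: disjointI => x; rewrite !inE => x1 /h.
by rewrite /= x1.
Qed.

Lemma path_pair_linkable e M U1 U2 P1 P2 : symmetric e -> path_pair e M U1 U2 P1 P2 -> linkable e M U1 U2.
Proof.
move=> es [[s1 s2] u sM -> ->]; apply: (linkable_mono sM); rewrite set_cat.
by apply: linkageU; [exact: uniq_disj | exact: linkable_path | exact: linkable_path].
Qed.

Lemma path_pair_card e M U1 U2 P1 P2 : path_pair e M U1 U2 P1 P2 ->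
  #|U1| = (P1 != [::]) + (P2 != [::]) /\ #|U2| = (P1 != [::]) + (P2 != [::]).
Proof.
move=> [_ /uniq_disj d _ -> ->]; have h1 := heads_sub P1; have h2 := heads_sub P2.
have l1 := lasts_sub P1; have l2 := lasts_sub P2.
rewrite !cardsU (disjoint_setI0 (_ : [disjoint heads P1 & heads P2])); last by disj.
rewrite (disjoint_setI0 (_ : [disjoint lasts P1 & lasts P2])); last by disj.
by rewrite !card_heads cards0 !subn0; case: (P1) (P2) => [|? ?] [|? ?]; rewrite /= ?cards0 ?cards1.
Qed.

Lemma linkable_path_pair e M U1 U2 : #|U1| = #|U2| -> #|U1| <= 2 -> linkable e M U1 U2 ->
  exists P1 P2, path_pair e M U1 U2 P1 P2.
Proof.
move=> cU c2 [D [d1 d2 d3]].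
have pathD u : u \in U1 -> exists p, [/\ path e u p, last u p \in U2, uniq (u :: p) & {subset u :: p <= D u}].
  move=> uU; have [uD _ cD] := d1 u uU; have [w wD wU] := d2 u uU.
  by have [p [pth E up ps]] := conn_path cD uD wD; exists p; split=> //; rewrite E.
case E : #|U1| c2 => [|[|[|n]]] // _.
- move/eqP: E (cU); rewrite cards_eq0 => /eqP U10; rewrite U10 cards0 => /esym/eqP; rewrite cards_eq0 => /eqP->.
  exists [::], [::]; split=> //=; rewrite ?setU0 //; by rewrite set_nil sub0set.
- move/eqP: (E) => /cards1P[u uE]; have uU : u \in U1 by rewrite uE inE.
  have [p [pth lU up ps]] := pathD u uU; exists (u :: p), [::]; split; rewrite ?cats0 //=.
  + by apply/subsetP=> x; rewrite inE => /ps; have [_ /subsetP h _] := d1 u uU; apply: h.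
  + by rewrite setU0.
  + by rewrite setU0; apply/esym/eqP; rewrite eqEcard sub1set lU cards1 -cU E.
move/eqP: (E) => /cards2P[u [v [uv UE]]].
have uU : u \in U1 by rewrite UE !inE eqxx.
have vU : v \in U1 by rewrite UE !inE eqxx orbT.
have [p [pth lU up ps]] := pathD u uU; have [q [pq lV uq qs]] := pathD v vU.
have dis x : x \in u :: p -> x \in v :: q -> False.
  by move=> /ps xu /qs xv; move/eqP: uv; apply; apply: (d3 u v x).
exists (u :: p), (v :: q); split.
- by [].
- rewrite cat_uniq up uq andbT andTb; apply/hasPn => x xq; apply/negP=> xp; exact: (dis x).
- apply/subsetP=> x; rewrite inE mem_cat => /orP[/ps|/qs].
    by have [_ /subsetP h _] := d1 u uU; apply: h.
  by have [_ /subsetP h _] := d1 v vU; apply: h.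
- by rewrite UE.
apply/esym/eqP; rewrite /= eqEcard subUset !sub1set lU lV /= -cU E cards2.
case: eqP => // h; case: (dis (last u p)); first exact: mem_last.
by rewrite h mem_last.
Qed.

Lemma path_pair_avoid e M U1 U2 P1 P2 n : symmetric e -> path_pair e M U1 U2 P1 P2 -> n \notin P1 ++ P2 ->
  linkable e (M :\ n) U1 U2.
Proof.
move=> es [s u sM h l] nP; apply: (@path_pair_linkable _ _ _ _ P1 P2) => //; split=> //.
by rewrite subsetD1 sM inE nP.
Qed.

Lemma path_pair_inner e M U1 U2 p n q P2 : path_pair e M U1 U2 (p ++ n :: q) P2 -> p != [::] -> q != [::] ->
  n \in M :\: (U1 :|: U2).
Proof.
move=> [_ u sM -> ->] p0 q0; have := uniq_disj u; have := heads_sub P2; have := lasts_sub P2.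
move=> l2 h2 d; have nP : n \in [set x in p ++ n :: q] by rewrite inE mem_cat inE eqxx orbT.
have nM : n \in M by apply: (subsetP sM); rewrite inE mem_cat mem_cat inE eqxx orbT.
have nh : n \notin heads (p ++ n :: q).
  case: p p0 u {sM d nP} => //= x p _; rewrite inE mem_cat => /andP[h _]; apply: contra h => /eqP->.
  by rewrite mem_cat inE eqxx orbT.
have nl : n \notin lasts (p ++ n :: q).
  rewrite (lasts_mid p [::]) /=; case: q q0 u {sM d nP nh} => //= x q _.
  rewrite inE -catA cat_uniq => /and3P[_ _]; rewrite cat_cons cons_uniq => /andP[h _].
  by apply: contra h => /eqP E; rewrite {1}E mem_cat mem_last.
by clear -nP nM nh nl l2 h2 d; setat n.
Qed.

Section Critical.
Variables (e : rel T) (M U1 U2 : {set T}).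
Hypothesis es : symmetric e.
Hypothesis crit : forall n, n \in M :\: (U1 :|: U2) -> ~ linkable e (M :\ n) U1 U2.

(** The permutation says that the new paths use the old vertices without [b] and [q], which gives
    uniqueness and inclusion at once. They then avoid the critical vertex [b]. *)
Lemma path_pair_reroute P1 P2 P1' P2' b q : path_pair e M U1 U2 P1 P2 -> b \in M :\: (U1 :|: U2) ->
  perm_eq (P1 ++ P2) ((b :: q) ++ (P1' ++ P2')) -> sorted e P1' -> sorted e P2' ->
  heads P1' :|: heads P2' = heads P1 :|: heads P2 -> lasts P1' :|: lasts P2' = lasts P1 :|: lasts P2 -> False.
Proof.
move=> [_ u sM h l] bM pe s1 s2 hE lE; apply: (crit bM).
have := u; rewrite (perm_uniq pe) cat_uniq => /and3P[_ /hasPn nb u'].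
apply: (@path_pair_avoid _ _ _ _ P1' P2') => //; last first.
  by apply/negP=> /nb; rewrite /= inE eqxx.
split=> //; rewrite ?hE ?lE //; apply: subset_trans sM; apply/subsetP=> x; rewrite !in_set (perm_mem pe) => hx.
by rewrite mem_cat hx orbT.
Qed.

(** The chord bypasses [b], which is an inner vertex of its path and hence outside U1 :|: U2. *)
Lemma no_chord p a b q c r P2 : path_pair e M U1 U2 (p ++ a :: b :: q ++ c :: r) P2 -> ~ e a c.
Proof.
move=> PP ac; have [[s1 s2] u sM h l] := PP.
have bM : b \in M :\: (U1 :|: U2).
  apply: (@path_pair_inner e _ _ _ (rcons p a) _ (q ++ c :: r) P2); rewrite ?cat_rcons //.
    by case: (p).
  by case: (q).
apply: (@path_pair_reroute _ _ (p ++ a :: c :: r) P2 b q PP bM) => //.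
- by apply/permP=> x; do 4!rewrite /= ?count_cat; clear; lia.
- move: s1; rewrite !sorted_mid => /andP[-> /=].
  by rewrite ac => /andP[_]; rewrite cat_path /= => /and3P[_ _ ->].
- by congr (_ :|: _); exact: heads_mid.
- congr (_ :|: _); rewrite -[a :: c :: r]cat1s -[a :: b :: q ++ c :: r]/([:: a, b & q] ++ c :: r) !catA.
  exact: lasts_mid.
Qed.

(** The crossing edges exchange the tails of the two paths. This drops the vertices of [p2] and
    [q2], all of which would be inner and critical, so there are none. *)
Lemma no_crossing p1 a p2 a' p3 q1 b q2 b' q3 :
  path_pair e M U1 U2 (p1 ++ a :: p2 ++ a' :: p3) (q1 ++ b :: q2 ++ b' :: q3) ->
  e a b' -> e b a' -> p2 = [::] /\ q2 = [::].
Proof.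
move=> PP ab ba; have [[s1 s2] u sM h l] := PP.
have key c q : perm_eq (p2 ++ q2) (c :: q) -> c \in M :\: (U1 :|: U2) -> False.
  move=> pe cM; apply: (@path_pair_reroute _ _ (p1 ++ a :: b' :: q3) (q1 ++ b :: a' :: p3) c q PP cM) => //.
  - apply/permP=> x; move/permP/(_ x): pe; do 4!rewrite /= ?count_cat.
    by clear; lia.
  - move: s1 s2; rewrite !sorted_mid => /andP[-> _] /andP[_] /=.
    by rewrite ab cat_path /= => /and3P[_ _ ->].
  - move: s1 s2; rewrite !sorted_mid => /andP[_ +] /andP[-> _] /=.
    by rewrite ba cat_path /= => /and3P[_ _ ->].
  - by congr (_ :|: _); exact: heads_mid.
  - rewrite setUC; congr (_ :|: _).
      rewrite -[b :: a' :: p3]cat1s -[a :: p2 ++ a' :: p3]cat_cons !catA; exact: lasts_mid.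
    rewrite -[a :: b' :: q3]cat1s -[b :: q2 ++ b' :: q3]cat_cons !catA; exact: lasts_mid.
clear s1 s2 u sM h l; split.
  case: p2 PP key => // c p2 PP key; case: (key c (p2 ++ q2)) => //.
  apply: (@path_pair_inner e _ _ _ (rcons p1 a) _ (p2 ++ a' :: p3) _); rewrite ?cat_rcons; [exact: PP| |].
    by case: (p1).
  by case: (p2).
case: q2 PP key => // c q2 PP key; case: (key c (p2 ++ q2)).
  by apply/permP=> x; do 4!rewrite /= ?count_cat; clear; lia.
apply: (@path_pair_inner e _ _ _ (rcons q1 b) _ (q2 ++ b' :: q3) _); rewrite ?cat_rcons; [exact: (path_pair_sym PP)| |].
  by case: (q1).
by case: (q2).
Qed.
End Critical.
End Paths.

(** * Critical vertices *)

Section Crit.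
Variable T : finType.
Implicit Types (e : rel T) (A C R U Z M K N : {set T}) (x y : T) (D : T -> {set T}).
Implicit Types (P p q : seq T).

Lemma split_seq A P k : k < count (mem A) P ->
  exists p a q, [/\ P = p ++ a :: q, a \in A & k <= count (mem A) q].
Proof.
elim: P => //= x P IH; have [xA|xA] := boolP (x \in A).
  by rewrite add1n ltnS => h; exists [::], x, P.
by rewrite add0n => /IH[p [a [q [-> aA h]]]]; exists (x :: p), a, q.
Qed.

Lemma split_seq3 A P : 2 < count (mem A) P -> exists p1 a p2 b p3 c p4,
  [/\ P = p1 ++ a :: p2 ++ b :: p3 ++ c :: p4, a \in A, b \in A & c \in A].
Proof.
move=> /split_seq[p1 [a [q [-> aA /split_seq[p2 [b [q' [-> bA /split_seq[p3 [c [p4 [-> cA _]]]]]]]]]]]].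
by exists p1, a, p2, b, p3, c, p4.
Qed.

Lemma count_card A P : uniq P -> count (mem A) P = #|A :&: [set x in P]|.
Proof.
move=> u; rewrite -size_filter -(card_uniqP _); last exact: filter_uniq.
by apply: eq_card => x; rewrite !inE mem_filter.
Qed.

Lemma heads_cat p q : p != [::] -> heads (p ++ q) = heads p.
Proof. by case: p. Qed.

Lemma lasts_cat p q : q != [::] -> lasts (p ++ q) = lasts q.
Proof. by case: q => // x q _; rewrite (lasts_mid p [::]). Qed.

Lemma cut_of_critical e M U1 U2 : symmetric e -> U1 \subset M -> U2 \subset M -> ~ linkable e M U1 U2 ->
  exists C Z, [/\ C \subset M, separates e M U1 U2 C Z & #|C| < #|U1|].
Proof.
move=> es s1 s2 nl; apply: NNPP => no; apply: nl; apply: menger => // C Z CM sep.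
by rewrite leqNgt; apply/negP=> lt; apply: no; exists C, Z.
Qed.

(** Of three neighbours [a], [b], [c] in this order on [P1], the middle one is inner, hence
    critical, and M :\ b has a cut with fewer than |U1| vertices. The cut meets neither [R] nor the
    two pieces of [P1] around [b], and it separates these pieces; but [R] joins [a] to [c]. *)
Lemma three_neighbours e M U1 U2 P1 P2 R : symmetric e -> path_pair e M U1 U2 P1 P2 ->
  conn e R -> R \subset M :\: (U1 :|: U2) -> R != set0 ->
  (forall n, n \in R -> linkable e (M :\ n) U1 U2) ->
  (forall n, n \in nb e M R -> n \notin U1 :|: U2 -> ~ linkable e (M :\ n) U1 U2) ->
  #|nb e M R :&: [set x in P1]| <= 2.
Proof.
move=> es PP cR RM R0 Rnon nbcrit; have [[s1 s2] u sM h l] := PP.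
rewrite leqNgt -count_card; last by move: u; rewrite cat_uniq => /and3P[].
apply/negP=> /split_seq3[p1 [a [p2 [b [p3 [c [p4 [PE aN bN cN]]]]]]]].
pose q1 := p1 ++ a :: p2; pose q2 := p3 ++ c :: p4.
have PE' : P1 = q1 ++ b :: q2 by rewrite PE /q1 /q2 -!catA.
rewrite PE' in PP s1 u sM h l.
have q10 : q1 != [::] by rewrite /q1; case: (p1).
have q20 : q2 != [::] by rewrite /q2; case: (p3).
have bM := path_pair_inner PP q10 q20.
have bcrit := nbcrit b bN (_ : b \notin U1 :|: U2).
have {bcrit} bcrit : ~ linkable e (M :\ b) U1 U2 by apply: bcrit; clear -bM; setat b.
have [aq1 cq2] : a \in q1 /\ c \in q2 by rewrite !mem_cat !inE !eqxx !orbT.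
clear PE; clearbody q1 q2; clear p1 p2 p3 p4.
have s1' : sorted e q1 /\ sorted e q2.
  move: s1; rewrite sorted_mid => /andP[h1 h2]; split; last exact: path_sorted h2.
  by move: h1; rewrite -cats1; case: (q1) => //= x s; rewrite cat_path => /andP[].
have [sq1 sq2] := s1'.
have hP1 : heads q1 \subset U1 by rewrite h heads_cat // subsetUl.
have lP1 : lasts q2 \subset U2.
  by rewrite l -cat_rcons lasts_cat // subsetUl.
have hP2 : heads P2 \subset U1 by rewrite h subsetUr.
have lP2 : lasts P2 \subset U2 by rewrite l subsetUr.
have qM : [set x in q1] \subset M :\ b /\ [set x in q2] \subset M :\ b /\ [set x in P2] \subset M :\ b.
  have sub (s : seq T) : {subset s <= (q1 ++ b :: q2) ++ P2} -> b \notin s -> [set x in s] \subset M :\ b.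
    move=> ss bs; rewrite subsetD1 inE bs andbT; apply: subset_trans sM; apply/subsetP=> x.
    by rewrite !in_set; exact: ss.
  have ub : perm_eq ((q1 ++ b :: q2) ++ P2) (b :: q1 ++ q2 ++ P2).
    by apply/permP=> x; do 4!rewrite /= ?count_cat; clear; lia.
  move: u; rewrite (perm_uniq ub) /= !mem_cat !negb_or => /andP[/and3P[n1 n2 n3] _].
  by split; [|split]; apply: sub => // x xs; rewrite !mem_cat !inE xs ?orbT.
have [q1M [q2M P2M]] := qM.
have U1M : U1 \subset M :\ b.
  have h1 := heads_sub q1; have h2 := heads_sub P2; rewrite h heads_cat //; clear -h1 h2 q1M P2M; subs.
have U2M : U2 \subset M :\ b.
  have h1 := lasts_sub q2; have h2 := lasts_sub P2; rewrite l -cat_rcons lasts_cat //; clear -h1 h2 q2M P2M; subs.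
have [C [Z [CM [ZM UZ clZ ZU] Clt]]] := cut_of_critical es U1M U2M bcrit.
have conn_Z A : conn e A -> A \subset M :\ b :\: C -> (exists2 x, x \in A & x \in Z) -> A \subset Z.
  by move=> cA AM meet; apply: (conn_meet cA AM).
have ZU2 A : A \subset Z -> (exists2 x, x \in A & x \in U2) -> False.
  by move=> AZ [x xA xU]; clear -AZ xA xU ZU; setat x.
have UZ1 x : x \in U1 -> x \notin C -> x \in Z by clear -UZ; setat x.
have ends P : P != [::] -> (exists2 x, x \in heads P & x \in P) /\ (exists2 x, x \in lasts P & x \in P).
  case: P => // x s _; split; [exists x => /= | exists (last x s) => /=]; rewrite ?inE ?eqxx //.
  by rewrite -in_cons mem_last.
have [C1 C2] := path_pair_card PP.
have P10 : q1 ++ b :: q2 != [::] by case: (q1).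
rewrite P10 /= in C1 C2.
(* The path [P2] avoids [b] and runs from U1 to U2, so it has to meet the cut, which has at most one
   vertex. *)
have CP2 x : x \in C -> x \in P2.
  move=> xC; have [P20|P20] := eqVneq P2 [::].
    by move: Clt; rewrite C1 P20 /= (cardsD1 x) xC.
  have Cle : #|C| <= 1 by move: Clt; rewrite C1; clear; case: (_ != _) => /=; lia.
  apply: contraT => xP; have [[x1 x1h x1P] [x2 x2l x2P]] := ends P2 P20; exfalso.
  have dCP : [disjoint C & [set z in P2]].
    apply: disjointI => z zC; rewrite inE => zP.
    have : z != x by apply: contraNneq xP => <-.
    by move=> zx; have := card1_neq zC xC zx; move: Cle; clear; lia.
  apply: (ZU2 [set z in P2]); last by exists x2; rewrite ?inE // (subsetP lP2).
  apply: conn_Z; [exact: conn_sorted | by clear -P2M dCP; subs |].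
  exists x1; rewrite ?inE //; apply: UZ1; first exact: (subsetP hP2).
  by apply/negP=> x1C; have := disjoint_at x1 dCP; rewrite x1C inE x1P.
have dd := uniq_disj u; rewrite -cat_rcons in dd.
have Cq1 : [disjoint C & [set z in q1]].
  apply: disjointI => z /CP2 zP; rewrite inE => zq; have := disjoint_at z dd.
  by rewrite !in_set mem_cat mem_rcons inE zq zP orbT.
have Cq2 : [disjoint C & [set z in q2]].
  apply: disjointI => z /CP2 zP; rewrite inE => zq; have := disjoint_at z dd.
  by rewrite !in_set mem_cat zq zP orbT.
have q1Z : [set z in q1] \subset Z.
  apply: conn_Z; [exact: conn_sorted | by clear -q1M Cq1; subs |].
  have [[x1 x1h x1P] _] := ends q1 q10; exists x1; rewrite ?inE //; apply: UZ1; first exact: (subsetP hP1).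
  by apply/negP=> x1C; have := disjoint_at x1 Cq1; rewrite x1C inE x1P.
have cZ : c \notin Z.
  apply/negP=> cZ; apply: (ZU2 [set z in q2]).
    apply: conn_Z; [exact: conn_sorted | by clear -q2M Cq2; subs |].
    by exists c; rewrite ?inE.
  by have [_ [x2 x2l x2P]] := ends q2 q20; exists x2; rewrite ?inE // (subsetP lP1).
have bR : b \notin R by have [_ []] := nbP _ _ _ _ bN.
(* A vertex [t] of [R] in the cut would be the whole cut. Since [t] is not critical, two links avoid
   it, and both would have to pass through [b]. *)
have RC : [disjoint R & C].
  apply: disjointI => t tR tC; have [D [d1 d2 d3]] := Rnon t tR.
  have bD v : v \in U1 -> b \in D v.
    move=> vU; have [vD DM cD] := d1 v vU; apply: contraT => bD.
    have CE z : z \in C -> z = t.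
      move=> zC; apply/eqP; apply: contraT => zt; have := card1_neq zC tC zt.
      by move: Clt; rewrite C1; clear; case: (_ != _) => /=; lia.
    have DC : [disjoint D v & C].
      by apply: disjointI => z zD /CE zt; move: (subsetP DM z zD); rewrite zt !inE eqxx.
    have [w wD wU] := d2 v vU; exfalso; apply: (ZU2 (D v)); last by exists w.
    apply: conn_Z => //; last by exists v => //; apply: UZ1 => //; clear -vD DC; setat v.
    have bD' : [disjoint D v & [set b]] by rewrite disjoint_sym disjoints1.
    by clear -DM DC bD'; subs.
  have [v [w [vw vU wU]]] : exists v w, [/\ v != w, v \in U1 & w \in U1].
    have : 1 < #|U1| by apply: leq_ltn_trans Clt; rewrite (cardsD1 t) tC.
    by move=> /card_gt1P[v [w [vU wU vw]]]; exists v, w.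
  by move/eqP: vw; apply; apply: (d3 _ _ b) => //; exact: bD.
have RMb : R \subset M :\ b :\: C.
  by apply/subsetP=> z zR; have zb : z != b; [by apply: contraNneq bR => <- | clear -RM RC zR zb; setat z].
have [aM [_ [ra raR raa]]] := nbP _ _ _ _ aN.
have [cM [_ [rc rcR rcc]]] := nbP _ _ _ _ cN.
have RZ : R \subset Z.
  apply: conn_Z => //; exists ra => //; apply: (clZ a); [by apply: (subsetP q1Z); rewrite inE | exact: (subsetP RMb) | by rewrite es].
case/negP: cZ; apply: (clZ rc) => //; first exact: (subsetP RZ).
have cq : c \in [set z in q2] by rewrite inE.
by clear -cq q2M Cq2; setat c.
Qed.

(* A component of non-critical vertices has neighbours only on the two paths, at most two on each. *)
Lemma rest_critical e M0 U1 U2 K : symmetric e -> #|U1| = #|U2| -> #|U1| <= 2 ->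
  U1 :|: U2 \subset M0 -> K \subset M0 :\: (U1 :|: U2) -> linkable e (M0 :\: K) U1 U2 ->
  (forall n t, n \in M0 :\: K :\: (U1 :|: U2) -> t \in K -> e t n -> ~ linkable e (M0 :\: K :\ n) U1 U2) ->
  (forall R, R != set0 -> R \subset M0 :\: K :\: (U1 :|: U2) -> [disjoint nb e M0 R & K] ->
     2 * #|U1| < #|nb e M0 R|) ->
  forall n, n \in M0 :\: K :\: (U1 :|: U2) -> ~ linkable e (M0 :\: K :\ n) U1 U2.
Proof.
move=> es cU c2 UM KM lM Kcrit big n0 n0M n0lk; set M := M0 :\: K in lM Kcrit big n0M n0lk *.
have [P1 [P2 PP]] := linkable_path_pair cU c2 lM.
have [N NP] := ex_set (fun n => n \in M :\: (U1 :|: U2) /\ linkable e (M :\ n) U1 U2).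
pose R := reach e N [set n0].
have RN : R \subset N by apply: reach_sub.
have NM : N \subset M :\: (U1 :|: U2) by apply/subsetP=> n /NP[].
have R0 : R != set0 by apply/set0Pn; exists n0; apply: reach_self; rewrite ?inE //; apply/NP.
have RM := subset_trans RN NM.
have nbK : [disjoint nb e M0 R & K].
  apply: disjointI => y /nbP[_ [_ [z zR zy]]] yK.
  have /NP[zM zl] := subsetP RN z zR; apply: (Kcrit z y) => //; by rewrite es.
have nbE : nb e M0 R = nb e M R.
  apply/setP=> y; apply/idP/idP => yN; have /nbP[yV [yR [z zR zy]]] := yN; apply: (nb_in zR) => //.
    by rewrite /M inE yV (disjointFr nbK yN).
  by move: yV; rewrite /M inE => /andP[].
have ncrit n : n \in nb e M R -> n \notin U1 :|: U2 -> ~ linkable e (M :\ n) U1 U2.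
  move=> /nbP[nM [nR [z zR zn]]] nU nl; case/negP: nR; apply: (reach_closed zR) => //.
  by apply/NP; rewrite inE nU nM.
have h1 : #|nb e M R :&: [set x in P1]| <= 2.
  apply: (three_neighbours es PP) => //; [exact: conn_reach1 | by move=> n /(subsetP RN)/NP[]].
have h2 : #|nb e M R :&: [set x in P2]| <= 2.
  apply: (three_neighbours es (path_pair_sym PP)) => //; [exact: conn_reach1 | by move=> n /(subsetP RN)/NP[]].
have [C1 _] := path_pair_card PP; have := big R R0 RM nbK; rewrite nbE C1.
have sub : nb e M R \subset (nb e M R :&: [set x in P1]) :|: (nb e M R :&: [set x in P2]).
  apply/subsetP=> y yN; rewrite -setIUr -set_cat in_setI yN /= in_set.
  apply: contraT => yP; exfalso; apply: (ncrit y yN); last exact: (path_pair_avoid es PP).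
  have [_ _ _ -> ->] := PP; move: yP; rewrite mem_cat negb_or => /andP[y1 y2].
  have := heads_sub P1; have := heads_sub P2; have := lasts_sub P1; have := lasts_sub P2.
  have n1 : y \notin [set x in P1] by rewrite inE.
  have n2 : y \notin [set x in P2] by rewrite inE.
  by clear -n1 n2; setat y.
have := leq_trans (subset_leq_card sub) (leq_card_setU _ _).
move: h1 h2; case: (eqVneq P1 [::]) => [->|_]; case: (eqVneq P2 [::]) => [->|_] /=;
  rewrite ?set_nil ?setI0 ?cards0; clear; lia.
Qed.
End Crit.

(** * Few common neighbours along two chordless paths *)

Section Few.
Variable T : finType.
Implicit Types (e : rel T) (A U M J : {set T}) (x y : T).
Implicit Types (P p q : seq T).

Lemma seq_split2 x0 P i j : i < j -> j < size P ->
  P = take i P ++ nth x0 P i :: take (j - i.+1) (drop i.+1 P) ++ nth x0 P j :: drop j.+1 P.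
Proof.
move=> ij jP; have iP := ltn_trans ij jP.
rewrite -[LHS](cat_take_drop i) (drop_nth x0) //; congr (_ ++ _ :: _).
rewrite -[LHS](cat_take_drop (j - i.+1)) drop_drop subnK //; congr (_ ++ _).
by rewrite (drop_nth x0).
Qed.

Definition chordless e x0 P := forall i j, i.+1 < j -> j < size P -> ~ e (nth x0 P i) (nth x0 P j).

Definition crossless e x0 P1 P2 := forall i i' j j', i < i' -> i' < size P1 -> j < j' -> j' < size P2 ->
  e (nth x0 P1 i) (nth x0 P2 j') -> e (nth x0 P2 j) (nth x0 P1 i') -> i' = i.+1 /\ j' = j.+1.

Lemma critical_chordless e M U1 U2 P1 P2 x0 : symmetric e ->
  (forall n, n \in M :\: (U1 :|: U2) -> ~ linkable e (M :\ n) U1 U2) -> path_pair e M U1 U2 P1 P2 ->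
  chordless e x0 P1.
Proof.
move=> es crit PP i j ij jP; have E := seq_split2 x0 (ltnW ij) jP.
have := size_takel (_ : j - i.+1 <= size (drop i.+1 P1)); rewrite size_drop => /(_ _) h.
have {h} : size (take (j - i.+1) (drop i.+1 P1)) = j - i.+1 by apply: h; lia.
case Eq : (take (j - i.+1) (drop i.+1 P1)) => [|b q] /=; first by lia.
by move=> _; rewrite Eq in E; move: PP; rewrite {1}E => PP; apply: (no_chord es crit PP).
Qed.

Lemma critical_crossless e M U1 U2 P1 P2 x0 : symmetric e ->
  (forall n, n \in M :\: (U1 :|: U2) -> ~ linkable e (M :\ n) U1 U2) -> path_pair e M U1 U2 P1 P2 ->
  crossless e x0 P1 P2.
Proof.
move=> es crit PP i i' j j' ii iP jj jP e1 e2.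
have E1 := seq_split2 x0 ii iP; have E2 := seq_split2 x0 jj jP.
move: PP; rewrite {1}E1 {1}E2 => PP; have [/nilP h1 /nilP h2] := no_crossing es crit PP e1 e2.
move: h1 h2; rewrite /nilp !size_takel ?size_drop; lia.
Qed.

Lemma nth_lasts x0 P : P != [::] -> lasts P = [set nth x0 P (size P).-1].
Proof. by case: P => // x p _; rewrite nth_last. Qed.

Section Common.
Variables (e : rel T) (x0 : T) (U2 J : {set T}).
Hypothesis ei : irreflexive e.

(** In the application [J] consists of the neighbours in [I] of a boundary vertex, whereas the paths
    end in the boundary. *)
Definition inner P := forall k, k < size P -> nth x0 P k \in J -> k.+1 < size P.

(** As [y] is the first vertex of [J] on [P1], no chord leaves only its successor as a neighbour in
    [J] on this path. If the successor is in [J] it is not final, so [y] misses the final vertex of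
    [P1]; this pays for the successor. *)
Lemma first_common P1 P2 i : uniq P1 -> chordless e x0 P1 -> inner P1 ->
  lasts P1 :|: lasts P2 \subset U2 -> J \subset [set x in P1 ++ P2] ->
  i < size P1 -> nth x0 P1 i \in J -> (forall k, k < i -> nth x0 P1 k \notin J) ->
  let y := nth x0 P1 i in
  [/\ Nb e y :&: J \subset nth x0 P1 i.+1 |: (Nb e y :&: J :&: [set x in P2]),
      nth x0 P1 i.+1 \in J -> i.+1 < size P1 -> nth x0 P1 (size P1).-1 \in U2 :\: Nb e y
    & #|Nb e y :&: J :&: [set x in P2]| <= 1 -> #|Nb e y :&: J| <= #|U2 :\: Nb e y|.+1].
Proof.
move=> u c1 inn lU JP iP yJ imin y.
have sub : Nb e y :&: J \subset nth x0 P1 i.+1 |: (Nb e y :&: J :&: [set x in P2]).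
  apply/subsetP=> x xJ; move: (xJ); rewrite in_setI => /andP[yx xJ'].
  have := subsetP JP x xJ'; rewrite in_set mem_cat => /orP[xP|xP]; last first.
    by rewrite in_setU1 in_setI xJ inE xP orbT.
  rewrite in_setU1; apply/orP; left; have xE := nth_index x0 xP; have kP : index x P1 < size P1 by rewrite index_mem.
  rewrite inE in yx; move: yx xE kP; move: (index x P1) => k yx xE kP; rewrite -xE in yx xJ' *.
  case: (ltngtP k i) => [ki|ik|E]; first by have := imin k ki; rewrite xJ'.
    case: (ltngtP k i.+1) => [|ik'|->//]; first by rewrite ltnS leqNgt ik.
    by case: (c1 i k ik' kP).
  by rewrite E /y ei in yx.
have lastU : nth x0 P1 i.+1 \in J -> i.+1 < size P1 -> nth x0 P1 (size P1).-1 \in U2 :\: Nb e y.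
  move=> sJ sP; have sP2 := inn _ sP sJ; rewrite !inE; apply/andP; split; last first.
    apply: (subsetP lU); rewrite inE (nth_lasts x0) ?inE ?eqxx //.
    by move: sP; case: (P1).
  by apply/negP; apply: c1; [lia | move: sP2; case: (size P1)].
split=> // c2.
have [sJ|sJ] := boolP ((nth x0 P1 i.+1 \in J) && (i.+1 < size P1)).
  move/andP: sJ => [sJ sP]; have lU2 := lastU sJ sP.
  have : 0 < #|U2 :\: Nb e y| by apply/card_gt0P; exists (nth x0 P1 (size P1).-1).
  have := subset_leq_card sub; rewrite cardsU1; move: c2; case: (_ \notin _) => /=; clear; lia.
apply: leq_trans (leq_trans _ c2) _ => //; apply: subset_leq_card; apply/subsetP=> x xJ.
have := subsetP sub x xJ; rewrite in_setU1 => /orP[/eqP xE|//].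
move: (xJ); rewrite in_setI => /andP[_ xJ']; have := subsetP JP x xJ'.
rewrite in_set mem_cat => /orP[xP|xP]; last by rewrite in_setI xJ inE.
case/negP: sJ; rewrite -xE xJ' /= ltnNge; apply/negP=> ge.
have kP : index x P1 < size P1 by rewrite index_mem.
have := inn _ kP; rewrite nth_index // => /(_ xJ') ks.
have : i < index x P1.
  rewrite ltnNge; apply/negP=> le; move: le; rewrite leq_eqVlt => /orP[/eqP E|lt].
    have := nth_index x0 xP; rewrite E => yx; move: xJ; rewrite -yx inE inE -/y ei.
    by [].
  by have := imin _ lt; rewrite nth_index // xJ'.
by move: ks ge; clear; lia.
Qed.

(** Let [y] and [z] be the first vertices of [J] on the two paths. If one of them has at most one
    neighbour in [J] on the other path, [first_common] suffices. Otherwise edges at [y] and [z]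
    cross, so [y] has at most three neighbours in [J], namely its successor, [z] and the successor
    of [z], and it misses the final vertices of both paths. *)
Lemma few_common_neighbours P1 P2 : uniq (P1 ++ P2) ->
  chordless e x0 P1 -> chordless e x0 P2 -> crossless e x0 P1 P2 -> inner P1 -> inner P2 ->
  lasts P1 :|: lasts P2 \subset U2 -> J \subset [set x in P1 ++ P2] -> J != set0 ->
  exists2 n, n \in J & #|Nb e n :&: J| <= #|U2 :\: Nb e n|.+1.
Proof.
move=> u c1 c1' c2 i1 i2 lU JP J0.
have lU' : lasts P2 :|: lasts P1 \subset U2 by rewrite setUC.
have JP' : J \subset [set x in P2 ++ P1] by rewrite set_cat setUC -set_cat.
have [u1 u2] : uniq P1 /\ uniq P2 by move: u; rewrite cat_uniq => /and3P[].
have dd := uniq_disj u.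
have minidx P : (exists2 x, x \in J & x \in P) ->
   exists i, [/\ i < size P, nth x0 P i \in J & forall k, k < i -> nth x0 P k \notin J].
  move=> [x xJ xP]; exists (find (mem J) P).
  have hp : has (mem J) P by apply/hasP; exists x.
  split; [by rewrite -has_find | exact: (nth_find x0 hp) |].
  by move=> k lt; have := before_find x0 lt => /= ->.
have single P P' i : uniq P -> chordless e x0 P -> inner P -> lasts P :|: lasts P' \subset U2 -> J \subset [set x in P ++ P'] ->
   i < size P -> nth x0 P i \in J -> (forall k, k < i -> nth x0 P k \notin J) ->
   #|Nb e (nth x0 P i) :&: J :&: [set x in P']| <= 1 ->
   exists2 n, n \in J & #|Nb e n :&: J| <= #|U2 :\: Nb e n|.+1.
  move=> h1 h2 h3 h4 h5 h6 h7 h8 h9; exists (nth x0 P i) => //.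
  by have [_ _ h] := first_common h1 h2 h3 h4 h5 h6 h7 h8; apply: h.
case: (classic (exists2 x, x \in J & x \in P1)) => [/minidx[i [iP yJ imin]]|no1]; last first.
  have nJ1 A : A :&: J :&: [set x in P1] = set0.
    apply/setP=> x; rewrite in_set0 !in_setI in_set; apply/negP=> /andP[/andP[_ xJ] xP].
    by apply: no1; exists x.
  have [x xJ] := set0Pn _ J0; have := subsetP JP x xJ; rewrite in_set mem_cat => /orP[xP|xP].
    by case: no1; exists x.
  have [i [iP yJ imin]] : exists i, [/\ i < size P2, nth x0 P2 i \in J & forall k, k < i -> nth x0 P2 k \notin J].
    by apply: minidx; exists x.
  by apply: (single P2 P1 i); rewrite ?nJ1 ?cards0.
case: (classic (exists2 x, x \in J & x \in P2)) => [/minidx[j [jP zJ jmin]]|no2]; last first.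
  apply: (single P1 P2 i) => //; rewrite (_ : _ :&: _ = set0) ?cards0 //.
  apply/setP=> x; rewrite in_set0 !in_setI in_set; apply/negP=> /andP[/andP[_ xJ] xP].
  by apply: no2; exists x.
have [le1|gt1] := leqP #|Nb e (nth x0 P1 i) :&: J :&: [set x in P2]| 1; first exact: (single P1 P2 i).
have [le2|gt2] := leqP #|Nb e (nth x0 P2 j) :&: J :&: [set x in P1]| 1; first exact: (single P2 P1 j).
have other A P k : 1 < #|A :&: J :&: [set x in P]| -> (forall k', k' < k -> nth x0 P k' \notin J) ->
   exists k', [/\ k < k', k' < size P, nth x0 P k' \in A & nth x0 P k' \in J].
  move=> gt kmin; have /card_gt0P[x] : 0 < #|(A :&: J :&: [set x in P]) :\ nth x0 P k|.
    by move: gt; rewrite (cardsD1 (nth x0 P k)); case: (_ \in _) => /=; clear; lia.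
  rewrite in_setD1 !in_setI in_set => /andP[xk /andP[/andP[xA xJ] xP]].
  exists (index x P); rewrite index_mem nth_index //; split=> //.
  rewrite ltnNge leq_eqVlt; apply/negP=> /orP[/eqP E|lt].
    by move/eqP: xk; apply; rewrite -E nth_index.
  by have := kmin _ lt; rewrite nth_index // xJ.
have [j' [jj jP' yj' j'J]] := other _ _ _ gt1 jmin.
have [i' [ii iP' zi' i'J]] := other _ _ _ gt2 imin.
rewrite inE in yj'; rewrite inE in zi'.
have [iE jE] := c2 i i' j j' ii iP' jj jP' yj' zi'.
have [sub lastU _] := first_common u1 c1 i1 lU JP iP yJ imin.
exists (nth x0 P1 i) => //; set y := nth x0 P1 i in yJ yj' sub lastU *.
have i'J' : nth x0 P1 i.+1 \in J by rewrite -iE.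
have l1 := lastU i'J' (_ : i.+1 < size P1); have iP'' := iP'; rewrite iE in iP'; have {l1} l1 := l1 iP'.
have jJ := i2 _ jP' j'J.
have l2 : nth x0 P2 (size P2).-1 \in U2 :\: Nb e y.
  rewrite !inE; apply/andP; split; last first.
    apply: (subsetP lU'); rewrite inE (nth_lasts x0) ?inE ?eqxx //.
    by move: jP; case: (P2).
  have jl : j < (size P2).-1 by move: jJ; rewrite jE; clear; lia.
  have lP : (size P2).-1 < size P2 by move: jJ; clear; lia.
  apply/negP=> yl; have [_] := c2 i i' j (size P2).-1 ii iP'' jl lP yl zi'.
  by move: jJ; rewrite jE; clear; lia.
have lne : nth x0 P1 (size P1).-1 != nth x0 P2 (size P2).-1.
  apply/eqP=> E; have m1 : nth x0 P1 (size P1).-1 \in [set x in P1].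
    by rewrite in_set mem_nth // ltn_predL; apply: leq_ltn_trans iP.
  have m2 : nth x0 P2 (size P2).-1 \in [set x in P2].
    by rewrite in_set mem_nth // ltn_predL; apply: leq_ltn_trans jP.
  by have := disjoint_at (nth x0 P1 (size P1).-1) dd; rewrite m1 E m2.
have U22 := card1_neq l1 l2 lne.
have sub2 : Nb e y :&: J :&: [set x in P2] \subset [set nth x0 P2 j; nth x0 P2 j.+1].
  apply/subsetP=> x; rewrite !in_setI in_set [x \in Nb _ _]inE => /andP[/andP[yx xJ] xP].
  have xE := nth_index x0 xP; have kP : index x P2 < size P2 by rewrite index_mem.
  move: xE kP; move: (index x P2) => k xE kP; rewrite -xE in yx xJ *.
  case: (ltngtP k j) => [kj|jk|->]; last by rewrite !inE eqxx.
    by have := jmin k kj; rewrite xJ.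
  have [] := c2 i i' j k ii iP'' jk kP yx zi'.
  by move=> _ ->; rewrite !inE eqxx orbT.
have := subset_leq_card sub; rewrite cardsU1.
have := subset_leq_card sub2; rewrite cards2.
by move: U22; case: (_ \notin _); case: (_ != _) => /=; clear; lia.
Qed.
End Common.
End Few.

(** * Regions of at least three vertices *)

Section Local.
Variable T : finType.
Implicit Types (C W R S U X Z M K J : {set T}) (x y : T) (D : T -> {set T}).
Variables (e : rel T) (I B tw : {set T}) (c : nat).
Hypotheses (es : symmetric e) (ei : irreflexive e) (dIB : [disjoint I & B]).
Hypothesis hB : forall b, b \in B -> exists2 y, y \in I & e b y.
Hypothesis big : forall R, R != set0 -> R \subset I -> R != I -> #|B| < #|nb e (I :|: B) R|.

(** A proper part closed in [I] would have its boundary inside [B], against [big]. *)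
Lemma local_conn : conn e I.
Proof.
split=> Z Z0 ZI cl; apply: contraT => IZ.
have ZneI : Z != I by apply: contraNneq IZ => ->.
have := big Z0 ZI ZneI; rewrite ltnNge subset_leq_card //.
apply/subsetP=> y /nbP[yV [yZ [z zZ zy]]]; have [yI|yI] := boolP (y \in I).
  by rewrite (cl z) in yZ.
by move: yV; rewrite inE (negPf yI).
Qed.

Lemma solvable_of K S U1 U2 : pattern B S U1 U2 -> K \subset I -> conn e (K :|: S) ->
  linkable e ((I :|: (U1 :|: U2)) :\: K) U1 U2 -> solvable e (I :|: B) B S U1 U2.
Proof.
move=> [SB U1B U2B [d1 d2 d12 _ _]] KI cK [D LD]; exists (K :|: S), D; split=> //.
- exact: subsetUr.
- by clear -dIB SB KI; subs.
apply: linkage_mono LD; clear -dIB SB KI U1B U2B d1 d2; subs.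
Qed.

Lemma local_solvable0 S : S \subset B -> solvable e (I :|: B) B S set0 set0.
Proof.
move=> SB; apply: (@solvable_of I).
- by split; rewrite ?sub0set //; split; rewrite ?cards0 //; clear; disj.
- exact: subxx.
- have [I0|I0] := eqVneq I set0.
    rewrite I0; have [->|/set0Pn[s sS]] := eqVneq S set0; first by rewrite setU0; exact: conn0.
    by have [y yI _] := hB (subsetP SB s sS); rewrite I0 inE in yI.
  apply: (conn_cover local_conn) => //; first exact: subsetUl.
  move=> b; rewrite inE => /orP[-> //|bS] _; have [y yI by'] := hB (subsetP SB b bS).
  exists [set b; y]; split; [exact: conn2 | | by rewrite !inE eqxx | by exists y; rewrite ?inE ?eqxx ?orbT].
  by rewrite subUset !sub1set !inE bS yI orbT.
- by exists (fun=> set0); split=> [a|a|a a' x]; rewrite inE.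
Qed.

Hypothesis I3 : 2 < #|I|.

(** A Menger obstruction is a cut [C] of at most one vertex. On either side of it, the part of [I]
    without [n] has a boundary of at most |B| vertices and must be empty; so [I] has at most the two
    vertices [n] and that of [C]. *)
Lemma local_linkable n U1 U2 : U1 \subset B -> U2 \subset B -> [disjoint U1 & U2] ->
  #|U1| = #|U2| -> #|U1| <= 2 -> n \in I -> linkable e ((I :|: (U1 :|: U2)) :\ n) U1 U2.
Proof.
move=> U1B U2B d12 cU c2 nI; set W := _ :\ n.
have nB : n \notin B by clear -nI dIB; setat n.
have nU1 : n \notin U1 by clear -nB U1B; setat n.
have nU2 : n \notin U2 by clear -nB U2B; setat n.
have U1W : U1 \subset W by rewrite subsetD1 nU1 andbT; clear; subs.
have U2W : U2 \subset W by rewrite subsetD1 nU2 andbT; clear; subs.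
have WE x : x \in W = (x != n) && ((x \in I) || (x \in U1 :|: U2)) by rewrite !inE.
apply: menger => // C Z CW [ZW UZ clZ ZU]; rewrite leqNgt; apply/negP=> Clt.
(* Compared with [B], the boundary of [L] misses U :\: C and gains at most [n] and C :\: B. As |C| <
   |U|, it is not larger than [B]. *)
have bound (L U : {set T}) : L \subset I -> n \notin L -> U \subset B -> #|U| = #|U1| ->
   (forall y, y \in nb e (I :|: B) L -> y \in n |: (C :|: (B :\: (U :\: C)))) -> L = set0.
  move=> LI nL UB UU nbL; apply/eqP; apply: contraT => L0.
  have LneI : L != I by apply: contraNneq nL => ->.
  have := big L0 LI LneI; rewrite ltnNge => /negP[].
  apply: leq_trans (subset_leq_card (_ : _ \subset n |: ((C :\: B) :|: (B :\: (U :\: C))))) _.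
    apply/subsetP=> y /nbL; clear; rewrite !in_setU !in_set1 !in_setD; case: (y == n) => //=; bcase.
  rewrite cardsU1; apply: leq_trans (leq_add (leq_b1 _) (leq_card_setU _ _)) _.
  have h1 : #|B :\: (U :\: C)| = #|B| - #|U :\: C|.
    by rewrite cardsD (setIidPr _) //; clear -UB; subs.
  have h2 : #|U :\: C| <= #|B| by apply: subset_leq_card; clear -UB; subs.
  have h3 := cardsID C U; have h4 := cardsID B C.
  have h5 : #|U :&: C| <= #|C :&: B| by apply: subset_leq_card; clear -UB; subs.
  move: Clt h1 h2 h3 h4 h5; rewrite UU; clear; lia.
have L0 : Z :&: I = set0.
  apply: (bound _ U2) => //; [exact: subsetIr | | ].
    by apply/negP; rewrite inE => /andP[/(subsetP ZW)]; rewrite !inE eqxx andbF.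
  move=> y yN; have /nbP[yV [yZI [z zL zy]]] := yN.
  rewrite in_setU1; case: (eqVneq y n) => //= yn.
  rewrite in_setU; case: (boolP (y \in C)) => //= yC.
  have zZ : z \in Z by clear -zL; setat z.
  have yZ : y \in W -> y \in Z by move=> yW; apply: (clZ z) => //; rewrite inE yC.
  rewrite !in_setD yC /=; have [yI|yI] := boolP (y \in I).
    have : y \in Z by apply: yZ; rewrite WE yn yI.
    by clear -yI yZI; setat y.
  have yB : y \in B by clear -yV yI; setat y.
  rewrite yB andbT; apply/negP=> yU2.
  have : y \in Z by apply: yZ; rewrite WE yn inE yU2 !orbT.
  by clear -yU2 ZU; setat y.
have R0 : I :\ n :\: C :\: Z = set0.
  apply: (bound _ U1) => //; [by clear; subs | by rewrite !inE eqxx !andbF | ].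
  move=> y yN; have /nbP[yV [yR [z zR zy]]] := yN.
  rewrite in_setU1; case: (eqVneq y n) => //= yn.
  rewrite in_setU; case: (boolP (y \in C)) => //= yC.
  have [zI zn zC zZ] : [/\ z \in I, z != n, z \notin C & z \notin Z].
    by move: zR; rewrite !inE => /and4P[-> -> -> ->].
  have zW : z \in W :\: C by rewrite inE zC WE zn zI.
  have yZ : y \notin Z by apply: contra zZ => yZ; apply: (clZ y) => //; rewrite es.
  rewrite !in_setD yC /=; have [yI|yI] := boolP (y \in I).
    by move: yR; rewrite !inE yI yn yC yZ.
  have yB : y \in B by clear -yV yI; setat y.
  rewrite yB andbT; apply/negP=> yU1.
  by case/negP: yZ; clear -yU1 yC UZ; setat y.
have IC : I \subset n |: C.
  apply/subsetP=> y yI; rewrite in_setU1; case: (eqVneq y n) => //= yn.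
  by have := eqset_at y L0; have := eqset_at y R0; rewrite !inE yI yn; clear; bcase.
have := subset_leq_card IC; rewrite cardsU1; move: I3 Clt c2; case: (_ \notin _) => /=; clear; lia.
Qed.

Hypotheses (Bc : #|B| <= c) (tt : twin e tw) (hf : rich c e tw I B).

Lemma twin_edge x y : x \in tw -> y \in tw -> x != y -> e x y.
Proof.
case: tt => [->|[x0 [y0 [-> _ exy]]]]; first by rewrite inE.
by rewrite !inE => /orP[]/eqP-> /orP[]/eqP->; rewrite ?eqxx // es.
Qed.

(* Richness at the edge [x n] makes [n] adjacent to all of [S], which is then attached to [n] alone. *)
Lemma stuck_solvable S U1 U2 x n : pattern B S U1 U2 ->
  (tw \subset B -> [disjoint tw & U2]) -> x \in S -> x \notin tw -> n \in I -> e x n ->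
  #|Nb e n :&: (Nb e x :&: I)| <= #|U2 :\: Nb e n|.+1 -> solvable e (I :|: B) B S U1 U2.
Proof.
move=> pat; have [SB U1B U2B [d1 d2 d12 cU c2]] := pat.
move=> twU xS xt nI xn few; have xB := subsetP SB x xS.
have := hf xB xt nI xn.
have -> : Nb e x :&: Nb e n :&: I = Nb e n :&: (Nb e x :&: I) by clear; seteq.
move=> h.
pose F := (B :\ x) :\: tw :\: Nb e n.
have xU2 : x \notin U2 by clear -xS d2; setat x.
have cB : #|B| = 1 + #|tw :&: B| + #|(Nb e n :&: B) :\ x :\: tw| + #|F|.
  have e1 := cardsD1 x B; have e2 := cardsID tw (B :\ x); have e3 := cardsID (Nb e n) (B :\ x :\: tw).
  have s1 : (B :\ x) :&: tw = tw :&: B.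
    by apply/setP=> z; rewrite !inE; case: eqVneq => [->|_] /=; [rewrite (negPf xt) | rewrite andbC].
  have s2 : (B :\ x :\: tw) :&: Nb e n = (Nb e n :&: B) :\ x :\: tw by clear; seteq.
  by move: e1 e2 e3; rewrite xB s1 s2 -/F; clear; lia.
(* Combining richness, [few] and |B| <= c cancels the neighbours of [n] in [B] outside the twin.
   What remains bounds |tw :&: B| + |F| by |U2 :\: Nb e n|, plus one if [n] sees a twin vertex in
   [B]. *)
have key : (tw != set0) && (tw \subset B) = false -> #|B :\ x :\: Nb e n| <= #|U2 :\: Nb e n|.
  move=> nt.
  have t1 : #|tw :&: B| <= 1.
    move: nt; case: tt => [->|[x0 [y0 [-> xy _]]]]; first by rewrite set0I cards0.
    have -> : [set x0; y0] != set0 by apply/set0Pn; exists x0; rewrite !inE eqxx.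
    move=> /= /negbT nB; rewrite leqNgt; apply: contra nB => gt.
    apply/setIidPl/eqP; rewrite eqEcard subsetIl cards2 xy; exact: gt.
  have sub : B :\ x :\: Nb e n \subset F :|: (tw :&: B :\: Nb e n).
    by apply/subsetP=> z; rewrite !in_setU !in_setD !in_setI; clear; bcase.
  have := leq_trans (subset_leq_card sub) (leq_card_setU _ _).
  have [nt0|nt0] := eqVneq (Nb e n :&: B :&: tw) set0.
    have t2 : #|tw :&: B :\: Nb e n| <= #|tw :&: B| by apply: subset_leq_card; exact: subsetDl.
    by move: h; rewrite nt0 eqxx /=; move: t1 t2 few cB Bc; clear; lia.
  have -> : #|tw :&: B :\: Nb e n| = 0.
    have /set0Pn[z] := nt0; rewrite !in_setI => /andP[/andP[zn zB] zt].
    apply/eqP; rewrite cards_eq0 -subset0; apply/subsetP=> z'; rewrite in_setD in_setI in_set0 => /andP[z'n /andP[z't z'B]].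
    have zz : z != z' by apply: contraNneq z'n => <-.
    have zi : z \in tw :&: B by rewrite inE zt zB.
    have zi' : z' \in tw :&: B by rewrite inE z't z'B.
    by have := card1_neq zi zi' zz; move: t1; clear; lia.
  have t2 : 0 < #|tw :&: B|.
    have /set0Pn[z] := nt0; rewrite !in_setI => /andP[/andP[zn zB] zt].
    by apply/card_gt0P; exists z; rewrite inE zt zB.
  by move: h; rewrite nt0 /=; move: t1 t2 few cB Bc; clear; lia.
(* With both twin vertices in [B] the same inequality gives |F| < |U2 :\: Nb e n|. But U2 avoids the
   twin and [x], so its non-neighbours of [n] all lie in [F]. *)
have U2F : tw != set0 -> tw \subset B -> False.
  move=> t0 tB; have tU := twU tB.
  have : #|U2 :\: Nb e n| <= #|F|.
    apply: subset_leq_card; apply/subsetP=> z; rewrite !in_setD in_set1 => /andP[zn zU].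
    by have zx : z != x; [apply: contraNneq xU2 => <- | rewrite zn zx; clear -tU zU U2B; setat z].
  have : 1 < #|tw :&: B|.
    rewrite (setIidPl tB); case: tt => [t0'|[x0 [y0 [-> xy _]]]]; first by rewrite t0' eqxx in t0.
    by rewrite cards2 xy.
  move: h; case: (_ != _) => /=; move: few cB Bc; clear; lia.
have {key} key : #|B :\ x :\: Nb e n| <= #|U2 :\: Nb e n|.
  by apply: key; apply/negP=> /andP[t0 tB]; apply: U2F.
have E : U2 :\: Nb e n = B :\ x :\: Nb e n.
  apply/eqP; rewrite eqEcard key andbT; apply/subsetP=> z; rewrite !in_setD in_set1 => /andP[zn zU].
  by have zx : z != x; [apply: contraNneq xU2 => <- | rewrite zn zx; clear -zU U2B; setat z].
have nS s : s \in S -> e n s.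
  move=> sS; apply: contraT => ns.
  have sx : s != x by apply: contraNneq ns => ->; rewrite es.
  have : s \in B :\ x :\: Nb e n by rewrite !inE ns sx (subsetP SB).
  by rewrite -E inE; clear -sS d2; setat s.
apply: (@solvable_of [set n]) => //; first by rewrite sub1set.
  apply: (conn_cover (conn1 e n)); [exact: subsetUl | by apply/set0Pn; exists n; rewrite inE |].
  move=> s; rewrite in_setU => /orP[sn|sS] sn'; first by rewrite sn in sn'.
  exists [set n; s]; split.
  - by apply: conn2 => //; exact: nS.
  - by rewrite setUS // sub1set.
  - by rewrite !inE eqxx orbT.
  - by exists n; rewrite !inE eqxx.
exact: local_linkable.
Qed.

Lemma local_solvable S U1 U2 : pattern B S U1 U2 -> 0 < #|U1| ->
  (tw \subset B -> [disjoint tw & U2]) -> solvable e (I :|: B) B S U1 U2.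
Proof.
move=> pat U10 twU; have [SB U1B U2B [d1 d2 d12 cU c2]] := pat.
(* Richness says nothing at twin vertices, so they are attached by hand: [K] will always contain a
   neighbour [t0] of one of those in [S], and the other follows along the edge of the twin. *)
have [t0 [t0I anch]] : exists t0, t0 \in I /\ (S :&: tw != set0 -> exists2 s0, s0 \in S :&: tw & e s0 t0).
  have [->|/set0Pn[s0 s0S]] := eqVneq (S :&: tw) set0.
    have /card_gt0P[t0 t0I] : 0 < #|I| by apply: leq_trans I3.
    by exists t0; rewrite t0I.
  have [|y yI sy] := hB (b := s0); first by clear -s0S SB; setat s0.
  by exists y; split=> // _; exists s0.
set U := U1 :|: U2; pose M0 := I :|: U.
have UB : U \subset B by rewrite subUset U1B.
have MU : M0 :\: U = I by rewrite /M0; clear -UB dIB; seteq.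
pose P K := [/\ t0 \in K, K \subset I, conn e K & linkable e (M0 :\: K) U1 U2].
have [K [[t0K KI cK lK] maxK]] : exists K, P K /\ forall K', P K' -> #|K'| <= #|K|.
  apply: (@ex_max_card _ P [set t0]); split; [by rewrite inE | by rewrite sub1set | exact: conn1 |].
  exact: local_linkable.
have crit : forall n, n \in M0 :\: K :\: U -> ~ linkable e (M0 :\: K :\ n) U1 U2.
  apply: rest_critical => //.
  - exact: subsetUr.
  - by rewrite MU.
  - move=> n t nM tK tn lk; have nI : n \in I by rewrite -MU; clear -nM; setat n.
    have nK : n \notin K by clear -nM; setat n.
    have : #|n |: K| <= #|K|; last by rewrite cardsU1 nK /= ltnn.
    apply: maxK; split; [by rewrite inE t0K orbT | by rewrite subUset sub1set nI | exact: (conn_add1 es cK tK tn) |].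
    by apply: linkable_mono lk; apply/subsetP=> z; rewrite !inE negb_or; bcase.
  move=> R R0 RM nbK.
  have RI : R \subset I by rewrite -MU; clear -RM; subs.
  have RneI : R != I.
    by apply/negP=> /eqP E; move: t0I; rewrite -E => /(subsetP RM); rewrite !inE t0K /= andbF.
  have lt := big R0 RI RneI.
  have sub : nb e (I :|: B) R \subset nb e M0 R :|: (B :\: U).
    apply/subsetP=> y /nbP[yV [yR [z zR zy]]]; rewrite inE.
    have [yM|yM] := boolP (y \in M0); first by rewrite (nb_in zR zy).
    by rewrite /M0 in yM; clear -yM yV; setat y.
  have := leq_trans (subset_leq_card sub) (leq_card_setU _ _).
  have : #|B| = #|U| + #|B :\: U| by rewrite -(cardsID U B) (setIidPr UB).
  have : #|U| = #|U1| + #|U2| by rewrite /U cardsU (disjoint_setI0 d12) cards0 subn0.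
  by move: lt cU; clear; lia.
(* Either every vertex of [S] outside the twin has a neighbour in [K] and K :|: S is connected, or
   some [x] is stuck and all its neighbours in [I] lie on the two paths. *)
case: (classic (exists x, [/\ x \in S, x \notin tw & forall t, t \in K -> ~ e x t])) => [[x [xS xt xK]]|free]; last first.
  apply: (@solvable_of K) => //.
  apply: (conn_cover cK); [exact: subsetUl | by apply/set0Pn; exists t0 |].
  move=> s; rewrite inE => /orP[->//|sS] _.
  case: (classic (exists2 t, t \in K & e s t)) => [[t tK st]|nt].
    exists [set s; t]; split; [exact: conn2 | | by rewrite !inE eqxx | by exists t; rewrite ?inE ?eqxx ?orbT].
    by rewrite subUset !sub1set !inE sS tK orbT.
  have st : s \in tw.
    by apply: contraT => sn; case: free; exists s; split=> // t tK stt; apply: nt; exists t.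
  have [|s0 s0S s0t] := anch; first by apply/set0Pn; exists s; rewrite inE sS.
  have ss0 : s != s0 by apply/eqP=> E; apply: nt; exists t0; rewrite // E.
  move: s0S; rewrite inE => /andP[s0S s0tw].
  exists ([set s; s0] :|: [set s0; t0]); split.
  - apply: connU_meet; [by apply: conn2 => //; exact: twin_edge | exact: conn2 |].
    by exists s0; rewrite !inE eqxx ?orbT.
  - by rewrite !subUset !sub1set !inE sS s0S t0K !orbT.
  - by rewrite !inE eqxx.
  - by exists t0; rewrite // !inE eqxx !orbT.
pose J := Nb e x :&: I.
have [|y yI xy] := hB (b := x); first exact: (subsetP SB).
have J0 : J != set0 by apply/set0Pn; exists y; rewrite !inE xy.
have [P1 [P2 PP]] := linkable_path_pair cU c2 lK; have [[_ _] u sM h1 h2] := PP.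
have JM z : z \in J -> z \in M0 :\: K :\: U.
  rewrite !inE => /andP[xz zI]; have zK : z \notin K by apply/negP=> /xK.
  by rewrite /M0 zK; clear -zI dIB UB; setat z.
have JP : J \subset [set z in P1 ++ P2].
  apply/subsetP=> z /JM zM; rewrite in_set; apply: contraT => zP; exfalso.
  by apply: (crit z zM); apply: (path_pair_avoid es PP).
have lU : lasts P1 :|: lasts P2 \subset U2 by rewrite -h2.
have inn P' : lasts P' \subset U2 -> inner x J P'.
  move=> lP' k kP kJ; rewrite ltn_neqAle kP andbT; apply/eqP=> E.
  have : nth x P' k \in U2.
    apply: (subsetP lP'); rewrite (nth_lasts x); last by move: kP; case: (P').
    by rewrite -E /= inE.
  by have := JM _ kJ; rewrite /U; clear; rewrite !in_setD !in_setU; bcase.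
have [lU1 lU2] : lasts P1 \subset U2 /\ lasts P2 \subset U2 by move: lU; rewrite subUset => /andP[].
have [n nJ few] := few_common_neighbours ei u (critical_chordless (x0 := x) es crit PP)
  (critical_chordless (x0 := x) es crit (path_pair_sym PP)) (critical_crossless (x0 := x) es crit PP)
  (inn _ lU1) (inn _ lU2) lU JP J0.
have [nI xn] : n \in I /\ e x n by move: nJ; rewrite !inE => /andP[].
exact: (stuck_solvable pat twU xS xt nI xn few).
Qed.

Lemma pattern_del X S U1 U2 x y : pattern X S U1 U2 -> x \in U1 -> y \in U2 ->
  pattern X S (U1 :\ x) (U2 :\ y).
Proof.
move=> [SX U1X U2X [d1 d2 d12 cU c2]] xU yU; split=> //.
- by clear -U1X; subs.
- by clear -U2X; subs.
split; [by clear -d1; disj | by clear -d2; disj | by clear -d12; disj | |].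
  by move: cU; rewrite (cardsD1 x) (cardsD1 y U2) xU yU; clear; lia.
by move: c2; rewrite (cardsD1 x) xU; clear; lia.
Qed.

Lemma pattern_swap X S U1 U2 : pattern X S U1 U2 -> pattern X S U2 U1.
Proof.
by move=> [? ? ? [? ? d cU c2]]; split=> //; split; rewrite // 1?disjoint_sym -?cU.
Qed.

(** The lemma [local_solvable] needs a twin inside [B] to avoid U2. Exchanging U1 and U2 settles the
    case where it avoids U1. If it meets both, its edge is a link, and after removing that pair U2
    avoids the twin. *)
Lemma local_linked : linked e (I :|: B) B.
Proof.
have base S U1 U2 : pattern B S U1 U2 -> (tw \subset B -> [disjoint tw & U2]) ->
    solvable e (I :|: B) B S U1 U2.
  move=> pat tU; have [U10|] := posnP #|U1|; last by move=> h; apply: local_solvable.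
  have [SB _ _ [_ _ _ cU _]] := pat; move: (cU); rewrite U10 => /esym/eqP; rewrite cards_eq0 => /eqP->.
  by move/eqP: U10; rewrite cards_eq0 => /eqP->; apply: local_solvable0.
move=> S U1 U2 pat; have [SB U1B U2B [d1 d2 d12 cU c2]] := pat.
have [h2|h2] := boolP [disjoint tw & U2]; first by apply: base.
have [h1|h1] := boolP [disjoint tw & U1].
  by apply: solvable_swap => //; apply: base; [exact: pattern_swap | ].
have tB : (tw \subset B) || ~~ (tw \subset B) by case: (tw \subset B).
have [{}tB|tB'] := orP tB; last by apply: base => //; rewrite (negPf tB').
have [x /andP[xt xU]] := pred0Pn h1; have [y /andP[yt yU]] := pred0Pn h2.
rewrite /= in xt xU yt yU.
have xy : x != y by apply: contraTneq xU => ->; clear -yU d12; setat y.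
apply: (solvable_add_edge es pat _ xU yU (twin_edge xt yt xy)); first exact: subsetUr.
apply: base; first exact: pattern_del.
move=> _; apply: disjointI => z zt; rewrite in_setD1 => /andP[zy zU].
have zx : z != x by apply: contraTneq zU => ->; clear -xU d12; setat x.
have : 2 < #|tw|.
  rewrite (cardsD1 x) xt (cardsD1 y) (cardsD1 z) !inE zt yt zx zy eq_sym xy; clear; lia.
by case: tt => [->|[x0 [y0 [-> xy0 _]]]]; rewrite ?cards0 // cards2 xy0.
Qed.
End Local.

(** * Regions of two vertices *)

Section Exc.
Variable T : finType.
Implicit Types (e : rel T) (A B C V R S U X I K tw : {set T}) (x y : T) (P D : T -> {set T}).

Lemma linkable_conn e C u v : conn e C -> u \in C -> v \in C -> linkable e C [set u] [set v].
Proof.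
move=> cC uC vC; exists (fun=> C); split.
- by move=> a; rewrite inE => /eqP->.
- by move=> a _; exists v; rewrite ?inE.
- by move=> a a' z; rewrite !inE => /eqP-> /eqP->.
Qed.

Lemma solvable1 e V X S u v T0 C : conn e T0 -> S \subset T0 -> T0 \subset V :\: (X :\: S) ->
  conn e C -> u \in C -> v \in C -> C \subset V :\: (X :\: [set u; v]) -> [disjoint T0 & C] ->
  solvable e V X S [set u] [set v].
Proof.
move=> cT ST TV cC uC vC CV dTC.
have [D LD] : linkable e (V :\: T0 :\: (X :\: ([set u] :|: [set v]))) [set u] [set v].
  by apply: linkable_mono (linkable_conn cC uC vC); clear -CV dTC; subs.
by exists T0, D.
Qed.

Lemma solvable2 e V X S u1 u2 v1 v2 T0 C1 C2 : conn e T0 -> S \subset T0 -> T0 \subset V :\: (X :\: S) ->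
  conn e C1 -> u1 \in C1 -> v1 \in C1 -> C1 \subset V :\: (X :\: [set u1; v1]) ->
  conn e C2 -> u2 \in C2 -> v2 \in C2 -> C2 \subset V :\: (X :\: [set u2; v2]) ->
  [disjoint T0 & C1] -> [disjoint T0 & C2] -> [disjoint C1 & C2] ->
  solvable e V X S [set u1; u2] [set v1; v2].
Proof.
move=> cT ST TV cC1 u1C v1C C1V cC2 u2C v2C C2V d1 d2 d12.
have [D LD] : linkable e (V :\: T0 :\: (X :\: ([set u1; u2] :|: [set v1; v2]))) [set u1; u2] [set v1; v2].
  apply: linkable_mono (linkageU d12 (linkable_conn cC1 u1C v1C) (linkable_conn cC2 u2C v2C)).
  by clear -C1V C2V d1 d2; subs.
by exists T0, D.
Qed.

Section Family.
Variables (e : rel T) (V X I B : {set T}) (P : T -> {set T}).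
Hypotheses (es : symmetric e) (LP : linkage e (V :\: I) X B P).

Definition fam (A : {set T}) : {set T} := \bigcup_(a in A) P a.

Lemma famP A x : reflect (exists2 a, a \in A & x \in P a) (x \in fam A).
Proof. exact: bigcupP. Qed.

Lemma fam_sub A : A \subset X -> fam A \subset V :\: I.
Proof.
by case: LP => p1 _ _ AX; apply/bigcupsP=> a aA; have [] := p1 a (subsetP AX a aA).
Qed.

Lemma fam_self A : A \subset X -> A \subset fam A.
Proof.
case: LP => p1 _ _ AX; apply/subsetP=> a aA; apply/famP; exists a => //.
by have [] := p1 a (subsetP AX a aA).
Qed.

Lemma fam_X A : A \subset X -> fam A :&: X \subset A.
Proof.
case: LP => p1 _ p3 AX; apply/subsetP=> x; rewrite inE => /andP[/famP[a aA xa] xX].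
have [xx _ _] := p1 x xX; by rewrite (p3 x a x xX (subsetP AX a aA) xx xa).
Qed.

Lemma fam_disj A A' : A \subset X -> A' \subset X -> [disjoint A & A'] -> [disjoint fam A & fam A'].
Proof.
case: LP => _ _ p3 AX AX' d; apply: disjointI => x /famP[a aA xa] /famP[a' aA' xa'].
have E := p3 a a' x (subsetP AX a aA) (subsetP AX' a' aA') xa xa'.
by rewrite E (disjointFl d aA') in aA.
Qed.

Lemma conn_spokes A (H : {set T}) : A \subset X -> conn e H -> H != set0 ->
  (forall a, a \in A -> exists p h, [/\ p \in P a, h \in H & e p h]) -> conn e (fam A :|: H).
Proof.
case: LP => p1 _ _ AX cH H0 adj; apply: (conn_cover cH) => //; first exact: subsetUr.
move=> b; rewrite in_setU => bAH bH; have /famP[a aA ba] : b \in fam A by rewrite (negPf bH) orbF in bAH.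
have [p [h [pP hH ph]]] := adj a aA; have [_ _ cP] := p1 a (subsetP AX a aA).
exists (P a :|: [set h]); split.
- by apply: (connU_edge es cP (conn1 e h) pP (set11 h) ph).
- rewrite subUset sub1set in_setU hH orbT andbT; apply/subsetP=> z za; rewrite in_setU.
  by apply/orP; left; apply/famP; exists a.
- by rewrite in_setU ba.
- by exists h; rewrite // !inE eqxx orbT.
Qed.

Lemma famU A A' : fam (A :|: A') = fam A :|: fam A'. Proof. exact: bigcup_setU. Qed.

(** Connectedness is required of a family together with its hub, so a hub may be empty when its
    family is already connected by direct edges between links. *)
Lemma fam_solvable2 S U1 U2 u1 v1 (H0 H1 H2 : {set T}) : X \subset V -> pattern X S U1 U2 ->
  1 < #|U1| -> u1 \in U1 -> v1 \in U2 ->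
  H0 \subset V :\: X -> H1 \subset V :\: X -> H2 \subset V :\: X ->
  [disjoint H0 & H1] -> [disjoint H0 & H2] -> [disjoint H1 & H2] ->
  [disjoint H0 :|: (H1 :|: H2) & fam (S :|: (U1 :|: U2))] ->
  conn e (fam S :|: H0) -> conn e (fam [set u1; v1] :|: H1) ->
  (forall u2 v2, u2 \in U1 -> v2 \in U2 -> conn e (fam [set u2; v2] :|: H2)) ->
  solvable e V X S U1 U2.
Proof.
move=> XV [SX U1X U2X [d1 d2 d12 cU c2]] k1 u1U v1U H0V H1V H2V d01 d02 dH dF cT cC1 cC2.
have /eqP/cards1P[u2 u2E] : #|U1 :\ u1| = 1 by move: k1 c2; rewrite (cardsD1 u1) u1U; clear; lia.
have /eqP/cards1P[v2 v2E] : #|U2 :\ v1| = 1 by move: k1 c2; rewrite cU (cardsD1 v1) v1U; clear; lia.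
have UE : U1 = [set u1; u2] by rewrite -(setD1K u1U) u2E.
have VE : U2 = [set v1; v2] by rewrite -(setD1K v1U) v2E.
have : u2 \in U1 :\ u1 by rewrite u2E inE.
have : v2 \in U2 :\ v1 by rewrite v2E inE.
rewrite !in_setD1 => /andP[v21 v2U] /andP[u21 u2U].
have sub u v : u \in U1 -> v \in U2 -> [set u; v] \subset U1 :|: U2.
  by move=> uU vU; rewrite subUset !sub1set !inE uU vU orbT.
have [Y1 Y2] := (sub u1 v1 u1U v1U, sub u2 v2 u2U v2U).
have UX : U1 :|: U2 \subset X by rewrite subUset U1X.
have [X1 X2] := (subset_trans Y1 UX, subset_trans Y2 UX).
have dS1 : [disjoint S & [set u1; v1]] by clear -d1 d2 Y1; disj.
have dS2 : [disjoint S & [set u2; v2]] by clear -d1 d2 Y2; disj.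
have duv : [disjoint [set u1; v1] & [set u2; v2]].
  have ne a b : a \in U1 -> b \in U2 -> a != b.
    by move=> aU bU; apply: contraTneq aU => ->; clear -bU d12; setat b.
  apply: disjointI => t; rewrite !inE => /orP[]/eqP-> /orP[]; apply/negP.
  - by rewrite eq_sym.
  - exact: ne.
  - by rewrite eq_sym; apply: ne.
  - by rewrite eq_sym.
have sS := fam_self SX; have fS := fam_sub SX; have xS := fam_X SX.
have F1 := fam_sub X1; have F2 := fam_self X1; have F3 := fam_X X1; have F4 := fam_disj SX X1 dS1.
have G1 := fam_sub X2; have G2 := fam_self X2; have G3 := fam_X X2; have G4 := fam_disj SX X2 dS2.
have FG := fam_disj X1 X2 duv.
have famS A A' : A \subset A' -> fam A \subset fam A'.
  by move=> AA; apply/subsetP=> x /famP[a aA xa]; apply/famP; exists a; rewrite // (subsetP AA).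
have K1 := famS _ _ Y1; have K2 := famS _ _ Y2; rewrite famU in dF; rewrite UE VE in K1 K2 dF *.
apply: (@solvable2 _ _ _ _ _ _ _ _ (fam S :|: H0) (fam [set u1; v1] :|: H1) (fam [set u2; v2] :|: H2)) => //.
- by clear -sS; subs.
- by clear -fS xS H0V; subs.
- by rewrite inE (subsetP F2) // !inE eqxx.
- by rewrite inE (subsetP F2) // !inE eqxx orbT.
- by clear -F1 F3 H1V; subs.
- exact: cC2.
- by rewrite inE (subsetP G2) // !inE eqxx.
- by rewrite inE (subsetP G2) // !inE eqxx orbT.
- by clear -G1 G3 H2V; subs.
- by clear -F4 d01 dF K1; disj.
- by clear -G4 d02 dF K2; disj.
- by clear -FG dH dF K1 K2; disj.
Qed.

(** A hub with an edge to each link of a set merges these links into one connected set: [H0] does so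
    for [S], [H1] and [H2] for one pair each. The third hub is requested only when there are two
    pairs. *)
Lemma hubs_solvable S U1 U2 (H0 H1 H2 : {set T}) : X \subset V -> pattern X S U1 U2 ->
  conn e H0 -> conn e H1 -> H0 != set0 -> H1 != set0 ->
  H0 \subset V :\: X -> H1 \subset V :\: X -> [disjoint H0 & H1] ->
  [disjoint H0 & fam (S :|: (U1 :|: U2))] -> [disjoint H1 & fam (S :|: (U1 :|: U2))] ->
  (forall a, a \in S -> exists p h, [/\ p \in P a, h \in H0 & e p h]) ->
  (forall a, a \in U1 :|: U2 -> exists p h, [/\ p \in P a, h \in H1 & e p h]) ->
  (1 < #|U1| -> [/\ conn e H2, H2 != set0, H2 \subset V :\: X,
     [/\ [disjoint H0 & H2], [disjoint H1 & H2] & [disjoint H2 & fam (S :|: (U1 :|: U2))]] &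
     forall a, a \in U1 :|: U2 -> exists p h, [/\ p \in P a, h \in H2 & e p h]]) ->
  solvable e V X S U1 U2.
Proof.
move=> XV [SX U1X U2X [d1 d2 d12 cU c2]] cH0 cH1 n0 n1 H0V H1V d01 dF0 dF1 a0 a1 two.
have sS := fam_self SX; have fS := fam_sub SX; have xS := fam_X SX.
have cT : conn e (fam S :|: H0) by apply: conn_spokes.
have ST : S \subset fam S :|: H0 by clear -sS; subs.
have TV : fam S :|: H0 \subset V :\: (X :\: S) by clear -fS xS H0V; subs.
have [U10|U1n] := posnP #|U1|.
  have [E1 E2] : U1 = set0 /\ U2 = set0.
    by split; apply/eqP; rewrite -cards_eq0 -?cU U10.
  rewrite E1 E2; exists (fam S :|: H0), (fun=> set0); split=> //.
  by split=> [a|a|a a' x]; rewrite inE.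
have [U11|U12] := eqVneq #|U1| 1.
  have /eqP/cards1P[u uE] := U11; have /eqP/cards1P[v vE] : #|U2| = 1 by rewrite -cU.
  have uvX : [set u; v] \subset X by rewrite subUset -uE -vE U1X.
  have dSuv : [disjoint S & [set u; v]] by clear -d1 d2 uE vE; disj.
  have F1 := fam_sub uvX; have F2 := fam_self uvX; have F3 := fam_X uvX; have F4 := fam_disj SX uvX dSuv.
  rewrite famU in dF0 dF1; rewrite uE vE in dF0 dF1 *; apply: (@solvable1 _ _ _ _ _ _ (fam S :|: H0) (fam [set u; v] :|: H1)) => //.
  - by apply: conn_spokes => // a aA; apply: a1; rewrite uE vE.
  - by rewrite inE (subsetP F2) // !inE eqxx.
  - by rewrite inE (subsetP F2) // !inE eqxx orbT.
  - by clear -F1 F3 H1V; subs.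
  - by clear -F4 d01 dF0 dF1; disj.
have U1gt : 1 < #|U1| by move: U1n U12; clear; lia.
have [|cH2 n2 H2V [d02 dH12 dF2] a2] := two; first exact: U1gt.
have /card_gt0P[u1 u1U] := U1n; have /card_gt0P[v1 v1U] : 0 < #|U2| by rewrite -cU.
have UX : U1 :|: U2 \subset X by rewrite subUset U1X.
have sub u v : u \in U1 -> v \in U2 -> [set u; v] \subset U1 :|: U2.
  by move=> uU vU; rewrite subUset !sub1set !inE uU vU orbT.
apply: (fam_solvable2 (u1 := u1) (v1 := v1) (H0 := H0) (H1 := H1) (H2 := H2)) => //.
- by clear -dF0 dF1 dF2; disj.
- apply: conn_spokes => //; first exact: subset_trans (sub _ _ u1U v1U) UX.
  by move=> a aA; apply: a1; apply: (subsetP (sub _ _ u1U v1U)).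
move=> u2 v2 u2U v2U; apply: conn_spokes => //; first exact: subset_trans (sub _ _ u2U v2U) UX.
by move=> a aA; apply: a2; apply: (subsetP (sub _ _ u2U v2U)).
Qed.
End Family.

Section Exceptional.
Variables (e : rel T) (V X tw : {set T}) (c : nat) (y z : T).
Hypotheses (es : symmetric e) (ei : irreflexive e) (XV : X \subset V) (tt : twin e tw) (tX : tw \subset X).
Local Notation I := [set y; z].
Local Notation B := (nb e V I).
Hypotheses (yz : y != z) (IV : I \subset V :\: X)
  (yB : forall b, b \in B -> e y b) (zB : forall b, b \in B -> e z b)
  (cB : #|B| = c) (cX : #|X| = c) (tB : tw != set0 -> ~~ (tw \subset B))
  (minc : forall R, R != set0 -> R \subset V :\: X -> c <= #|nb e V R|).

Let Iy : y \in V :\: X. Proof. by apply: (subsetP IV); rewrite !inE eqxx. Qed.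
Let Iz : z \in V :\: X. Proof. by apply: (subsetP IV); rewrite !inE eqxx orbT. Qed.

(** There are [c] edges from each of [y] and [z] to the boundary and at most one between them,
    counted in both directions. The last summand of [dense] is just large enough to exclude this
    when nothing else lies outside [X]. *)
Lemma pair_edges : E2 e V I <= 4 * c + 2.
Proof.
have yNB : y \notin B by have := nb_disj e V I => d; rewrite (disjointFl d) // !inE eqxx.
have zNB : z \notin B by have := nb_disj e V I => d; rewrite (disjointFl d) // !inE eqxx orbT.
have sub : epairs e V I \subset star y (z |: B) :|: star z B.
  have h u v : u \in I -> v \in V -> e u v -> v \in I \/ v \in B.
    move=> uI vV uv; have [vI|vI] := boolP (v \in I); [by left | right; exact: (nb_in uI)].
  apply/subsetP=> -[u v]; rewrite !inE /= => /and4P[uV vV uv].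
  have irr w : e w w = false by exact: ei.
  case/orP=> uI.
    have uI' : u \in I by rewrite !inE.
    case: (h u v uI' vV uv) => [|vB]; last by case/orP: uI => ->; rewrite vB ?orbT.
    rewrite !inE => vI; move: uI vI uv => /orP[]/eqP-> /orP[]/eqP->; rewrite ?irr ?eqxx ?orbT //.
  have vI' : v \in I by rewrite !inE.
  case: (h v u vI' uV (etrans (es v u) uv)) => [|uB]; last by case/orP: uI => ->; rewrite uB ?orbT.
  by rewrite !inE => uI'; move: uI uI' uv => /orP[]/eqP-> /orP[]/eqP->; rewrite ?irr ?eqxx ?orbT.
apply: leq_trans (leq_trans (subset_leq_card sub) (leq_card_setU _ _)) _.
rewrite !card_star //; last by rewrite !inE (negPf yz).
by rewrite cardsU1 zNB cB; clear; lia.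
Qed.

Lemma famI_cut P S : linkage e (V :\: I) X B P -> S \subset X -> [disjoint I & fam P S].
Proof. by move=> LP SX; have := fam_sub LP SX => h; disj. Qed.

(** The third hub is a component [K] of what remains outside [X] and [I]. Its boundary lies in [X]
    and has at least [c] vertices, so it is all of [X]. If nothing remains, [pair_edges] contradicts
    density. *)
Lemma pair_region_full : dense c e V X tw -> B = X -> linked e V X.
Proof.
move=> dens BX.
have tw0 : tw = set0 by apply/eqP; apply: contraT => /tB; rewrite BX tX.
have [E|/set0Pn[w wM]] := eqVneq (V :\: X :\: I) set0.
  have QI : V :\: X = I.
    apply/eqP; rewrite eqEsubset IV andbT; apply/subsetP=> x xQ; have := eqset_at x E.
    by rewrite in_setD xQ in_set0 andbT; case: (x \in I).
  have := pair_edges; move: dens; rewrite /dense QI tw0 twin_set0 cX !eqxx cards2 yz; clear; lia.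
pose K := reach e (V :\: X :\: I) [set w].
have KM : K \subset V :\: X :\: I by apply: reach_sub.
have K0 : K != set0 by apply/set0Pn; exists w; apply: reach_self => //; rewrite inE.
have KX : nb e V K \subset X.
  apply/subsetP=> v vN; have /nbP[vV [vK [k kK kv]]] := vN; apply: contraT => vX.
  have [vI|vI] := boolP (v \in I).
    have kB : k \in B by apply: (nb_in vI); [by rewrite es | clear -kK KM; setat k | clear -kK KM; setat k].
    by rewrite BX in kB; clear -kB KM kK; setat k.
  by case/negP: vK; apply: (reach_closed kK) => //; rewrite !in_setD vX vI vV.
have KE : nb e V K = X.
  apply/eqP; rewrite eqEcard KX cX; apply: minc => //; clear -KM; subs.
move=> S U1 U2 pat; have [SX U1X U2X _] := pat.
have SUX : S :|: (U1 :|: U2) \subset X by rewrite !subUset SX U1X.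
have UX : U1 :|: U2 \subset X by rewrite subUset U1X.
have LPid : linkage e (V :\: I) X B (fun a => [set a]).
  split; [|by move=> a aX; exists a; rewrite ?inE ?BX|by move=> a a' x _ _; rewrite !inE => /eqP-> /eqP->].
  move=> a aX; split; [by rewrite inE | | exact: conn1].
  by rewrite sub1set; clear -aX XV IV; setat a.
have famid A : fam (fun a : T => [set a]) A = A.
  by apply/setP=> x; apply/famP/idP => [[a aA]|xA]; [rewrite inE => /eqP-> | exists x; rewrite ?inE].
have adj h a : e h a -> exists p h', [/\ p \in [set a], h' \in [set h] & e p h'].
  by move=> ha; exists a, h; rewrite !inE !eqxx es.
have yX a : a \in X -> e y a by rewrite -BX; exact: yB.
have zX a : a \in X -> e z a by rewrite -BX; exact: zB.
have one h : h \in V :\: X -> [set h] \subset V :\: X by rewrite sub1set.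
have dI h : h \in V :\: X -> [disjoint [set h] & S :|: (U1 :|: U2)].
  by move=> hV; rewrite disjoints1; clear -hV SUX; setat h.
have yK : y \notin K by apply/negP=> /(subsetP KM); rewrite !inE eqxx.
have zK : z \notin K by apply/negP=> /(subsetP KM); rewrite !inE eqxx orbT.
apply: (hubs_solvable es LPid (H0 := [set y]) (H1 := [set z]) (H2 := K) XV pat).
- exact: conn1.
- exact: conn1.
- by apply/set0Pn; exists y; rewrite inE.
- by apply/set0Pn; exists z; rewrite inE.
- exact: one.
- exact: one.
- by rewrite disjoints1 inE.
- by rewrite famid; apply: dI.
- by rewrite famid; apply: dI.
- by move=> a /(subsetP SX) aX; apply: adj; exact: yX.
- by move=> a /(subsetP UX) aX; apply: adj; exact: zX.
move=> _; split; [exact: conn_reach1 | exact: K0 | by clear -KM; subs | split | ].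
- by rewrite disjoints1.
- by rewrite disjoints1.
- by rewrite famid; clear -KM SUX; disj.
move=> a /(subsetP UX); rewrite -KE => /nbP[_ [_ [k kK ka]]].
by exists a, k; rewrite inE es.
Qed.

Hypothesis ineq : forall x y, x \in V -> x \notin tw -> y \in V -> y \notin X -> e x y ->
     c + twin_count e tw (V :\: X) <= twin_count (contract e x y) tw (V :\: X :\ y) + #|loss e V X x y|.

(** Contracting [w y] can lose only edges to [z] and to the other vertices of [B], [c] in all, and
    the inequality demands all of them unless the twin count rises. It can rise by one only, at [w];
    then the exception is a twin vertex not adjacent to [w]. *)
Lemma third_hub w : w \in B -> w \notin X -> exists bad : {set T},
  [/\ forall b, b \in B -> b != w -> b \notin bad -> e w b, #|bad| <= 1 & bad \subset tw :&: B].
Proof.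
move=> wB wX; have /nbP[wV [wI [z0 z0I z0w]]] := wB.
have wt : w \notin tw by apply: contra wX; exact: (subsetP tX).
have [yV yX] : y \in V /\ y \notin X by move: Iy; rewrite inE => /andP[].
have wy : e w y by rewrite es yB.
have wney : w != y by apply: contraNneq wI => ->; rewrite !inE eqxx.
have zNB : z \notin B by have := nb_disj e V I => d; rewrite (disjointFl d) // !inE eqxx orbT.
have h := ineq wV wt yV yX wy; set e' := contract e w y in h; set L := loss e V X w y in h.
have LP b : b \in L -> [/\ b \in V, b != w, e y b & e w b].
  by rewrite inE (negPf wX) /= orbF => /and4P[].
have yN b : b \in V -> e y b -> b != z -> b \in B.
  move=> bV yb bz; apply: (nb_in _ yb) => //; first by rewrite !inE eqxx.
  by rewrite !inE negb_or bz andbT; apply: contraTneq yb => ->; rewrite ei.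
have Lsub : L \subset z |: (B :\ w).
  apply/subsetP=> b /LP[bV bw yb wb]; rewrite !inE bw.
  by have [//|bz] := eqVneq b z; apply: yN.
have cL : #|z |: (B :\ w)| = c.
  by rewrite cardsU1 inE (negPf zNB) andbF /= -cB (cardsD1 w B) wB.
have tP t : t \in tw -> [/\ t \in V, t != w, t != y, t != z & t \in X].
  move=> tt'; have tX' := subsetP tX t tt'; split=> //; first exact: (subsetP XV).
  - by apply: contraNneq wX => <-.
  - by apply: contraNneq yX => <-.
  - by move: Iz; rewrite inE => /andP[zX _]; apply: contraNneq zX => <-.
have e'E a t : t \in tw -> a != y -> e' a t = if a == w then e w t || e y t else e a t.
  by move=> /tP[_ tw' ty _ _] ay; apply: contract_to.
have sub : twin_set e' tw (V :\: X :\ y) :\ w \subset twin_set e tw (V :\: X).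
  apply/subsetP=> a; rewrite in_setD1 !inE => /andP[aw /and3P[/andP[ay aQ] t0 /subsetP at_]].
  rewrite aQ t0 /=; apply/subsetP=> t tt'; have := at_ t tt'; rewrite !inE e'E // (negPf aw).
  by [].
have [wd|wd] := boolP ((w \in twin_set e' tw (V :\: X :\ y)) && (w \notin twin_set e tw (V :\: X))); last first.
  have le : twin_count e' tw (V :\: X :\ y) <= twin_count e tw (V :\: X).
    apply: subset_leq_card; apply/subsetP=> a ad; have [aw|aw] := eqVneq a w.
      by move: wd; rewrite -aw ad /= negbK.
    by apply: (subsetP sub); rewrite in_setD1 aw.
  have LE : L = z |: (B :\ w).
    by apply/eqP; rewrite eqEcard Lsub cL; move: h le; clear; lia.
  exists set0; split; rewrite ?cards0 ?sub0set //.
  move=> b bB bw _; have : b \in L by rewrite LE !inE bw bB orbT.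
  by case/LP.
case/andP: wd => wd nwd.
have le : twin_count e' tw (V :\: X :\ y) <= (twin_count e tw (V :\: X)).+1.
  by rewrite /twin_count (cardsD1 w) wd add1n ltnS; apply: subset_leq_card.
have wQ : w \in V :\: X by rewrite inE wX wV.
move: wd nwd; rewrite [w \in twin_set e' _ _]inE [w \in twin_set e _ _]inE wQ => /and3P[_ t0 /subsetP wtw].
rewrite t0 /= => /subsetPn[x0 x0t]; rewrite inE => wx0.
have w't t : t \in tw -> e w t || e y t.
  by move=> tt'; have := wtw t tt'; rewrite inE e'E // eqxx.
have [x0V x0w x0y x0z x0X] := tP x0 x0t.
have yx0 : e y x0 by have := w't x0 x0t; rewrite (negPf wx0).
have x0B : x0 \in B by apply: yN.
have LE : L = z |: (B :\ w :\ x0).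
  apply/eqP; rewrite eqEcard; apply/andP; split.
    apply/subsetP=> b bL; have := subsetP Lsub b bL; rewrite !inE => /orP[->//|->].
    by rewrite andbT orbC; apply/orP; left; apply: contraNneq wx0 => <-; case/LP: bL.
  have : #|z |: (B :\ w :\ x0)| = c.-1.
    move: cL; rewrite !cardsU1 !inE (negPf zNB) !andbF /= (cardsD1 x0 (B :\ w)) !inE x0B x0w /=.
    by clear; lia.
  by move=> ->; move: h le; clear; lia.
exists [set x0]; split.
- move=> b bB bw; rewrite inE => bx0; have : b \in L by rewrite LE !inE bw bB bx0 orbT.
  by case/LP.
- by rewrite cards1.
- by rewrite sub1set inE x0t.
Qed.

(** Besides [y] and [z], the end [w] of the link from a vertex [xw] of [X] outside [B] is nearly a
    third hub. It lies on the link of [xw], so the role of [xw] in the pattern decides what [w] may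
    serve. *)
Lemma pair_region : dense c e V X tw -> linked e V X.
Proof.
move=> dens; have [BX|BX] := eqVneq B X; first exact: pair_region_full.
(* If the twin meets [B], [xw] is chosen as a twin vertex outside [B], so that the vertex missed by
   [w] is at least adjacent to [xw]. *)
have [xw [xwX xwB xwt]] : exists xw, [/\ xw \in X, xw \notin B & tw :&: B != set0 -> xw \in tw].
  have [tB0|tB0] := eqVneq (tw :&: B) set0.
    have : ~~ (X \subset B) by apply: contra BX => XB; rewrite eq_sym eqEcard XB cB cX leqnn.
    by case/subsetPn=> x xX xB; exists x; split=> //; rewrite eqxx.
  have t0 : tw != set0 by apply: contraNneq tB0 => ->; rewrite set0I.
  have /subsetPn[x xt xB] := tB t0; exists x; split=> //; exact: (subsetP tX).
have [P LP] : linkable e (V :\: I) X B.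
  apply: menger_region => // R3 IR3 R3V; rewrite cX; apply: minc => //.
  by apply/set0Pn; exists y; apply: (subsetP IR3); rewrite !inE eqxx.
have [p1 p2 p3] := LP; have [b bP] := choose_mem p2.
have binj : {in X &, injective b}.
  by move=> u v uX vX E; have [h _] := bP u uX; have [h' _] := bP v vX; rewrite E in h; apply: (p3 _ _ (b v)).
have bE : b @: X = B.
  apply/eqP; rewrite eqEcard card_in_imset // cB cX leqnn andbT.
  by apply/subsetP=> _ /imsetP[x xX ->]; have [] := bP x xX.
have bX x : x \in X -> x \in B -> b x = x.
  move=> xX; rewrite -bE => /imsetP[v vX xE]; have [xx _ _] := p1 x xX; have [h _] := bP v vX.
  by rewrite -xE in h; rewrite {2}xE (p3 _ _ _ xX vX xx h).
have [wP wB] := bP xw xwX; set w := b xw in wP wB.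
have wX : w \notin X.
  apply/negP=> wX; have [ww _ _] := p1 w wX; have E := p3 _ _ _ wX xwX ww wP.
  by case/negP: xwB; rewrite -E.
have [bad [adj badc badB]] := third_hub wB wX.
have badX : bad \subset X by clear -badB tX; subs.
have bw s : s \in X -> s != xw -> s \notin bad -> e w (b s).
  move=> sX sx sb; have [_ bB] := bP s sX; apply: adj => //.
    by apply: contraNneq sx => E; apply/eqP; apply: binj.
  apply: contra sb => bb; have bbX := subsetP badX _ bb; have bbB : b s \in B by [].
  by have := bX _ bbX bbB => E; have <- : b s = s by apply: binj.
have badxw a : a \in bad -> e a xw.
  move=> ab; have aB := subsetP badB a ab; rewrite inE in aB; have /andP[at_ aB'] := aB.
  have xt : xw \in tw by apply: xwt; apply/set0Pn; exists a; rewrite inE.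
  by apply: (twin_edge es tt) => //; apply: contraNneq xwB => <-.
move=> S U1 U2 pat; have [SX U1X U2X [d1 d2 d12 cU c2]] := pat.
have SUX : S :|: (U1 :|: U2) \subset X by rewrite !subUset SX U1X.
have UX : U1 :|: U2 \subset X by rewrite subUset U1X.
have adjy a : a \in X -> exists p h, [/\ p \in P a, h \in [set y] & e p h].
  by move=> /bP[h1 h2]; exists (b a), y; rewrite inE eqxx es yB.
have adjz a : a \in X -> exists p h, [/\ p \in P a, h \in [set z] & e p h].
  by move=> /bP[h1 h2]; exists (b a), z; rewrite inE eqxx es zB.
have one h : h \in V :\: X -> [set h] \subset V :\: X by rewrite sub1set.
have set0ne h : [set h] != set0 by apply/set0Pn; exists h; rewrite inE.
have dI h A : h \in I -> A \subset X -> [disjoint [set h] & fam P A].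
  by move=> hI AX; rewrite disjoints1; have := famI_cut LP AX => d; clear -d hI; setat h.
have yI : y \in I by rewrite !inE eqxx.
have zI : z \in I by rewrite !inE eqxx orbT.
have d_yz : [disjoint [set y] & [set z]] by rewrite disjoints1 inE.
have [U1le|U12] := leqP #|U1| 1.
  apply: (hubs_solvable es LP (H0 := [set y]) (H1 := [set z]) (H2 := set0) XV pat) => //.
  - exact: conn1.
  - exact: conn1.
  - exact: one.
  - exact: one.
  - exact: dI.
  - exact: dI.
  - by move=> a /(subsetP SX); exact: adjy.
  - by move=> a /(subsetP UX); exact: adjz.
  - by rewrite ltnNge U1le.
have wF : w \in fam P [set xw] by apply/famP; exists xw; rewrite ?inE.
have xw1 : [set xw] \subset X by rewrite sub1set.
have cPw : conn e (fam P [set xw]) by rewrite /fam big_set1; have [] := p1 xw xwX.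
have wI : w \notin I by have := fam_sub LP xw1 => h; clear -h wF; setat w.
have wV : w \in V :\: X by have := fam_sub LP xw1 => h; clear -h wF wX; setat w.
have adjw a : a \in X -> a != xw -> a \notin bad -> exists p h, [/\ p \in P a, h \in [set w] & e p h].
  by move=> aX ax ab; have [h1 h2] := bP a aX; exists (b a), w; rewrite inE eqxx es bw.
have wne : [disjoint [set y] & [set w]] /\ [disjoint [set w] & [set y]].
  by rewrite [in X in _ /\ X]disjoint_sym disjoints1 inE; split; apply: contraNneq wI => <-.
have wne' : [disjoint [set z] & [set w]] /\ [disjoint [set w] & [set z]].
  by rewrite [in X in _ /\ X]disjoint_sym disjoints1 inE; split; apply: contraNneq wI => <-; rewrite zI.
have [[wne1 wne2] [wne3 wne4]] := (wne, wne').
have yQ := one y Iy; have zQ := one z Iz.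
have pairX V1 V2 u v : V1 \subset X -> V2 \subset X -> u \in V1 -> v \in V2 -> [set u; v] \subset X.
  by move=> V1X V2X uV vV; rewrite subUset !sub1set (subsetP V1X) // (subsetP V2X).
have conn_hub A H : A \subset X -> (forall a, a \in X -> exists p h, [/\ p \in P a, h \in [set H] & e p h]) ->
    conn e (fam P A :|: [set H]).
  by move=> AX adjH; apply: (conn_spokes es LP AX (conn1 e H) (set0ne _ H)) => a /(subsetP AX); exact: adjH.
have dyz A : A \subset X -> [disjoint [set y] :|: [set z] & fam P A].
  by move=> AX; have h1 := dI y A yI AX; have h2 := dI z A zI AX; clear -h1 h2; disj.
(* The link of [xw] ends in [w] and continues by an edge into the link of some [v1] outside [bad].
   This pair needs no hub, which leaves [y] for [S] and [z] for the other pair. *)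
have direct V1 V2 : pattern X S V1 V2 -> 1 < #|V1| -> xw \in V1 -> solvable e V X S V1 V2.
  move=> pat' k1 xwV; have [_ V1X V2X [e1 e2 e12 cV k2]] := pat'.
  have /subsetPn[v1 v1V v1b] : ~~ (V2 \subset bad).
    by apply/negP=> /subset_leq_card; move: badc k1; rewrite cV; clear; lia.
  have v1X := subsetP V2X v1 v1V.
  have v1w : v1 != xw by apply: contraTneq v1V => ->; clear -xwV e12; setat xw.
  apply: (fam_solvable2 LP (u1 := xw) (v1 := v1) (H0 := [set y]) (H1 := set0) (H2 := [set z]) XV pat') => //.
  - exact: sub0set.
  - by rewrite disjoint_sym disjoints_subset sub0set.
  - by rewrite disjoints_subset sub0set.
  - by rewrite set0U dyz // !subUset SX V1X.
  - exact: conn_hub.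
  - rewrite setU0 famU setUC; apply: (conn_spokes es LP) => //; first by rewrite sub1set.
      by apply/set0Pn; exists w.
    by move=> a; rewrite inE => /eqP->; have [h1 h2] := bP v1 v1X; exists (b v1), w; rewrite es bw.
  - by move=> u2 v2 u2V v2V; apply: conn_hub => //; exact: (pairX V1 V2).
have [xU1|xU1] := boolP (xw \in U1); first exact: direct.
have [xU2|xU2] := boolP (xw \in U2).
  apply: solvable_swap => //; apply: direct => //; [exact: pattern_swap | by rewrite -cU].
(* The links of [S] are joined at [w], with an exceptional vertex attached to [xw] by the edge of
   the twin; [y] and [z] are free for the pairs. *)
have [xS|xS] := boolP (xw \in S).
  have /card_gt0P[a1 a1U] : 0 < #|U1| by apply: ltnW.
  have /card_gt0P[v1 v1U] : 0 < #|U2| by rewrite -cU; apply: ltnW.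
  apply: (fam_solvable2 LP (u1 := a1) (v1 := v1) (H0 := set0) (H1 := [set y]) (H2 := [set z]) XV pat) => //.
  - exact: sub0set.
  - by rewrite disjoints_subset sub0set.
  - by rewrite disjoints_subset sub0set.
  - by rewrite set0U dyz.
  - rewrite setU0 -(setD1K xS) famU setUC; apply: (conn_spokes es LP) => //.
    + by apply: subset_trans (subsetDl _ _) SX.
    + by apply/set0Pn; exists w.
    move=> s; rewrite in_setD1 => /andP[sx sS]; have sX := subsetP SX s sS.
    have [sb|sb] := boolP (s \in bad).
      exists s, xw; split; [by have [] := p1 s sX | | exact: badxw].
      by apply: (subsetP (fam_self LP xw1)); rewrite inE.
    by have [h1 h2] := bP s sX; exists (b s), w; rewrite es bw.
  - by apply: conn_hub => //; exact: (pairX U1 U2).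
  - by move=> u2 v2 u2V v2V; apply: conn_hub => //; exact: (pairX U1 U2).
have dw : [disjoint [set w] & fam P (S :|: (U1 :|: U2))].
  rewrite disjoints1; have d : [disjoint [set xw] & S :|: (U1 :|: U2)].
    by rewrite disjoints1 !inE !negb_or xS xU1.
  by have := fam_disj LP xw1 SUX d => d'; clear -d' wF; setat w.
have xwU a : a \in U1 :|: U2 -> a != xw.
  by move=> aU; apply: contraTneq aU => ->; rewrite inE negb_or xU1.
have xwS a : a \in S -> a != xw by move=> aS; apply: contraTneq aS => ->.
have wQ := one w wV.
(* The link of [xw] is free, so [w] is a proper hub, for [S] or for a pair. The set [bad] has at
   most one vertex, so it misses [S] or both U1 and U2, and [w] serves accordingly. *)
have [sb|/set0Pn[x0]] := eqVneq (S :&: bad) set0.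
  apply: (hubs_solvable es LP (H0 := [set w]) (H1 := [set y]) (H2 := [set z]) XV pat) => //.
  - exact: conn1.
  - exact: conn1.
  - exact: dI.
  - move=> a aS; apply: adjw; [exact: (subsetP SX) | exact: xwS | by clear -sb aS; setat a].
  - by move=> a /(subsetP UX); exact: adjy.
  move=> _; split=> //; [exact: conn1 | by split=> //; exact: dI |].
  by move=> a /(subsetP UX); exact: adjz.
rewrite inE => /andP[x0S x0b].
apply: (hubs_solvable es LP (H0 := [set y]) (H1 := [set w]) (H2 := [set z]) XV pat) => //.
- exact: conn1.
- exact: conn1.
- exact: dI.
- by move=> a /(subsetP SX); exact: adjy.
- move=> a aU; apply: adjw; [exact: (subsetP UX) | exact: xwU |].
  apply/negP=> ab; have ne : a != x0 by apply: contraTneq aU => ->; clear -x0S d1 d2; setat x0.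
  by have := card1_neq ab x0b ne; move: badc; clear; lia.
move=> _; split=> //; [exact: conn1 | by split=> //; exact: dI |].
by move=> a /(subsetP UX); exact: adjz.
Qed.
End Exceptional.
End Exc.

(** * The linkage theorem *)

Section Fin.
Variable T : finType.
Implicit Types (e : rel T) (B C V R S U X Q I tw : {set T}) (x y : T).

(** With at most two boundary vertices, a pattern has either no pair or a single pair and empty [S];
    connectedness of [I] is enough in both cases. *)
Lemma small_boundary_linked e I B : symmetric e -> [disjoint I & B] ->
  (forall b, b \in B -> exists2 y, y \in I & e b y) ->
  (forall R, R != set0 -> R \subset I -> R != I -> #|B| < #|nb e (I :|: B) R|) ->
  #|B| <= 2 -> linked e (I :|: B) B.
Proof.
move=> es dIB hB big B2 S U1 U2 pat; have [SB U1B U2B [d1 d2 d12 cU c2]] := pat.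
have [U10|U1n] := posnP #|U1|.
  have [-> ->] : U1 = set0 /\ U2 = set0.
    by split; apply/eqP; rewrite -cards_eq0 -?cU U10.
  exact: local_solvable0.
have cSUU : #|S| + (#|U1| + #|U2|) <= #|B|.
  have := subset_leq_card (_ : S :|: (U1 :|: U2) \subset B).
  rewrite !subUset SB U1B U2B => /(_ isT).
  rewrite cardsU (_ : S :&: _ = set0) ?cards0; last by clear -d1 d2; seteq.
  by rewrite cardsU (disjoint_setI0 d12) cards0 !subn0.
have /eqP/cards1P[u uE] : #|U1| = 1 by move: cSUU cU U1n B2; clear; lia.
have /eqP/cards1P[v vE] : #|U2| = 1 by move: cSUU cU U1n B2; clear; lia.
have S0 : S = set0 by apply/eqP; rewrite -cards_eq0; move: cSUU cU U1n B2; clear; lia.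
have uB : u \in B by apply: (subsetP U1B); rewrite uE inE.
have vB : v \in B by apply: (subsetP U2B); rewrite vE inE.
have cI := local_conn big.
have [yu yuI uy] := hB u uB; have [yv yvI vy] := hB v vB.
rewrite S0 uE vE; apply: (solvable1 (T0 := set0) (C := I :|: [set u; v])).
- exact: conn0.
- exact: subxx.
- exact: sub0set.
- apply: (conn_cover cI); [exact: subsetUl | by apply/set0Pn; exists yu |].
  move=> b; rewrite in_setU => /orP[bI|]; first by rewrite bI.
  move=> /set2P[]-> _; [exists [set u; yu] | exists [set v; yv]]; split; try exact: conn2.
  + by rewrite subUset !sub1set !inE eqxx yuI !orbT.
  + by rewrite !inE eqxx.
  + by exists yu; rewrite ?inE ?eqxx ?orbT.
  + by rewrite subUset !sub1set !inE eqxx yvI !orbT.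
  + by rewrite !inE eqxx.
  + by exists yv; rewrite ?inE ?eqxx ?orbT.
- by rewrite !inE eqxx orbT.
- by rewrite !inE eqxx !orbT.
- have uvB : [set u; v] \subset B by rewrite subUset !sub1set uB.
  by clear -uvB dIB; subs.
- by clear; disj.
Qed.

(* The counting bound is tight when [I] is small. *)
Lemma rich_complete e tw I B c x y : symmetric e -> irreflexive e -> rich c e tw I B ->
  x \in B -> x \notin tw -> y \in I -> e x y -> #|I| <= 2 -> #|B| <= c ->
  [/\ #|I| = 2, #|B| = c, forall b, b \in B -> e y b, #|tw :&: B| <= 1
    & exists z, [/\ z \in I, e x z & e y z]].
Proof.
move=> es ei hf xB xt yI xy I2 Bc; have := hf x y xB xt yI xy.
set a := #|_ :&: I|; set b := #|_ :\: tw|; set k := (_ != _ : nat) => h.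
have ha : a <= #|I :\ y|.
  apply: subset_leq_card; apply/subsetP=> t; rewrite !inE => /andP[/andP[xt' yt] ->].
  by rewrite andbT; apply: contraTneq yt => ->; rewrite ei.
have cI := cardsD1 y I; rewrite yI in cI.
have cN := cardsID tw ((Nb e y :&: B) :\ x).
have tE : ((Nb e y :&: B) :\ x) :&: tw = Nb e y :&: B :&: tw.
  by apply/setP=> t; rewrite !inE; case: eqVneq => [->|//]; rewrite (negPf xt) /= !andbF.
have hk : k <= #|Nb e y :&: B :&: tw|.
  by rewrite /k; case: (eqVneq _ set0) => [//|nz]; rewrite card_gt0.
have k1 : k <= 1 by rewrite /k; case: (_ != _).
have sub : (Nb e y :&: B) :\ x \subset B :\ x by rewrite setSD // subsetIr.
have cB := cardsD1 x B; rewrite xB in cB.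
have le := subset_leq_card sub; rewrite tE -/b in cN.
have E : (Nb e y :&: B) :\ x = B :\ x.
  by apply/eqP; rewrite eqEcard sub; move: h ha cI cN hk le cB I2 Bc; clear; lia.
have yall t : t \in B -> e y t.
  move=> tB; have [->|tx] := eqVneq t x; first by rewrite es.
  by have : t \in B :\ x; [rewrite in_setD1 tx | rewrite -E !inE => /and3P[]].
have a0 : 0 < a by move: h ha cI cN hk le cB I2 Bc; clear; lia.
split.
- by move: h ha cI cN hk le cB I2 Bc; clear; lia.
- by move: h ha cI cN hk le cB I2 Bc; clear; lia.
- exact: yall.
- have t1 : tw :&: B = Nb e y :&: B :&: tw.
    apply/setP=> t; rewrite !inE; case tB: (t \in B); rewrite ?andbF //= andbT.
    by rewrite yall.
  by rewrite t1; move: h ha cI cN hk le cB I2 Bc k1; rewrite E; clear; lia.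
have /card_gt0P[z] := a0; rewrite !inE => /andP[/andP[xz yz] zI]; by exists z.
Qed.

Theorem admissible_linked c e V X tw : symmetric e -> irreflexive e -> admissible c e V X tw -> linked e V X.
Proof.
move: {-1}_.+1 (ltnSn #|V :\: X|) => n; elim: n e V X tw => // n IHn e V X tw nlt es ei cl.
have IH : @linked_below T c #|V :\: X|.
  move=> e' V' X' tw' es' ei' cl' lt; apply: (IHn _ _ _ tw') => //; exact: leq_trans lt nlt.
apply: NNPP => nl; have [XV Xc [tt tX] dens spar] := cl.
have ineq x y := @contraction_ineq _ c e V X tw x y es ei cl IH nl.
have norig R := @no_rigid _ c e V X tw R es ei cl IH nl.
have Q0 : V :\: X != set0.
  apply/eqP=> Q0; move: dens; rewrite /dense Q0 /E2 (_ : epairs _ _ _ = set0) ?cards0 ?ltn0 //.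
  by apply/setP=> -[u v]; rewrite !inE !andbF.
(* A rigid [I] is impossible, so it remains to link [I] to its boundary, except when it has two
   vertices and [X] is linked directly. *)
have [I [I0 IV BX minB propB]] := min_cut e Q0 XV.
set B := nb e V I in BX minB propB.
have hf : rich c e tw I B by apply: (common_neighbours es ei XV tt tX IV ineq).
have dIB : [disjoint I & B] by rewrite disjoint_sym; exact: nb_disj.
have hB b : b \in B -> exists2 y, y \in I & e b y.
  by move=> /nbP[_ [_ [z zI zb]]]; exists z; rewrite // es.
have Bc := leq_trans BX Xc.
have sV : I :|: B \subset V by rewrite subUset nb_subV andbT; apply: subset_trans IV (subsetDl _ _).
have big R : R != set0 -> R \subset I -> R != I -> #|B| < #|nb e (I :|: B) R|.
  by move=> R0 RI Rn; rewrite (nb_sub_within RI (subxx _) sV); exact: propB.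
have nlB : ~ linked e (I :|: B) B by move=> lB; apply: (norig I).
(* Past this case [B] is larger than the twin, so richness applies to some boundary vertex. *)
have [B2|B3] := leqP #|B| 2; first by apply: nlB; apply: small_boundary_linked.
have [I2|I3] := leqP #|I| 2; last by apply: nlB; apply: (local_linked es ei dIB hB big I3 Bc tt hf).
have t2 : #|tw| <= 2.
  by case: tt => [->|[x0 [y0 [-> _ _]]]]; rewrite ?cards0 // cards2; case: (_ != _).
have /subsetPn[x xB xt] : ~~ (B \subset tw).
  by apply/negP=> /subset_leq_card; move: B3 t2; clear; lia.
have [y yI xy] := hB x xB.
have [cI cB yB tB [z [zI xz yz]]] := rich_complete es ei hf xB xt yI xy I2 Bc.
have [_ _ zB _ _] := rich_complete es ei hf xB xt zI xz I2 Bc.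
have yzne : y != z by apply: contraTneq yz => ->; rewrite ei.
have IE : I = [set y; z].
  by apply/esym/eqP; rewrite eqEcard subUset !sub1set yI zI cI cards2 yzne.
have cX : #|X| = c by apply/eqP; rewrite eqn_leq Xc -{1}cB.
apply: nl; rewrite /B IE in IV B3 yB zB cB minB tB.
apply: (pair_region es ei XV tt tX yzne IV yB zB cB cX _ _ ineq dens).
  move=> t0; apply: contraL tB => /setIidPl->; rewrite -ltnNge.
  by case: tt => [E|[x0 [y0 [-> xy0 _]]]]; [rewrite E eqxx in t0 | rewrite cards2 xy0].
by move=> R R0 RV; rewrite -cB; apply: minB.
Qed.
End Fin.

(** * Highly connected graphs *)

Section Main.
Variable T : finType.
Implicit Types (e : rel T) (A R U X Q K : {set T}) (x y : T) (P : T -> {set T}).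

Lemma k_connected_closed e k R : k_connected e k -> R != set0 -> #|nb e setT R| < k ->
  ~: nb e setT R \subset R.
Proof.
move=> [_ kc] R0 lt; have [cD] := induced_conn (kc _ lt).
apply: cD => //; first by have := nb_disj e setT R => h; subs.
move=> x y xR; rewrite inE => yn xy; apply: contraT => yR; case/negP: yn.
by apply: (nb_in xR); rewrite ?inE.
Qed.

Lemma k_connected_degree e k x : irreflexive e -> k_connected e k -> k <= #|Nb e x|.
Proof.
move=> ei kc; rewrite leqNgt; apply/negP=> lt; have [kT _] := kc.
have nE : nb e setT [set x] = Nb e x.
  apply/setP=> y; rewrite [in RHS]inE; apply/idP/idP => [/nbP[_ [_ [z]]]|xy].
    by rewrite inE => /eqP->.
  apply: (@nb_in _ _ _ _ x); rewrite ?inE //; by apply: contraTneq xy => ->; rewrite ei.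
have x0 : [set x] != set0 by apply/set0Pn; exists x; rewrite inE.
have := k_connected_closed kc x0; rewrite nE => /(_ lt)/subset_leq_card.
rewrite cards1; have := cardsC (Nb e x); rewrite -cardsT; move: lt kT; rewrite cardsT; clear; lia.
Qed.

Lemma card_pairs e Q : #|[set p : T * T | (p.1 \in Q) && e p.1 p.2]| = \sum_(r in Q) #|Nb e r|.
Proof.
rewrite -sum1dep_card -(pair_big_dep (mem Q) (fun r s => e r s) (fun _ _ => 1)) /=.
by apply: eq_bigr => r _; rewrite sum1dep_card.
Qed.

(** Each vertex outside [X] starts at least 2 * c ordered pairs. A vertex of [X] has more than [c]
    neighbours outside [X], and the pairs it starts supply the strict excess, including the last
    summand of [dense]. A region with a boundary smaller than [X] would leave no room for [X], so
    sparsity is vacuous. *)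
Lemma k_connected_admissible e c X : symmetric e -> irreflexive e -> k_connected e (2 * c) -> 1 < c ->
  X != set0 -> #|X| <= c -> admissible c e setT X set0.
Proof.
move=> es ei kc c1 /set0Pn[x xX] Xc; split=> //.
- by split; [left | exact: sub0set].
- rewrite /dense twin_set0 setTD; set Q := ~: X.
  have deg r : 2 * c <= #|Nb e r| by apply: k_connected_degree.
  have h1 : 2 * c * #|Q| <= #|[set p : T * T | (p.1 \in Q) && e p.1 p.2]|.
    rewrite card_pairs mulnC -sum_nat_const; apply: leq_sum => r _; exact: deg.
  have h2 : c < #|Nb e x :&: Q|.
    have := cardsID Q (Nb e x); have := deg x.
    have : #|Nb e x :\: Q| <= #|X :\ x|.
      apply: subset_leq_card; apply/subsetP=> t; rewrite !inE negbK => /andP[-> xt]; rewrite andbT.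
      by apply: contraTneq xt => ->; rewrite ei.
    by have := cardsD1 x X; rewrite xX; move: Xc; clear; lia.
  pose F := [set (x, t) | t in Nb e x :&: Q].
  have cF : #|F| = #|Nb e x :&: Q| by rewrite card_imset // => a b [].
  have dF : [disjoint [set p : T * T | (p.1 \in Q) && e p.1 p.2] & F].
    apply: disjointI => -[a b]; rewrite inE /= => /andP[aQ _] /imsetP[t _ [ax _]].
    by move: aQ; rewrite ax inE xX.
  have sub : [set p : T * T | (p.1 \in Q) && e p.1 p.2] :|: F \subset epairs e setT Q.
    apply/subsetP=> -[a b]; rewrite in_setU => /orP[|/imsetP[t tN [-> ->]]].
      by rewrite !inE /= => /andP[-> ->].
    by move: tN; rewrite !inE /= => /andP[-> ->]; rewrite orbT.
  have := subset_leq_card sub; rewrite cardsU (disjoint_setI0 dF) cards0 subn0 cF /E2.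
  move: h1 h2 c1; rewrite eqxx /= muln0 addn0.
  move: (2 * c * #|Q|) #|[set p | _]| #|Nb e x :&: Q| #|epairs _ _ _| (leq_b1 (#|X| == c)) => a b d f; clear; lia.
move=> R R0 RX lt; have lt2 : #|nb e setT R| < 2 * c by move: lt Xc; clear; lia.
have h := k_connected_closed kc R0 lt2.
suff : X \subset nb e setT R by move/subset_leq_card; rewrite leqNgt lt.
by apply/subsetP=> t tX; apply: contraT => tn; clear -h RX tX tn; setat t.
Qed.

Lemma next_mid (p q : seq T) (a b : T) : uniq (p ++ a :: b :: q) -> next (p ++ a :: b :: q) a = b.
Proof.
move=> u; rewrite next_nth mem_cat inE eqxx orbT.
have ap : a \notin p.
  move: u; rewrite cat_uniq /= => /and3P[_ /norP[h _] _]; exact: h.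
case: p u ap => [|y p] u ap /=; first by rewrite eqxx.
move: ap; rewrite inE negb_or eq_sym => /andP[/negPf-> ap].
by rewrite index_cat (negPf ap) /= eqxx addn0 nth_cat ltnNge leqnSn /= subSn // subnn.
Qed.

Lemma next_wrap (p : seq T) x y : uniq (x :: rcons p y) -> next (x :: rcons p y) y = x.
Proof.
move=> u; rewrite next_nth inE mem_rcons inE eqxx orbT /=.
have yp : y \notin x :: p by move: u; rewrite -rcons_cons rcons_uniq => /andP[].
move: yp; rewrite inE negb_or eq_sym => /andP[/negPf-> yp].
by rewrite -cats1 index_cat (negPf yp) /= eqxx addn0 nth_default // size_cat /= addn1.
Qed.

Lemma set2_eqP (x y u v : T) : [set x; y] = [set u; v] -> (x = u /\ y = v) \/ (x = v /\ y = u).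
Proof.
move=> E.
have /set2P xP : x \in [set u; v] by rewrite -E set21.
have /set2P yP : y \in [set u; v] by rewrite -E set22.
have /set2P uP : u \in [set x; y] by rewrite E set21.
have /set2P vP : v \in [set x; y] by rewrite E set22.
by case: xP yP uP vP => -> [] -> [] ? [] ?; subst; auto.
Qed.

Lemma cycle_edge_set2 (s : seq T) x y u v : cycle_edge s x y -> [set x; y] = [set u; v] -> cycle_edge s u v.
Proof.
move=> h /set2_eqP[[<- <-]|[<- <-]] //.
by move: h; rewrite /cycle_edge [(x \in s) && _]andbC orbC.
Qed.

Lemma card_edge e x y : irreflexive e -> e x y -> #|[set x; y]| = 2.
Proof. by move=> ei; rewrite cards2; case: eqVneq => [->|//]; rewrite ei. Qed.

Lemma card_edge_meet e x y u v : irreflexive e -> e x y -> e u v -> [set x; y] != [set u; v] ->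
  #|[set x; y] :&: [set u; v]| <= 1.
Proof.
move=> ei xy uv ne; rewrite leqNgt; apply: contra ne => gt.
have E1 : [set x; y] :&: [set u; v] = [set x; y] by apply/eqP; rewrite eqEcard subsetIl (card_edge ei xy).
have E2' : [set x; y] :&: [set u; v] = [set u; v] by apply/eqP; rewrite eqEcard subsetIr (card_edge ei uv).
by rewrite -E1 E2'.
Qed.

Lemma paths_cycle e x (p : seq T) y (q : seq T) : symmetric e -> path e x p -> path e y q -> uniq ((x :: p) ++ (y :: q)) ->
  e x y -> e (last x p) (last y q) -> [set x; y] != [set last x p; last y q] ->
  let s := (x :: p) ++ rev (y :: q) in
  [/\ is_cycle e s, cycle_edge s x y, cycle_edge s (last x p) (last y q) & s =i (x :: p) ++ (y :: q)].
Proof.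
move=> es xp yq u xy ll ne s.
have sE : s =i (x :: p) ++ (y :: q) by move=> z; rewrite !mem_cat mem_rev.
have us : uniq s by rewrite -(perm_uniq (s1 := (x :: p) ++ (y :: q))) // perm_cat2l perm_sym perm_rev.
have s1 : s = x :: rcons (p ++ rev q) y by rewrite /s rev_cons /= rcons_cat.
have s2 : s = belast x p ++ last x p :: last y q :: rev (belast y q).
  by rewrite /s lastI (lastI y q) rev_rcons cat_rcons.
have cyc : cycle e s.
  rewrite s1 /= rcons_path last_rcons es xy andbT.
  have -> : rcons (p ++ rev q) y = p ++ last y q :: rev (belast y q).
    by rewrite rcons_cat -rev_cons lastI rev_rcons.
  rewrite cat_path xp /= ll /=.
  rewrite rev_path; apply: sub_path yq => a b; by rewrite es.
split=> //.
- split; last by rewrite /ucycle cyc.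
  (* Two one-vertex paths would have the same pair of first and of last vertices, which [ne]
     excludes; so the cycle has at least three vertices. *)
  rewrite size_cat size_rev; move: ne; clear; case: p => [|a p]; case: q => [|b q]; rewrite /= ?eqxx //; lia.
- apply/andP; split; first by rewrite !sE !mem_cat !inE !eqxx !orbT.
  by rewrite s1 next_wrap ?eqxx ?orbT // -s1.
apply/andP; split; first by rewrite !sE !mem_cat !mem_last !orbT.
by rewrite s2 next_mid ?eqxx // -s2.
Qed.


(* A largest connected set whose deletion keeps the ends linked leaves only two disjoint paths,
   which the two edges close up. *)
Lemma linked_edges_cycle e k K0 u1 v1 u2 v2 : symmetric e -> irreflexive e ->
  k_connected e k -> 4 < k -> e u1 v1 -> e u2 v2 -> [set u1; v1] != [set u2; v2] ->
  K0 != set0 -> conn e K0 -> K0 \subset ~: ([set u1; v1] :|: [set u2; v2]) ->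
  linkable e (~: K0) [set u1; v1] [set u2; v2] ->
  exists s, [/\ is_cycle e s, all (fun x => x \notin K0) s, cycle_edge s u1 v1, cycle_edge s u2 v2
    & induced_connected e [set x | x \notin s]].
Proof.
move=> es ei kc k4 e1 e2 ne K00 cK0 K0U l0.
set U1 := [set u1; v1] in ne K0U l0 *; set U2 := [set u2; v2] in ne K0U l0 *.
have c1 : #|U1| = 2 := card_edge ei e1.
have c2 : #|U2| = 2 := card_edge ei e2.
pose good K := [/\ K0 \subset K, conn e K, K \subset ~: (U1 :|: U2) & linkable e (setT :\: K) U1 U2].
have [K [[K0K cK KU lK] maxK]] : exists K, good K /\ forall K', good K' -> #|K'| <= #|K|.
  by apply: (@ex_max_card _ good K0); split; rewrite ?setTD.
have /set0Pn[k0 k0K0] := K00; have k0K := subsetP K0K k0 k0K0.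
have crit : forall n, n \in setT :\: K :\: (U1 :|: U2) -> ~ linkable e (setT :\: K :\ n) U1 U2.
  apply: rest_critical => //; rewrite ?c1 ?c2 ?setTD //.
    move=> n t nM tK tn lk.
    have nK : n \notin K by clear -nM; setat n.
    have nU : n \notin U1 :|: U2 by clear -nM; setat n.
    have : #|n |: K| <= #|K|; last by rewrite cardsU1 nK /= ltnn.
    apply: maxK; split; [by clear -K0K; subs | exact: (conn_add1 es cK tK tn) | |].
      by rewrite subUset sub1set inE nU.
    by apply: linkable_mono lk; clear; subs.
  (* A region whose boundary has at most four vertices would, as 4 < k, together with this boundary
     cover the graph; but [k0] lies in neither. *)
  move=> R R0 RM nbK; rewrite ltnNge; apply/negP=> le.
  have h := k_connected_closed kc R0 (leq_ltn_trans le k4).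
  by clear -h nbK RM k0K; setat k0.
have [P1 [P2 PP]] := linkable_path_pair (etrans c1 (esym c2)) (eq_leq c1) lK.
have [[s1 s2] u sM hE lE] := PP.
have KE : [set x in P1 ++ P2] = ~: K.
  apply/eqP; rewrite eqEsubset -setTD sM /=; apply/subsetP=> n nM; rewrite in_set; apply: contraT => nP.
  have n1 : n \notin U1 :|: U2.
    have h1 := heads_sub P1; have h2 := heads_sub P2; have h3 := lasts_sub P1; have h4 := lasts_sub P2.
    have nP' : n \notin [set x in P1] :|: [set x in P2] by rewrite -set_cat in_set.
    by rewrite hE lE; clear -h1 h2 h3 h4 nP'; setat n.
  by exfalso; apply: (crit n); [rewrite in_setD n1 | exact: (path_pair_avoid es PP)].
have [cP _] := path_pair_card PP; rewrite c1 in cP.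
case: P1 P2 PP s1 s2 u sM hE lE KE cP => [|x p] [|y q] //= PP s1 s2 u sM hE lE KE _.
have exy : e x y.
  by case: (set2_eqP hE) => -[<- <-] //; rewrite es.
have ell : e (last x p) (last y q).
  by case: (set2_eqP lE) => -[<- <-] //; rewrite es.
have ne' : [set x; y] != [set last x p; last y q] by rewrite -hE -lE.
have [cs ce1 ce2 sE] := paths_cycle es s1 s2 u exy ell ne'.
set s := (x :: p) ++ rev (y :: q) in cs ce1 ce2 sE.
have sK z : (z \in s) = (z \notin K).
  by rewrite sE; have /setP/(_ z) := KE; rewrite in_set in_setC.
exists s; split=> //.
- by apply/allP=> z; rewrite sK; apply: contra; exact: (subsetP K0K).
- by apply: cycle_edge_set2 ce1 _.
- by apply: cycle_edge_set2 ce2 _.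
have -> : [set z | z \notin s] = K by apply/setP=> z; rewrite inE sK negbK.
by move=> a b aK bK; exact: conn_connect.
Qed.
End Main.

Theorem mainTheorem3 (T : finType) (e : rel T)
  (e_sym : symmetric e) (e_irr : irreflexive e)
  (m : nat) (hm : 1 <= m)
  (hconn : k_connected e (2 * m + 8))
  (u1 v1 u2 v2 : T) (he1 : e u1 v1) (he2 : e u2 v2)
  (hdist : [set u1; v1] != [set u2; v2])
  (A : {set T}) (hA : #|A| = m)
  (hAdisj : [disjoint A & [set u1; v1; u2; v2]]) :
  exists c : seq T,
    [/\ is_cycle e c,
        all (fun x => x \notin A) c,
        cycle_edge c u1 v1,
        cycle_edge c u2 v2 &
        induced_connected e [set x | x \notin c]].
Proof.
set U1 := [set u1; v1] in hdist; set U2 := [set u2; v2] in hdist.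
have UE : [set u1; v1; u2; v2] = U1 :|: U2 by rewrite /U2 setUA.
rewrite UE in hAdisj; pose X := A :|: (U1 :|: U2).
have c1 : #|U1| = 2 := card_edge e_irr he1.
have c2 : #|U2| = 2 := card_edge e_irr he2.
have c12 : #|U1 :&: U2| <= 1 by apply: (card_edge_meet e_irr he1 he2).
have A0 : A != set0 by rewrite -card_gt0 hA.
have kc : k_connected e (2 * (m + 4)) by rewrite mulnDr.
have cX : #|X| <= m + 4.
  apply: leq_trans (leq_card_setU _ _) _; rewrite hA leq_add2l.
  by apply: leq_trans (leq_card_setU _ _) _; rewrite c1 c2.
have lX : linked e setT X.
  (* The [m] vertices of [A] and the at most four ends of the two edges give c = m + 4, whence 2 * m
     + 8. *)
  apply: (@admissible_linked _ (m + 4) _ _ _ set0) => //; apply: k_connected_admissible => //; first by clear; lia.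
  by have /set0Pn[a aA] := A0; apply/set0Pn; exists a; rewrite inE aA.
have [K0 [AK cK KX lK]] : exists K0 : {set T}, [/\ A \subset K0, conn e K0, K0 \subset ~: (X :\: A)
   & linkable e (~: K0) U1 U2].
  (* A common end of the two edges cannot belong to both sides of a pattern. It is left out and then
     restored as a link of one vertex. *)
  pose W := U1 :&: U2.
  have WU1 : W \subset U1 by exact: subsetIl.
  have WU2 : W \subset U2 by exact: subsetIr.
  have pat : pattern X A (U1 :\: W) (U2 :\: W).
    split; [by rewrite /X; clear; subs | by rewrite /X; clear; subs | by rewrite /X; clear; subs | split].
    - by clear -hAdisj; disj.
    - by clear -hAdisj; disj.
    - by rewrite /W; clear; disj.
    - by rewrite !cardsD (setIidPr WU1) (setIidPr WU2) c1 c2.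
    - by rewrite -c1 subset_leq_card // subsetDl.
  have [K0 [D [cK AK KX LD]]] := lX _ _ _ pat; exists K0; rewrite -!setTD; split=> //.
  have dW : [disjoint setT :\: K0 :\: (X :\: (U1 :\: W :|: (U2 :\: W))) & W].
    by rewrite /X; clear -WU1 WU2; disj.
  have := linkageU dW (ex_intro _ D LD) (@linkage_id _ e W W W (subxx _) (subxx _)).
  have -> : U1 :\: W :|: W = U1 by clear -WU1; seteq.
  have -> : U2 :\: W :|: W = U2 by clear -WU2; seteq.
  apply: linkable_mono; rewrite /X in KX; clear -WU1 KX hAdisj; subs.
have KU : K0 \subset ~: (U1 :|: U2) by rewrite /X in KX; clear -KX hAdisj; subs.
have K00 : K0 != set0.
  by have /set0Pn[a aA] := A0; apply/set0Pn; exists a; apply: (subsetP AK).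
have [|s [h1 h2 h3 h4 h5]] := linked_edges_cycle e_sym e_irr kc _ he1 he2 hdist K00 cK KU lK.
  by clear -hm; lia.
exists s; split=> //; apply/allP=> z /(allP h2); apply: contra; exact: (subsetP AK).
Qed.
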